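(* Let $n\ge 1$ be an integer, $k\ge \frac{n-1}{2n}$, and let $a,b>0$. Let $f$ be a measurable function on $\mathbb{R}$ such that, for some constant $C>0$, $$|f(x)|\le C\,e^{-na|x|^{2/n}}\quad\text{and}\quad |\mathcal{F}_{k,n}f(x)|\le C\,e^{-nb|x|^{2/n}}\qquad\text{for all }x\in\mathbb{R}.$$ Then: 1. If $ab>\frac14$, then $f=0$ almost everywhere. 2. If $ab=\frac14$, then $f(x)=\lambda\,e^{-na|x|^{2/n}}$ almost everywhere for some constant $\lambda\in\mathbb{C}$. 3. If $ab<\frac14$, there exist infinitely many functions $f$ satisfying both inequalities.
   Context: Fix an integer $n\ge1$ and $k\ge\frac{n-1}{2n}$, and put $\alpha=kn-\frac n2$. For $\beta>-1$ the normalized Bessel function is $j_\beta(z)=\Gamma(\beta+1)\sum_{m\ge0}\frac{(-1)^m}{m!\,\Gamma(\beta+m+1)}\left(\frac z2\right)^{2m}$ (an entire even function). The measure $\mu_{k,n}$ on $\mathbb{R}$ is $$d\mu_{k,n}(x)=\frac{1}{2\Gamma(kn-\frac n2+1)}\left(\frac n2\right)^{kn-\frac n2}|x|^{2k+\frac2n-2}\,dx,$$ and $L^p_{k,n}=L^p(\mathbb{R},d\mu_{k,n})$. The kernel is $$B_{k,n}(x,\lambda)=j_\alpha\big(n|\lambda x|^{1/n}\big)+(-i)^n\left(\frac n2\right)^n\frac{\Gamma(\alpha+1)}{\Gamma(\alpha+n+1)}\,\lambda x\, j_{\alpha+n}\big(n|\lambda x|^{1/n}\big),$$ and the one-dimensional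 $(k,\frac2n)$-generalized Fourier transform of $f\in L^1_{k,n}$ is $\mathcal{F}_{k,n}f(\lambda)=\int_{\mathbb{R}} f(x)B_{k,n}(x,\lambda)\,d\mu_{k,n}(x)$ (the $(k,a)$-generalized Fourier transform of Ben Saïd–Kobayashi–Ørsted with $a=2/n$); it extends to a unitary operator on $L^2_{k,n}$. *)

(* Defs.v *)
From mathcomp Require Import all_boot all_order all_algebra.
From mathcomp Require Import all_classical all_reals all_analysis.
From mathcomp Require Export complex.
Set Implicit Arguments.
Unset Strict Implicit.
Unset Printing Implicit Defensive.
Import Order.TTheory GRing.Theory Num.Theory.
Import numFieldNormedType.Exports.
Local Open Scope ring_scope.
Local Open Scope classical_set_scope.
Local Open Scope complex_scope.

Section HardyDefs.
Variable R : realType.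

(* Euler Gamma function on the reals: Gamma x = int_0^oo t^(x-1) e^(-t) dt
   (used only for x > 0). *)
Definition Gamma (x : R) : R :=
  Rintegral (@lebesgue_measure R) `]0%R, +oo[
    (fun t => t `^ (x - 1) * expR (- t)).

Definition bessel_term (beta z : R) (m : nat) : R :=
  (-1) ^+ m / ((m`!)%:R * Gamma (beta + m%:R + 1)) * (z / 2) ^+ (2 * m).

Definition bessel_j (beta z : R) : R :=
  Gamma (beta + 1) * limn (series (bessel_term beta z)).

Definition alpha_kn (k : R) (n : nat) : R := k * n%:R - n%:R / 2.

(* density of mu_{k,n} w.r.t. Lebesgue measure *)
Definition w_kn (k : R) (n : nat) (x : R) : R :=
  (2 * Gamma (alpha_kn k n + 1))^-1 * (n%:R / 2) `^ (alpha_kn k n)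
  * `|x| `^ (2 * k + 2 / n%:R - 2).

Definition B_kn (k : R) (n : nat) (x lam : R) : R[i] :=
  let a := alpha_kn k n in
  let z := n%:R * `|lam * x| `^ (n%:R^-1) in
  ((bessel_j a z)%:C
   + (- 'i) ^+ n *
     ((n%:R / 2) ^+ n * (Gamma (a + 1) / Gamma (a + n%:R + 1))
        * lam * x * bessel_j (a + n%:R) z)%:C)%C.

Definition cintegral (g : R -> R[i]) : R[i] :=
  (Rintegral (@lebesgue_measure R) setT (fun x => complex.Re (g x))
   +i* Rintegral (@lebesgue_measure R) setT (fun x => complex.Im (g x)))%C.

Definition F_kn (k : R) (n : nat) (f : R -> R[i]) (lam : R) : R[i] :=
  cintegral (fun x => f x * B_kn k n x lam * (w_kn k n x)%:C).

Definition gauss_n (n : nat) (c x : R) : R :=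
  expR (- (n%:R * c * `|x| `^ (2 / n%:R))).

Definition cmeasurable (f : R -> R[i]) : Prop :=
  measurable_fun setT (fun x => complex.Re (f x)) /\
  measurable_fun setT (fun x => complex.Im (f x)).

Definition hardy_decay (n : nat) (k a b : R) (f : R -> R[i]) : Prop :=
  cmeasurable f /\
  exists C : R, 0 < C /\
    (forall x : R, `|f x| <= (C * gauss_n n a x)%:C) /\
    (forall x : R, `|F_kn k n f x| <= (C * gauss_n n b x)%:C).

End HardyDefs.

(* Main.v *)
Require Import Defs.
From mathcomp Require Import all_boot all_order all_algebra.
From mathcomp Require Import all_classical all_reals all_analysis.
From mathcomp Require Import complex.
From mathcomp Require Import measurable_realfun ring lra.
Import Order.TTheory GRing.Theory Num.Theory.
Import numFieldNormedType.Exports.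
Local Open Scope ring_scope.
Local Open Scope complex_scope.
Set Implicit Arguments.
Unset Strict Implicit.
Unset Printing Implicit Defensive.

(** For [|f| <= C gauss] the transform splits into its even and odd parts in the
    spectral variable, each a Hankel-type transform [F t] of [t = |x|^(2/n)].
    Expanding the Bessel function, the Gaussian decay of [f] bounds the [m]-th
    coefficient of [F] by [C' sigma^m / m!], so [F] is entire of exponential type
    [sigma]; the decay of the transform says [|F t| <= C exp (- sigma t)] on the
    positive axis when [ab = 1/4].  By Phragmen-Lindelof and Liouville
    [F t = F 0 * exp (- sigma t)] (and the odd part vanishes), i.e. the moments of
    [f] in [|x|^(2/n)] are those of a multiple of the Gaussian.  These moments are
    determinate: the Laplace transform of the difference vanishes near [0], hence
    so do its integrals against functions of [exp (- delta y)], which approximate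
    indicators of half-lines, and Lebesgue differentiation concludes.  Complex
    function theory is replaced by polynomials: the maximum principle and Cauchy's
    estimate are averages over roots of unity, and [exp z] is [(1 + z / M) ^ M].
    The case [ab > 1/4] is the critical case with a smaller [a]; the case
    [ab < 1/4] is witnessed by multiples of the Gaussian. *)

(** Where criticality comes from: the moments of the weighted Gaussian in [|x|^(2/n)] involve the
    rising factorial of [(s0 + 1) / q], with [q = 2/n] and [s0] the weight exponent. This number
    equals [alpha + 1], the parameter in the denominators of the even Bessel series, so the two
    cancel and leave the type [sigma = n / (4 a)]. It equals [n b] exactly when [ab = 1/4]. The
    obstacle is that decay is known on one ray only. [F t * exp (sigma t)] is bounded on both
    half-axes, but a half-plane is the borderline opening for order 1. Hence sectors of opening pi -
    2 pi / (N + 1) are used, with [exp ((1 + i c) t)] (after scaling [sigma] to 1), tilted just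
    enough to absorb the growth on the outer ray; then N tends to infinity and c to 0. The
    substitution [t = z ^ N] turns the damping exponent, a fractional power of [t], into a multiple
    of [z ^ (N + 1)], so that polynomials suffice. The odd part carries an extra factor
    [|lambda| = t ^ (n / 2)]; its product with a nonzero multiple of [exp (- sigma t)] exceeds every
    bound [C * exp (- sigma t)]. *)

Section ComplexNorm.
Variable R : realType.
Implicit Types (x y r t : R) (z w u : R[i]).
Local Notation Re := complex.Re.
Local Notation Im := complex.Im.

(** * Real-valued modulus, bounds for [(1 + u / n) ^ n], averages over roots of unity *)

Lemma bernoulli_le t m : 0 <= t <= 1 -> 1 - m%:R * t <= (1 - t) ^+ m.
Proof.
move=> /andP[t0 t1]; elim: m => [|m IH]; first by rewrite expr0 mul0r subr0.
rewrite exprS; apply: le_trans (_ : _ <= (1 - t) * (1 - m%:R * t)) _; last first.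
  by rewrite ler_wpM2l ?subr_ge0.
have : 0 <= m%:R * t * t by rewrite !mulr_ge0.
by rewrite -addn1 natrD; lra.
Qed.

(** The norm of [R[i]] takes its values in [R[i]]; a real-valued copy keeps all inequalities and
    limits in [R]. *)
Definition nrm z : R := Num.sqrt (Re z ^+ 2 + Im z ^+ 2).

Lemma nrmE z : `|z| = (nrm z)%:C.
Proof. exact: normc_def. Qed.

Lemma nrm_ge0 z : 0 <= nrm z.
Proof. exact: sqrtr_ge0. Qed.

Lemma nrm_sqr z : nrm z ^+ 2 = Re z ^+ 2 + Im z ^+ 2.
Proof. by rewrite sqr_sqrtr// addr_ge0// sqr_ge0. Qed.

Lemma nrmM z w : nrm (z * w) = nrm z * nrm w.
Proof. by apply: complexI; rewrite rmorphM/= -!nrmE normrM. Qed.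

Lemma nrm1 : nrm 1 = 1.
Proof. by apply: complexI; rewrite -nrmE normr1. Qed.

Lemma nrmX z n : nrm (z ^+ n) = nrm z ^+ n.
Proof. by elim: n => [|n IH]; rewrite ?nrm1// !exprS nrmM IH. Qed.

Lemma nrmD z w : nrm (z + w) <= nrm z + nrm w.
Proof. by rewrite -lecR rmorphD/= -!nrmE ler_normD. Qed.

Lemma nrmN z : nrm (- z) = nrm z.
Proof. by apply: complexI; rewrite -!nrmE normrN. Qed.

Lemma nrm_real x : nrm x%:C = `|x|.
Proof. by rewrite /nrm/= expr0n addr0 sqrtr_sqr. Qed.

Lemma nrm_sum (I : Type) (s : seq I) (P : pred I) (F : I -> R[i]) :
  nrm (\sum_(i <- s | P i) F i) <= \sum_(i <- s | P i) nrm (F i).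
Proof.
elim/big_ind2: _ => //; first by rewrite -[0]/(0%:C) nrm_real normr0.
by move=> z x w y zx wy; rewrite (le_trans (nrmD _ _))// lerD.
Qed.

Lemma normr_Re_le z : `|Re z| <= nrm z.
Proof. by rewrite -sqrtr_sqr ler_wsqrtr// lerDl sqr_ge0. Qed.

Lemma normr_Im_le z : `|Im z| <= nrm z.
Proof. by rewrite -sqrtr_sqr ler_wsqrtr// lerDr sqr_ge0. Qed.

(** [|1 + u|^2 = 1 + 2 Re u + |u|^2], and [1 + x <= exp x]. *)
Lemma nrm_1D_le u : nrm (1 + u) <= expR (Re u + nrm u ^+ 2 / 2).
Proof.
rewrite -(@ler_pXn2r _ 2)// ?nnegrE ?nrm_ge0 ?expR_ge0// -expRM_natl nrm_sqr.
apply: le_trans (expR_ge1Dx _).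
rewrite nrm_sqr; case: u => a b /=; lra.
Qed.

Lemma nrm_1D_exp_le u n : (0 < n)%N ->
  nrm ((1 + u / n%:R%:C) ^+ n) <= expR (Re u + nrm u ^+ 2 / (2 * n%:R)).
Proof.
move=> n0; have n0' : (0 : R) < n%:R by rewrite ltr0n.
rewrite nrmX; apply: (@le_trans _ _
  (expR (Re (u / n%:R%:C) + nrm (u / n%:R%:C) ^+ 2 / 2) ^+ n)).
  by rewrite lerXn2r ?nnegrE ?nrm_ge0 ?expR_ge0// nrm_1D_le.
rewrite -expRM_natl ler_expR -fmorphV nrmM nrm_real ger0_norm ?invr_ge0 ?ler0n//.
have -> : Re (u * n%:R^-1%:C) = Re u / n%:R by case: (u) => a b /=; rewrite mulr0 subr0.
rewrite le_eqVlt; apply/orP; left; apply/eqP; field.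
by rewrite gt_eqF.
Qed.

(** With [v = u / n], the product [(1 + v) (1 - v) = 1 - v^2] is bounded below by Bernoulli after
    taking powers; dividing by the upper bound for [(1 - v) ^ n] leaves a lower bound for
    [(1 + v) ^ n]. *)
Lemma nrm_1D_exp_ge u n : (0 < n)%N -> nrm u ^+ 2 <= n%:R ->
  (1 - nrm u ^+ 2 / n%:R) * expR (Re u - nrm u ^+ 2 / (2 * n%:R))
  <= nrm ((1 + u / n%:R%:C) ^+ n).
Proof.
move=> n0 un; have n0' : (0 : R) < n%:R by rewrite ltr0n.
set v := u / _.
have -> : Re u - nrm u ^+ 2 / (2 * n%:R) = - (Re (- u) + nrm (- u) ^+ 2 / (2 * n%:R)).
  by rewrite nrmN; case: (u) => a b /=; rewrite opprD opprK.
rewrite expRN ler_pdivrMr ?expR_gt0//.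
apply: (@le_trans _ _ (nrm ((1 + v) ^+ n) * nrm ((1 + - u / n%:R%:C) ^+ n))); last first.
  by rewrite ler_wpM2l ?nrm_ge0// nrm_1D_exp_le.
rewrite -nrmM -exprMn mulNr -/v [(1 + v) * _]mulrC -subr_sqr expr1n nrmX.
have nv : nrm v = nrm u / n%:R.
  by rewrite nrmM -fmorphV nrm_real ger0_norm ?invr_ge0 ?ler0n.
have v1 : 1 - nrm v ^+ 2 <= nrm (1 - v ^+ 2).
  have := nrmD (1 - v ^+ 2) (v ^+ 2).
  by rewrite subrK nrm1 nrmX; lra.
have nn : (1 : R) <= n%:R by rewrite ler1n.
have nv0 : 0 <= 1 - nrm v ^+ 2.
  rewrite subr_ge0 nv expr_div_n ler_pdivrMr ?exprn_gt0// mul1r.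
  by rewrite (le_trans un)// expr2 ler_peMr// ler0n.
apply: (@le_trans _ _ ((1 - nrm v ^+ 2) ^+ n)); last first.
  by rewrite lerXn2r ?nnegrE ?nrm_ge0.
apply: le_trans (@bernoulli_le _ _ _); last first.
  by rewrite sqr_ge0 -subr_ge0.
rewrite lerD2l lerN2 nv expr_div_n.
rewrite le_eqVlt; apply/orP; left; apply/eqP; field.
by rewrite gt_eqF.
Qed.

Definition cis t : R[i] := cos t +i* sin t.

Lemma cisD s t : cis (s + t) = cis s * cis t.
Proof. by rewrite /cis cosD sinD [sin s * _ + _]addrC. Qed.

Lemma cis0 : cis 0 = 1.
Proof. by rewrite /cis cos0 sin0. Qed.

Lemma cisX t n : cis t ^+ n = cis (n%:R * t).
Proof.
elim: n => [|n IH]; first by rewrite mul0r cis0.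
by rewrite exprS IH -cisD -natr1 mulrDl mul1r addrC.
Qed.

Lemma nrm_cis t : nrm (cis t) = 1.
Proof. by rewrite /nrm /= cos2Dsin2 sqrtr1. Qed.

Lemma cis_neq1 t : 0 < t < pi *+ 2 -> cis t != 1.
Proof.
move=> /andP[t0 t2]; apply/eqP => /(congr1 (@complex.Re R))/=.
have -> : t = (t / 2) *+ 2 by rewrite -mulr_natr divfK.
have : 0 < sin (t / 2).
  apply: sin_gt0_pi; rewrite divr_gt0//= ltr_pdivrMr// mulr_natr.
  by [].
rewrite cos_mulr2n cos2sin2 => s0 /eqP.
rewrite -mulr_natr => /eqP e.
have : sin (t / 2) ^+ 2 = 0 by lra.
by move/eqP; rewrite sqrf_eq0 gt_eqF.
Qed.

Definition unity_root n : R[i] := cis (pi *+ 2 / n%:R).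

Lemma unity_rootX n : (0 < n)%N -> unity_root n ^+ n = 1.
Proof.
move=> n0; rewrite cisX mulrC divfK ?pnatr_eq0 -?lt0n//.
by rewrite /cis cos2pi sin2pi.
Qed.

Lemma sum_unity_rootX n j : (0 < n)%N -> (0 < j < n)%N ->
  \sum_(i < n) (unity_root n ^+ i) ^+ j = 0.
Proof.
move=> n0 /andP[j0 jn].
have /eqP : (unity_root n ^+ j) ^+ n - 1 = 0.
  by rewrite exprAC unity_rootX// expr1n subrr.
rewrite subrX1 mulf_eq0 subr_eq0 => /orP[/eqP|/eqP s0]; last first.
  by rewrite -[RHS]s0; apply: eq_bigr => i _; rewrite exprAC.
move=> e; have /negP[] : unity_root n ^+ j != 1; last exact/eqP.
rewrite cisX; apply: cis_neq1.
have n0' : (0 : R) < n%:R by rewrite ltr0n.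
have p0 : 0 < pi *+ 2 :> R by rewrite pmulrn_lgt0// pi_gt0.
rewrite mulrA divr_gt0 ?mulr_gt0 ?ltr0n//=.
by rewrite ltr_pdivrMr// mulrC ltr_pM2l ?ltr_nat.
Qed.

(** The powers of the roots of unity sum to zero for every exponent strictly between 0 and [n], so
    only the constant coefficient survives. *)
Lemma poly_mean_value (p : {poly R[i]}) z n : (0 < n)%N -> (size p <= n)%N ->
  \sum_(i < n) p.[z * unity_root n ^+ i] = n%:R * p.[0].
Proof.
move=> n0 pn; rewrite horner_coef0.
transitivity (\sum_(i < n) \sum_(j < n) p`_j * (z * unity_root n ^+ i) ^+ j).
  by apply: eq_bigr => i _; rewrite (horner_coef_wide _ pn).
rewrite exchange_big/=; case: n n0 pn => // n _ pn.
have z0 (j : 'I_n) : \sum_(i < n.+1) p`_(lift ord0 j) *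
    (z * unity_root n.+1 ^+ i) ^+ lift ord0 j = 0.
  rewrite (eq_bigr (fun i : 'I_n.+1 => p`_(lift ord0 j) * z ^+ lift ord0 j *
    (unity_root n.+1 ^+ i) ^+ lift ord0 j)) => [|i _]; last by rewrite exprMn mulrA.
  by rewrite -mulr_sumr sum_unity_rootX ?mulr0// lift0/= ltnS ltn_ord.
rewrite big_ord_recl [X in _ + X]big1 ?addr0 => [|j _]; last exact: z0.
rewrite (eq_bigr (fun=> p`_0)) => [|i _]; last by rewrite expr0 mulr1.
by rewrite sumr_const card_ord mulr_natl.
Qed.

(* Cauchy's estimate, by averaging over roots of unity. *)
Lemma poly_coef_bound (p : {poly R[i]}) (j : nat) r B : 0 <= r ->
  (forall z, nrm z = r -> nrm p.[z] <= B) -> nrm p`_j * r ^+ j <= B.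
Proof.
(* [n] exceeds [j] and is at least the size of [p]. The weight of exponent [n - j] moves coefficient
   [j] to exponent [n], where the roots sum to [n]; all other exponents stay nonzero modulo [n]. *)
move=> r0 pB; set n := (size p + j.+1)%N.
have n0 : (0 < n)%N by rewrite /n addnS.
have jn : (j < n)%N by rewrite /n addnS ltnS leq_addl.
have E : \sum_(i < n) (unity_root n ^+ i) ^+ (n - j) * p.[r%:C * unity_root n ^+ i]
    = n%:R * (p`_j * r%:C ^+ j).
  transitivity (\sum_(i < n) \sum_(l < n) p`_l * r%:C ^+ l *
      (unity_root n ^+ i) ^+ (n - j + l)).
    apply: eq_bigr => i _; rewrite (@horner_coef_wide _ n) ?leq_addr// mulr_sumr.
    by apply: eq_bigr => l _; rewrite exprMn exprD; ring.
  rewrite exchange_big (bigD1 (Ordinal jn))//= [X in _ + X]big1 ?addr0.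
    rewrite (eq_bigr (fun=> p`_j * r%:C ^+ j)) ?sumr_const ?card_ord ?mulr_natl// => i _.
    rewrite subnK; last exact: ltnW.
    by rewrite exprAC unity_rootX// expr1n mulr1.
  move=> l lj; rewrite (eq_bigr (fun i : 'I_n => p`_l * r%:C ^+ l *
    (unity_root n ^+ i) ^+ ((n - j + l) %% n))) => [|i _]; last first.
    congr (_ * _); rewrite {1}(divn_eq (n - j + l) n) exprD mulnC exprM.
    by rewrite [(_ ^+ i) ^+ n]exprAC unity_rootX// !expr1n mul1r.
  rewrite -mulr_sumr sum_unity_rootX ?mulr0// ltn_mod n0 andbT lt0n.
  apply: contra lj => /eqP e; apply/eqP/val_inj => /=.
  have : (n - j + l + j = j %[mod n])%N by rewrite -modnDml e.
  rewrite addnAC subnK; last exact: ltnW.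
  by rewrite modnDl !modn_small.
have : nrm (n%:R * (p`_j * r%:C ^+ j)) <= n%:R * B.
  rewrite -E (le_trans (nrm_sum _ _ _))//.
  rewrite mulr_natl -[X in B *+ X](card_ord n) -sumr_const; apply: ler_sum => i _.
  rewrite nrmM !nrmX nrm_cis !expr1n mul1r pB// nrmM nrmX nrm_cis expr1n mulr1.
  by rewrite nrm_real ger0_norm.
rewrite -[n%:R]/(n%:R : R[i]) -(rmorph_nat (real_complex R)) nrmM nrm_real.
rewrite ger0_norm ?ler0n// ler_pM2l ?ltr0n// nrmM nrmX nrm_real ger0_norm//.
Qed.

End ComplexNorm.

(** * Maximum principle for polynomials on compact sets *)

Section MaximumPrinciple.
Variable R : realType.
Implicit Types (p : {poly R[i]}) (K : set (R * R)).
Local Notation Re := complex.Re.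
Local Notation Im := complex.Im.

Definition toC (x : R * R) : R[i] := x.1 +i* x.2.

Lemma toCK (z : R[i]) : toC (Re z, Im z) = z.
Proof. by case: z. Qed.

Lemma continuous_nrm_poly p : continuous (fun x => nrm p.[toC x]).
Proof.
have cst1 : continuous (fun x : R * R => x.1) by move=> x; exact: cvg_fst.
have cst2 : continuous (fun x : R * R => x.2) by move=> x; exact: cvg_snd.
have [cRe cIm] : continuous (fun x => Re p.[toC x]) /\ continuous (fun x => Im p.[toC x]).
  elim/poly_ind: p => [|p c [cRe cIm]].
    by split => x; rewrite /continuous_at horner0; under eq_fun do rewrite horner0;
      exact: cvg_cst.
  have E x : (p * 'X + c%:P).[toC x] = (Re p.[toC x] * x.1 - Im p.[toC x] * x.2 + Re c)
      +i* (Re p.[toC x] * x.2 + Im p.[toC x] * x.1 + Im c).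
    by rewrite hornerD hornerMX hornerC; case: p.[_] => a b; case: c => d e.
  split.
    rewrite (_ : (fun _ => _) = fun x => Re p.[toC x] * x.1 - Im p.[toC x] * x.2 + Re c);
      last by apply/funext => x; rewrite E.
    move=> x; apply: cvgD; last exact: cvg_cst.
    by apply: cvgB; apply: cvgM;
      [exact: cRe|exact: cst1|exact: cIm|exact: cst2].
  rewrite (_ : (fun _ => _) = fun x => Re p.[toC x] * x.2 + Im p.[toC x] * x.1 + Im c);
    last by apply/funext => x; rewrite E.
  move=> x; apply: cvgD; last exact: cvg_cst.
  by apply: cvgD; apply: cvgM;
    [exact: cRe|exact: cst2|exact: cIm|exact: cst1].
have sq (f : R * R -> R) x : {for x, continuous f} ->
    {for x, continuous (fun y => f y ^+ 2)}.
  by move=> cf; apply: (cvgM cf cf).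
have c2 : continuous (fun x => Re p.[toC x] ^+ 2 + Im p.[toC x] ^+ 2).
  by move=> x; apply: cvgD; apply: sq; [exact: cRe|exact: cIm].
move=> x; exact: (@continuous_comp _ _ _ _ (@Num.sqrt R) x (c2 x) (@sqrt_continuous R _)).
Qed.

(* The strictly subharmonic term [e * |z|^2] rules out interior maxima. *)
Lemma poly_no_local_max p (z : R[i]) (e r : R) : 0 < e -> 0 < r ->
  exists2 w, nrm (w - z) = r &
    nrm p.[z] + e * nrm z ^+ 2 < nrm p.[w] + e * nrm w ^+ 2.
Proof.
(* Adding 2 ensures [n >= 2], so that the roots of unity themselves sum to zero. *)
move=> e0 r0; set n := (size p + 2)%N; have n0 : (0 < n)%N by rewrite /n addn2.
pose w i := z + r%:C * unity_root R n ^+ i.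
have nw i : nrm (w i - z) = r.
  rewrite /w addrC addKr nrmM nrmX nrm_cis expr1n mulr1 nrm_real gtr0_norm//.
apply/not_exists2P => H.
have {}H (i : 'I_n) : nrm p.[w i] + e * nrm (w i) ^+ 2 <= nrm p.[z] + e * nrm z ^+ 2.
  by case: (H (w i)) => [/(_ (nw i))//|/negP]; rewrite -leNgt.
have S1 : n%:R * nrm p.[z] <= \sum_(i < n) nrm p.[w i].
  have := @poly_mean_value R (p \Po ('X + z%:P)) r%:C n n0.
  rewrite size_comp_poly2 ?size_XaddC// leq_addr => /(_ isT).
  rewrite horner_comp !hornerE => E.
  have -> : n%:R * nrm p.[z] = nrm (\sum_(i < n) p.[w i]).
    have <- : n%:R * p.[z] = \sum_(i < n) p.[w i].
      by rewrite -E; apply: eq_bigr => i _; rewrite horner_comp !hornerE addrC.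
    by rewrite nrmM -(rmorph_nat (real_complex R)) nrm_real ger0_norm.
  exact: nrm_sum.
(* The cross terms add up to the real part of a multiple of the sum of the roots, which is 0; the
   surviving [r ^+ 2] makes the average strictly larger. *)
have S2 : \sum_(i < n) nrm (w i) ^+ 2 = n%:R * (nrm z ^+ 2 + r ^+ 2).
  have E1 (i : 'I_n) : nrm (w i) ^+ 2 =
      nrm z ^+ 2 + r ^+ 2 + 2 * r * Re (z^*%C * unity_root R n ^+ i).
    have := nrm_cis (i%:R * (pi *+ 2 / n%:R) : R).
    move/(congr1 (fun t => t ^+ 2)); rewrite -cisX -/(unity_root R n) expr1n !nrm_sqr /w.
    case: (unity_root R n ^+ i) => a b; case: (z) => c d /= ab.
    rewrite !mul0r subr0 addr0.
    transitivity (c ^+ 2 + d ^+ 2 + r ^+ 2 * (a ^+ 2 + b ^+ 2) +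
      2 * r * (c * a + d * b)); first by ring.
    by rewrite ab mulr1; ring.
  under eq_bigr do rewrite E1.
  rewrite big_split/= sumr_const card_ord -mulr_sumr.
  have -> : \sum_(i < n) Re (z^*%C * unity_root R n ^+ i) = 0.
    rewrite -(raddf_sum (@complex.Re R : Rcomplex R -> R)) -mulr_sumr.
    have := @sum_unity_rootX R n 1 n0; rewrite {1}/n addn2 => /(_ isT).
    under eq_bigr do rewrite expr1.
    by move=> ->; rewrite mulr0.
  by rewrite mulr0 addr0 mulr_natl.
have : \sum_(i < n) (nrm p.[w i] + e * nrm (w i) ^+ 2) <=
    n%:R * (nrm p.[z] + e * nrm z ^+ 2).
  rewrite mulr_natl -[X in _ *+ X](card_ord n) -sumr_const; exact: ler_sum.
rewrite big_split/= -mulr_sumr S2.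
have : 0 < n%:R * (e * r ^+ 2) by rewrite !mulr_gt0// ?ltr0n// exprn_gt0.
nra.
Qed.

(** At a maximum over [K] of [|p| + e |z|^2] the second alternative is impossible, so [|p| <= B]
    there; small [e] transfers this to every point. One circle inside [K] around each remaining
    point is enough, because the absence of local maxima is tested on a single circle. *)
Lemma maximum_principle p K (B : R) : compact K ->
  (forall z, K z -> nrm p.[toC z] <= B \/
     exists2 r, 0 < r & forall w, nrm (w - toC z) = r -> K (Re w, Im w)) ->
  forall z, K z -> nrm p.[toC z] <= B.
Proof.
move=> cK bdK z Kz; apply/ler_addgt0Pr => d d0.
have K0 : (K !=set0)%classic by exists z.
have cX : continuous (fun x => nrm (toC x) ^+ 2).
  have -> : (fun x => nrm (toC x) ^+ 2) = (fun x => nrm ('X).[toC x] ^+ 2).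
    by apply/funext => x; rewrite hornerX.
  by move=> x; apply: cvgM; exact: continuous_nrm_poly.
have [m Km mM] := compact_EVT_max K0 cK (continuous_subspaceT cX).
set M := nrm (toC m) ^+ 2 in mM; have M0 : 0 <= M by rewrite sqr_ge0.
(* This size keeps [e |z|^2] below [d] on all of [K]. *)
pose e := d / (M + 1); have e0 : 0 < e by rewrite divr_gt0// ltr_wpDl.
have cv : continuous (fun x => nrm p.[toC x] + e * nrm (toC x) ^+ 2).
  move=> x; apply: cvgD; first exact: continuous_nrm_poly.
  by apply: cvgM; [exact: cvg_cst|exact: cX].
have [c Kc cM] := compact_EVT_max K0 cK (continuous_subspaceT cv).
have cB : nrm p.[toC c] <= B.
  move/set_mem in Kc; have [//|[r r0 rK]] := bdK _ Kc.
  have [w wr] := poly_no_local_max p (toC c) e0 r0.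
  rewrite ltNge => /negP[]; have := cM (Re w, Im w).
  by rewrite toCK; apply; apply/mem_set/rK.
have := cM z (mem_set Kz).
have := mM c Kc.
have eM : e * M <= d.
  rewrite /e mulrAC ler_pdivrMr ?ltr_wpDl// ler_pM2l//; lra.
have : 0 <= e * nrm (toC z) ^+ 2 by rewrite mulr_ge0 ?sqr_ge0 ?ltW.
move=> h1 h2 h3.
have : e * nrm (toC c) ^+ 2 <= e * M by rewrite ler_pM2l.
lra.
Qed.

End MaximumPrinciple.

(** * Truncations of the entire series with coefficients [d m / m!], for bounded [d] *)

Section ExponentialType.
Variables (R : realType) (d : nat -> R) (C : R).
Local Notation Re := complex.Re.
Local Notation Im := complex.Im.
Hypothesis d_le : forall m, `|d m| <= C.

(** Times [C], this remainder of the exponential series bounds the truncation error on the circle of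
    radius [r]. *)
Definition exp_tail (M : nat) (r : R) : R := expR r - series (exp_coeff r) M.

Lemma cvg_exp_tail r : (exp_tail M r @[M --> \oo] --> 0)%classic.
Proof. by rewrite -(subrr (expR r)); apply: cvgB; [exact: cvg_cst|exact: is_cvg_series_exp_coeff]. Qed.

Lemma exp_tail_diff M M' r : exp_tail M r - exp_tail M' r =
  series (exp_coeff r) M' - series (exp_coeff r) M.
Proof. by rewrite /exp_tail; ring. Qed.

Lemma series_exp_coeff_diff M M' (r : R) : (M <= M')%N ->
  series (exp_coeff r) M' - series (exp_coeff r) M = \sum_(M <= m < M') r ^+ m / m`!%:R.
Proof. by move=> MM; rewrite sub_series_geq. Qed.

Lemma le_exp_tail M r s : 0 <= r <= s -> exp_tail M r <= exp_tail M s.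
Proof.
move=> /andP[r0 rs]; rewrite -subr_le0.
have : (exp_tail M' r - exp_tail M' s @[M' --> \oo] --> 0)%classic.
  by rewrite -(subrr 0); apply: cvgB; exact: cvg_exp_tail.
move/cvgr_to_ge; apply; near=> M'.
have MM : (M <= M')%N by near: M'; exact: nbhs_infty_ge.
have := exp_tail_diff M M' r; have := exp_tail_diff M M' s.
rewrite !series_exp_coeff_diff// => e1 e2.
suff : \sum_(M <= m < M') r ^+ m / m`!%:R <= \sum_(M <= m < M') s ^+ m / m`!%:R by lra.
apply: ler_sum => m _; rewrite ler_wpM2r// ?invr_ge0// lerXn2r ?nnegrE//.
exact: le_trans rs.
Unshelve. all: by end_near. Qed.

Lemma exp_tail_ge0 M r : 0 <= r -> 0 <= exp_tail M r.
Proof.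
move=> r0; have /cvgr_to_le : (exp_tail M' r - exp_tail M r @[M' --> \oo] --> 0 - exp_tail M r)%classic.
  by apply: cvgB; [exact: cvg_exp_tail|exact: cvg_cst].
move/(_ 0); rewrite sub0r oppr_le0; apply; near=> M'.
have MM : (M <= M')%N by near: M'; exact: nbhs_infty_ge.
rewrite exp_tail_diff -opprB series_exp_coeff_diff// oppr_le0 sumr_ge0// => m _.
by rewrite mulr_ge0 ?invr_ge0// exprn_ge0.
Unshelve. all: by end_near. Qed.

Lemma C_ge0 : 0 <= C.
Proof. exact: le_trans (d_le 0). Qed.

(** Taylor polynomial of the entire function. The function itself is never formed off the real axis:
    complex estimates concern [Phi M] and carry an explicit tail. *)
Definition Phi (M : nat) : {poly R[i]} := \poly_(m < M) (d m / m`!%:R)%:C.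

Lemma horner_Phi M z : (Phi M).[z] = \sum_(0 <= m < M) (d m / m`!%:R)%:C * z ^+ m.
Proof. by rewrite horner_poly big_mkord. Qed.

Lemma Phi_term_le m (z : R[i]) :
  nrm ((d m / m`!%:R)%:C * z ^+ m) <= C * (nrm z ^+ m / m`!%:R).
Proof.
rewrite nrmM nrmX nrm_real normrM [`|_^-1|]ger0_norm ?invr_ge0//.
by rewrite -mulrA [_^-1 * _]mulrC ler_wpM2r// mulr_ge0 ?exprn_ge0 ?nrm_ge0 ?invr_ge0.
Qed.

Lemma Phi_diff_le M M' z : (M <= M')%N ->
  nrm ((Phi M').[z] - (Phi M).[z]) <= C * exp_tail M (nrm z).
Proof.
move=> MM; rewrite !horner_Phi (big_cat_nat (leq0n M) MM)/= addrAC subrr add0r.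
rewrite (le_trans (nrm_sum _ _ _))//.
apply: (@le_trans _ _ (C * \sum_(M <= m < M') nrm z ^+ m / m`!%:R)).
  by rewrite mulr_sumr; apply: ler_sum => m _; exact: Phi_term_le.
rewrite ler_wpM2l ?C_ge0// -series_exp_coeff_diff// -exp_tail_diff gerBl.
by rewrite exp_tail_ge0 ?nrm_ge0.
Qed.

Lemma Phi_le M z : nrm (Phi M).[z] <= C * expR (nrm z).
Proof.
have := @Phi_diff_le 0 M z isT; rewrite /exp_tail /series/= big_geq// subr0.
by rewrite [Phi 0]poly_def big_ord0 horner0 subr0.
Qed.

Hypothesis phi_le : forall x, 0 <= x ->
  `|limn (series (fun m => d m * x ^+ m / m`!%:R))| <= C * expR (- x).

Lemma Phi_real M x : (Phi M).[x%:C] = (series (fun m => d m * x ^+ m / m`!%:R) M)%:C.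
Proof.
rewrite horner_Phi /series/= rmorph_sum/=; apply: eq_bigr => m _.
by rewrite -rmorphXn -rmorphM/= mulrAC.
Qed.

(** The decay hypothesis concerns the full series, so passing to a truncation costs one tail. *)
Lemma Phi_real_le M x : 0 <= x ->
  nrm (Phi M).[x%:C] <= C * expR (- x) + C * exp_tail M x.
Proof.
move=> x0; set u := fun m => d m * x ^+ m / m`!%:R.
have cu : cvgn (series u).
  apply: normed_cvg; apply: (@series_le_cvg _ _ (fun m => C * exp_coeff x m)).
  - by move=> m; exact: normr_ge0.
  - by move=> m; rewrite mulr_ge0 ?C_ge0// /exp_coeff/= mulr_ge0 ?invr_ge0 ?exprn_ge0.
  - move=> m; rewrite /= /u -mulrA normrM [`|_ / _|]ger0_norm ?mulr_ge0 ?invr_ge0 ?exprn_ge0//.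
    by rewrite ler_wpM2r// mulr_ge0 ?invr_ge0 ?exprn_ge0.
  - exact/is_cvg_seriesZ/is_cvg_series_exp_coeff.
have : (`|series u M' - series u M| @[M' --> \oo] --> `|limn (series u) - series u M|)%classic.
  by apply: cvg_norm; apply: cvgB => //; exact: cvg_cst.
move/cvgr_to_le => /(_ (C * exp_tail M x)) h.
have {}h : `|limn (series u) - series u M| <= C * exp_tail M x.
  apply: h; near=> M'.
  have MM : (M <= M')%N by near: M'; exact: nbhs_infty_ge.
  have := @Phi_diff_le M M' x%:C MM.
  by rewrite !Phi_real -rmorphB/= !nrm_real [`|x|]ger0_norm.
rewrite Phi_real nrm_real.
have := phi_le x0; have := ler_normB (limn (series u)) (limn (series u) - series u M).
rewrite opprB addrC subrK -/u; lra.
Unshelve. all: by end_near. Qed.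

End ExponentialType.

(** * Circular sectors of opening below pi *)

Section Sector.
Variable R : realType.
Local Notation Re := complex.Re.
Local Notation Im := complex.Im.
Implicit Types (t X : R).

(** For [0 < t < pi] this is the sector [0 <= arg z <= t], [|z| <= X]; the second condition reads
    [|z| sin (t - arg z) >= 0]. Polynomial inequalities make it visibly closed. *)
Definition cone t X : set (R * R) :=
  [set x | [/\ 0 <= x.2, 0 <= sin t * x.1 - cos t * x.2 & x.1 ^+ 2 + x.2 ^+ 2 <= X ^+ 2]].

Lemma compact_cone t X : 0 <= X -> compact (cone t X).
Proof.
move=> X0; apply: (@subclosed_compact _ _ (`[- X, X] `*` `[- X, X])%classic).
- have -> : cone t X = ((fun x : R * R => x.2) @^-1` [set y | 0 <= y] `&`
      ((fun x : R * R => sin t * x.1 - cos t * x.2) @^-1` [set y | 0 <= y] `&`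
       (fun x : R * R => X ^+ 2 - (x.1 * x.1 + x.2 * x.2)) @^-1` [set y | 0 <= y]))%classic.
    apply/seteqP; split => x /=; rewrite /cone/= !expr2 -?expr2.
      by move=> [? ? ?]; split => //; split => //; rewrite subr_ge0.
    by move=> [? [?]]; rewrite subr_ge0; split.
  apply: closedI; last apply: closedI; apply: preimage_closed; try exact: closed_ge.
  + by move=> x _; exact: cvg_snd.
  + move=> x _; apply: cvgB; apply: cvgM; try exact: cvg_cst;
      [exact: cvg_fst|exact: cvg_snd].
  + move=> x _; apply: cvgB; first exact: cvg_cst.
    by apply: cvgD; apply: cvgM; (exact: cvg_fst || exact: cvg_snd).
- by apply: compact_setX; exact: segment_compact.
- move=> x [_ _ xX] /=; rewrite !in_itv/= -!ler_norml -!sqrtr_sqr -(ger0_norm X0) -sqrtr_sqr.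
  by split; rewrite ler_wsqrtr// (le_trans _ xX)// ?lerDl ?lerDr sqr_ge0.
Qed.

Lemma cone_interior t X (x : R * R) : 0 < x.2 -> 0 < sin t * x.1 - cos t * x.2 ->
  nrm (toC x) < X ->
  exists2 r, 0 < r & forall w, nrm (w - toC x) = r -> cone t X (Re w, Im w).
Proof.
move=> x2 xl xX; pose l := (sin t * x.1 - cos t * x.2).
(* On a circle of radius [r] the linear form moves by at most [2 r], whence the half in [l / 2]. *)
exists (Num.min x.2 (Num.min (l / 2) (X - nrm (toC x)))).
  by rewrite !lt_min x2 divr_gt0//= subr_gt0.
set r := Num.min _ _ => w wr.
have r1 : r <= x.2 by rewrite ge_min lexx.
have r2 : r <= l / 2 by rewrite !ge_min lexx orbT.
have r3 : r <= X - nrm (toC x) by rewrite !ge_min lexx !orbT.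
have := normr_Re_le (w - toC x); have := normr_Im_le (w - toC x); rewrite wr => hI hR.
have eR : Re (w - toC x) = Re w - x.1 by case: (w).
have eI : Im (w - toC x) = Im w - x.2 by case: (w).
rewrite eR in hR; rewrite eI in hI.
have X0 : 0 <= X by rewrite ltW// (le_lt_trans _ xX)// nrm_ge0.
split => /=.
- by move: hI; rewrite ler_norml => /andP[]; lra.
- have hs : `|sin t * (Re w - x.1)| <= r.
    by rewrite normrM -[leRHS]mul1r ler_pM// sin_max.
  have hc : `|cos t * (Im w - x.2)| <= r.
    by rewrite normrM -[leRHS]mul1r ler_pM// cos_max.
  move: hs hc; rewrite !ler_norml => /andP[h1 h2] /andP[h3 h4].
  rewrite /l in r2; lra.
- rewrite -nrm_sqr lerXn2r ?nnegrE ?nrm_ge0//.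
  have := nrmD (w - toC x) (toC x); rewrite subrK wr; lra.
Qed.

Lemma polar (z : R[i]) : 0 <= Im z ->
  exists2 u, 0 <= u <= pi & z = (nrm z)%:C * cis u.
Proof.
case: z => a b /= b0; set r := nrm _.
have [r0|r0] := eqVneq r 0.
  exists 0; first by rewrite lexx pi_ge0.
  have := nrm_sqr (a +i* b); rewrite -/r r0 expr0n/= => /esym/eqP.
  rewrite paddr_eq0 ?sqr_ge0// !sqrf_eq0 => /andP[/eqP a0 /eqP b0'].
  by rewrite a0 b0' mul0r.
have rp : 0 < r by rewrite lt_neqAle eq_sym r0 nrm_ge0.
have r2 : r ^+ 2 = a ^+ 2 + b ^+ 2 by rewrite nrm_sqr.
have ar : -1 <= a / r <= 1.
  by rewrite -ler_norml normrM normrV ?unitfE// [`|r|]gtr0_norm// ler_pdivrMr// mul1r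
    (normr_Re_le (a +i* b)).
have ci : a / r \in `[-1, 1] by rewrite in_itv.
have cu : r * cos (acos (a / r)) = a by rewrite acosK// mulrC divfK.
have su : r * sin (acos (a / r)) = b.
  have s0 : 0 <= sin (acos (a / r)) by rewrite sin_acos// sqrtr_ge0.
  apply/eqP; rewrite -(@eqrXn2 _ 2)// ?mulr_ge0 ?nrm_ge0//.
  by rewrite exprMn sin2cos2 mulrBr mulr1 -exprMn cu r2 addrC addKr.
exists (acos (a / r)); last by rewrite /cis /= -{1}cu -{1}su; simpc.
by rewrite acos_ge0//= acos_lepi.
Qed.

(** An argument [u] in []t, pi]] would give [sin (u - t) > 0], against the second inequality of the
    cone. *)
Lemma cone_polar t X (x : R * R) : 0 < t < pi -> cone t X x ->
  exists2 u, 0 <= u <= t & toC x = (nrm (toC x))%:C * cis u.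
Proof.
move=> /andP[t0 tpi] [b0 l0 _]; have [u /andP[u0 upi] xu] := @polar (toC x) b0.
have [r0|r0] := eqVneq (nrm (toC x)) 0.
  by exists 0; [rewrite lexx ltW|rewrite r0 mul0r xu r0 mul0r].
have rp : 0 < nrm (toC x) by rewrite lt_neqAle eq_sym r0 nrm_ge0.
have /(congr1 (@complex.Re R)) := xu; have /(congr1 (@complex.Im R)) := xu.
rewrite /= !mul0r subr0 addr0 => x2 x1.
exists u => //; rewrite u0/= leNgt; apply/negP => tu.
have : 0 < sin (u - t) by apply: sin_gt0_pi; rewrite subr_gt0 tu/=; lra.
rewrite -(pmulr_rgt0 _ rp) sinB mulrBr !mulrA -x1 -x2.
rewrite ltNge => /negP[]; lra.
Qed.

Lemma ler_cos (u v : R) : `|u| <= v -> v <= pi -> cos v <= cos u.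
Proof.
move=> uv vpi; have hu : `|u| \in `[0, pi] by rewrite in_itv/= normr_ge0 (le_trans uv).
have hv : v \in `[0, pi] by rewrite in_itv/= vpi (le_trans _ uv).
by rewrite -(cos_norm u) leNgt ltr_cos// -leNgt.
Qed.

End Sector.

(** * Phragmen-Lindelof in a sector with polynomial comparison functions *)

Section PhragmenLindelof.
Variables (R : realType) (d : nat -> R) (C : R).
Local Notation Re := complex.Re.
Local Notation Im := complex.Im.
Hypothesis d_le : forall m, `|d m| <= C.
Hypothesis phi_le : forall x, 0 <= x ->
  `|limn (series (fun m => d m * x ^+ m / m`!%:R))| <= C * expR (- x).

(** Under [z ^ N] this opening becomes pi - 2 pi / (N + 1), which exhausts the half-plane as N
    grows; under [z ^ (N + 1)] it becomes pi (N - 1) / N, still below pi. *)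
Definition sector_angle (N : nat) : R := (N%:R - 1) * pi / (N%:R * (N%:R + 1)).

(** Rotation by this half-opening centres the image of the sector under [z ^ (N + 1)] on the
    positive axis, so the real part is positive there. *)
Definition sector_half (N : nat) : R := (N%:R + 1) * sector_angle N / 2.

Lemma sector_angleM N : (1 < N)%N ->
  N%:R * sector_angle N = pi - (pi / (N%:R + 1)) *+ 2.
Proof.
move=> N1; have N0 : (N%:R : R) != 0 by rewrite pnatr_eq0 -lt0n ltnW.
have N2 : (N%:R + 1 : R) != 0 by rewrite natr1 pnatr_eq0.
rewrite /sector_angle -mulr_natr; field.
by rewrite N2 N0.
Qed.

Lemma sector_half_lt N : (1 < N)%N -> 0 < sector_half N < pi / 2.
Proof.
move=> N1; have N1' : (1 : R) < N%:R by rewrite ltr1n.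
have p0 := pi_gt0 R.
have N0 : (0 : R) < N%:R by rewrite (lt_trans _ N1').
have N2 : (0 : R) < N%:R + 1 by rewrite addr_gt0.
have -> : sector_half N = (1 - N%:R^-1) * (pi / 2).
  rewrite /sector_half /sector_angle; field.
  by rewrite (gt_eqF N0) (gt_eqF N2).
have i0 : (0 : R) < N%:R^-1 by rewrite invr_gt0.
have i1 : (N%:R^-1 : R) < 1 by rewrite invf_lt1.
have q0 : 0 < pi / 2 :> R by rewrite divr_gt0.
by rewrite mulr_gt0 ?subr_gt0//= gtr_pMl// gtrBl.
Qed.

Lemma sector_angle_gt0 N : (1 < N)%N -> 0 < sector_angle N < pi.
Proof.
move=> N1; have N1' : (1 : R) < N%:R by rewrite ltr1n.
have := sector_half_lt N1; rewrite /sector_half => /andP[h1 h2].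
have N2 : (1 : R) < N%:R + 1 by rewrite (lt_trans N1')// ltrDl.
have N3 : (0 : R) < N%:R + 1 by rewrite (lt_trans _ N2).
have t0 : 0 < sector_angle N by rewrite -(pmulr_rgt0 _ N3); lra.
rewrite t0/= (@lt_trans _ _ ((N%:R + 1) * sector_angle N))//; first by rewrite ltr_pMl.
lra.
Qed.

(** Stands for [F (z^N) exp (A z^N) exp (k z^(N+1))]. The second factor balances [F] on the two
    rays; the third has higher order and wins on the arc. *)
Definition PLpoly (M N : nat) (A k : R[i]) : {poly R[i]} :=
  (Phi d M \Po 'X^N) * (1 + (A / M%:R%:C) *: 'X^N) ^+ M
    * (1 + (k / M%:R%:C) *: 'X^(N.+1)) ^+ M.

Lemma horner_PLpoly M N A k z : (PLpoly M N A k).[z] =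
  (Phi d M).[z ^+ N] * (1 + (A * z ^+ N) / M%:R%:C) ^+ M
    * (1 + (k * z ^+ N.+1) / M%:R%:C) ^+ M.
Proof.
by rewrite !hornerM !horner_exp horner_comp !hornerD !hornerZ !hornerXn !hornerC
  ![_ / _ * _]mulrAC.
Qed.

Variables (N : nat) (c e : R).
Hypothesis N_gt1 : (1 < N)%N.
Hypothesis c_ge : sin (pi / (N%:R + 1)) <= c * cos (pi / (N%:R + 1)).
Hypothesis e_gt0 : 0 < e.
Let A : R[i] := 1 +i* c.
Let k : R[i] := (- e)%:C * cis (- sector_half N).

Lemma Re_PL1 (r u : R) :
  Re (A * (r%:C * cis u) ^+ N) = r ^+ N * (cos (N%:R * u) - c * sin (N%:R * u)).
Proof.
rewrite exprMn cisX -rmorphXn /A /cis/= !mul0r !mul1r subr0 addr0; ring.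
Qed.

Lemma Re_PL2 (r u : R) : Re (k * (r%:C * cis u) ^+ N.+1) =
  - (e * r ^+ N.+1 * cos (N.+1%:R * u - sector_half N)).
Proof.
rewrite /k exprMn cisX -rmorphXn mulrACA -rmorphM -cisD /cis.
by rewrite addrC/= mul0r subr0 mulNr mulNr.
Qed.

Lemma nrm_PL1 (r u : R) : 0 <= r -> nrm (A * (r%:C * cis u) ^+ N) = nrm A * r ^+ N.
Proof. by move=> r0; rewrite nrmM nrmX nrmM nrm_cis nrm_real mulr1 ger0_norm. Qed.

Lemma nrm_PL2 (r u : R) : 0 <= r -> nrm (k * (r%:C * cis u) ^+ N.+1) = e * r ^+ N.+1.
Proof.
by move=> r0; rewrite nrmM nrmX !nrmM !nrm_cis !nrm_real !mulr1 normrN gtr0_norm// ger0_norm.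
Qed.

(** Only three boundary pieces matter. On the positive ray the decay of [F] cancels [exp (z^N)] up
    to a tail; on the outer ray the tilt [c] cancels the type bound; on the arc the lower bound on
    [X] lets [e X^(N+1)] absorb [(1 + |A|) X^N]. The last factor is the price of replacing
    exponentials by [M]-th powers and tends to 1 as [M] grows. *)
Lemma PLpoly_le (M : nat) (X : R) (x : R * R) : (0 < M)%N ->
  1 + nrm A <= e * cos (sector_half N) * X -> cone (sector_angle N) X x ->
  nrm (PLpoly M N A k).[toC x] <= C * (1 + expR (X ^+ N) * exp_tail M (X ^+ N))
    * expR (((nrm A * X ^+ N) ^+ 2 + (e * X ^+ N.+1) ^+ 2) / (2 * M%:R)).
Proof.
move=> M0 XA; have C0 := C_ge0 d_le.
have M0' : (0 : R) < M%:R by rewrite ltr0n.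
have /andP[h0 h1] := sector_half_lt N_gt1.
have s0 : 0 < cos (sector_half N).
  by apply: cos_gt0_pihalf; rewrite h1 andbT (lt_trans _ h0)// oppr_lt0 (lt_trans h0).
have X0 : 0 < X.
  rewrite -(pmulr_rgt0 _ (mulr_gt0 e_gt0 s0)) (lt_le_trans _ XA)//.
  by rewrite ltr_wpDr// nrm_ge0.
set B := C * (1 + _); set D := _ / _.
have tX0 : 0 <= exp_tail M (X ^+ N) by rewrite exp_tail_ge0 ?exprn_ge0 ?ltW.
have CB : C <= B by rewrite /B ler_peMr// lerDl mulr_ge0 ?expR_ge0.
(* Trades both powers for true exponentials, so that each boundary piece reduces to comparing
   exponents. *)
have key (r u : R) : 0 <= r -> r <= X -> 0 <= u <= sector_angle N ->
    nrm (Phi d M).[(r%:C * cis u) ^+ N] *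
      expR (r ^+ N * (cos (N%:R * u) - c * sin (N%:R * u))
            - e * r ^+ N.+1 * cos (N.+1%:R * u - sector_half N)) <= B ->
    nrm (PLpoly M N A k).[r%:C * cis u] <= B * expR D.
  move=> r0 rX u0 hB; rewrite horner_PLpoly nrmM nrmM -[leLHS]mulrA.
  apply: le_trans (ler_wpM2r (expR_ge0 D) hB).
  rewrite -[leRHS]mulrA ler_wpM2l ?nrm_ge0// -expRD.
  apply: (@le_trans _ _ (expR (Re (A * (r%:C * cis u) ^+ N) +
        nrm (A * (r%:C * cis u) ^+ N) ^+ 2 / (2 * M%:R)) *
      expR (Re (k * (r%:C * cis u) ^+ N.+1) +
        nrm (k * (r%:C * cis u) ^+ N.+1) ^+ 2 / (2 * M%:R)))).
    by apply: ler_pM; rewrite ?nrm_ge0// nrm_1D_exp_le.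
  rewrite -expRD ler_expR Re_PL1 Re_PL2 nrm_PL1// nrm_PL2// addrACA lerD2l.
  rewrite -mulrDl /D ler_wpM2r ?invr_ge0 ?mulr_ge0//.
  have hX n : r ^+ n <= X ^+ n by rewrite lerXn2r ?nnegrE// ltW.
  by apply: lerD; rewrite lerXn2r ?nnegrE ?mulr_ge0 ?exprn_ge0 ?nrm_ge0 ?(ltW X0) ?(ltW e_gt0)//
    ler_wpM2l ?nrm_ge0 ?(ltW e_gt0).
have cosu u : 0 <= u <= sector_angle N ->
    cos (sector_half N) <= cos (N.+1%:R * u - sector_half N).
  move=> /andP[u0 u1]; apply: ler_cos; last by rewrite ltW// (lt_trans h1)// ltr_pdivrMr// ltr_pMr ?pi_gt0// ltr1n.
  have : N.+1%:R * u <= N.+1%:R * sector_angle N by rewrite ler_wpM2l.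
  have : 0 <= N.+1%:R * u by rewrite mulr_ge0.
  rewrite /sector_half -natr1 ler_norml; lra.
have ray0 r : 0 <= r -> r <= X -> nrm (PLpoly M N A k).[r%:C * cis 0] <= B * expR D.
  move=> r0 rX; have u0 : 0 <= (0 : R) <= sector_angle N.
    by rewrite lexx; have /andP[/ltW] := sector_angle_gt0 N_gt1.
  apply: key => //; rewrite cis0 mulr1 -rmorphXn.
  apply: (@le_trans _ _ ((C * expR (- r ^+ N) + C * exp_tail M (r ^+ N)) * expR (r ^+ N))).
    apply: ler_pM; rewrite ?nrm_ge0 ?expR_ge0//.
      by rewrite (Phi_real_le d_le phi_le)// exprn_ge0.
    rewrite ler_expR mulr0 cos0 sin0 mulr0 subr0 mulr1 gerBl.
    by rewrite !mulr_ge0 ?exprn_ge0 ?(ltW e_gt0)// (le_trans (ltW s0)) ?cosu.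
  rewrite mulrDl -mulrA -expRD addNr expR0.
  rewrite /B [leRHS]mulrDr lerD2l -mulrA ler_wpM2l//.
  rewrite mulrC; have rXN : r ^+ N <= X ^+ N by rewrite lerXn2r ?nnegrE// ltW.
  apply: ler_pM; rewrite ?expR_ge0 ?exp_tail_ge0 ?exprn_ge0// ?ler_expR//.
  by rewrite le_exp_tail// exprn_ge0.
have ray1 r : 0 <= r -> r <= X -> nrm (PLpoly M N A k).[r%:C * cis (sector_angle N)] <= B * expR D.
  move=> r0 rX; have u0 : 0 <= sector_angle N <= sector_angle N.
    by rewrite lexx andbT; have /andP[/ltW] := sector_angle_gt0 N_gt1.
  apply: key => //; apply: le_trans CB.
  apply: (@le_trans _ _ (C * expR (r ^+ N) * expR (- r ^+ N))); last first.
    by rewrite -mulrA -expRD subrr expR0 mulr1.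
  apply: ler_pM; rewrite ?nrm_ge0 ?expR_ge0//.
    by rewrite (le_trans (Phi_le d_le _ _))// nrmX nrmM nrm_cis mulr1 nrm_real ger0_norm.
  rewrite ler_expR; set q := e * _ * _.
  have q0 : 0 <= q.
    by rewrite !mulr_ge0 ?exprn_ge0 ?(ltW e_gt0)// (le_trans (ltW s0)) ?cosu.
  suff : r ^+ N * (cos (N%:R * sector_angle N) - c * sin (N%:R * sector_angle N)) <= r ^+ N * -1.
    by move: q0; lra.
  rewrite ler_wpM2l ?exprn_ge0// sector_angleM//.
  have : 0 <= sin (pi / (N%:R + 1)) :> R.
    apply: sin_ge0_pi; rewrite divr_ge0 ?pi_ge0//= ler_pdivrMr ?ltr_wpDl//.
    by rewrite ler_peMr ?pi_ge0// lerDr.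
  (* At argument pi - 2 y, the real part of [(1 + i c) w] is [- |w|] times
     [1 - 2 sin^2 y + 2 c sin y cos y], which is at least 1 exactly because [c] satisfies [c_ge]. *)
  move: c_ge; set y := pi / (N%:R + 1) => cy sy.
  rewrite cosB sinB cospi sinpi cos_mulr2n sin_mulr2n cos2sin2.
  have : sin y * sin y <= sin y * (c * cos y) by rewrite ler_wpM2l.
  rewrite !mulr2n; lra.
have arc u : 0 <= u <= sector_angle N -> nrm (PLpoly M N A k).[X%:C * cis u] <= B * expR D.
  move=> u0; apply: key => //; first exact: ltW.
  apply: le_trans CB.
  apply: (@le_trans _ _ (C * expR (X ^+ N) * expR (- X ^+ N))); last first.
    by rewrite -mulrA -expRD subrr expR0 mulr1.
  apply: ler_pM; rewrite ?nrm_ge0 ?expR_ge0//.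
    by rewrite (le_trans (Phi_le d_le _ _))// nrmX nrmM nrm_cis mulr1 nrm_real gtr0_norm.
  rewrite ler_expR.
  have : X ^+ N * (cos (N%:R * u) - c * sin (N%:R * u)) <= nrm A * X ^+ N.
    rewrite -Re_PL1 -(nrm_PL1 u (ltW X0)) (le_trans (ler_norm _))//.
    exact: normr_Re_le.
  have : X ^+ N * (1 + nrm A) <= X ^+ N * (e * cos (sector_half N) * X).
    by rewrite ler_wpM2l// exprn_ge0// ltW.
  have : e * X ^+ N.+1 * cos (sector_half N) <=
      e * X ^+ N.+1 * cos (N.+1%:R * u - sector_half N).
    by rewrite ler_wpM2l ?cosu// mulr_ge0 ?exprn_ge0// ltW.
  rewrite exprS; lra.
apply: maximum_principle => {x} [|x Kx]; first exact/compact_cone/ltW.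
have [u u0 xu] := cone_polar (sector_angle_gt0 N_gt1) Kx.
have r0 := nrm_ge0 (toC x).
have rX : nrm (toC x) <= X.
  by case: Kx => _ _; rewrite -[X in X <= _](nrm_sqr (toC x)) ler_pXn2r ?nnegrE// ltW.
have [rX'|rX'] := eqVneq (nrm (toC x)) X; first by left; rewrite xu rX'; exact: arc.
case: (Kx) => [x2 xl _].
have [x20|x20] := eqVneq x.2 0.
  left; suff -> : toC x = (nrm (toC x))%:C * cis 0 by exact: ray0.
  rewrite cis0 mulr1 /nrm /toC/= x20 expr0n addr0 sqrtr_sqr ger0_norm//.
  move: xl; rewrite x20 mulr0 subr0 pmulr_rge0//.
  by apply: sin_gt0_pi; exact: sector_angle_gt0.
have [xl0|xl0] := eqVneq (sin (sector_angle N) * x.1 - cos (sector_angle N) * x.2) 0.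
  left; suff -> : toC x = (nrm (toC x))%:C * cis (sector_angle N) by exact: ray1.
  rewrite [LHS]xu; congr (_ * cis _).
  have x1e : x.1 = nrm (toC x) * cos u.
    by have /(congr1 (@complex.Re R)) := xu; rewrite /= mul0r subr0.
  have x2e : x.2 = nrm (toC x) * sin u.
    by have /(congr1 (@complex.Im R)) := xu; rewrite /= mul0r addr0.
  move/eqP: xl0; rewrite {1}x1e {1}x2e.
  rewrite (_ : _ - _ = nrm (toC x) * sin (sector_angle N - u)); last by rewrite sinB; ring.
  have nx0 : nrm (toC x) != 0 by apply: contra x20; rewrite x2e => /eqP ->; rewrite mul0r.
  rewrite mulf_eq0 (negbTE nx0)/= => /eqP s'.
  apply/eqP; rewrite eq_le; case/andP: u0 => u0 ut; rewrite ut/= leNgt; apply/negP => lt.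
  have : 0 < sin (sector_angle N - u).
    apply: sin_gt0_pi; rewrite subr_gt0 lt/=.
    by have /andP[_] := sector_angle_gt0 N_gt1; lra.
  by rewrite s' ltxx.
right; apply: cone_interior.
- by rewrite lt_neqAle eq_sym x20.
- by rewrite lt_neqAle eq_sym xl0.
- by rewrite lt_neqAle rX' rX.
Qed.

End PhragmenLindelof.

(** * Passage to the limit, bound on the whole plane, and rigidity *)

Section Liouville.
Variables (R : realType) (d : nat -> R) (C : R).
Local Notation Re := complex.Re.
Local Notation Im := complex.Im.
Hypothesis d_le : forall m, `|d m| <= C.
Hypothesis phi_le : forall x, 0 <= x ->
  `|limn (series (fun m => d m * x ^+ m / m`!%:R))| <= C * expR (- x).

(** Removes an auxiliary positive parameter: first the damping [e], later the tilt [c]. *)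
Lemma le_expR_lim (a b q : R) :
  (forall e, 0 < e -> a <= b * expR (e * q)) -> a <= b.
Proof.
move=> h; have : (b * expR (harmonic m * q) @[m --> \oo] --> b * expR (0 * q))%classic.
  apply: cvgM; first exact: cvg_cst.
  apply: continuous_cvg; first exact: continuous_expR.
  by apply: cvgM; [exact: cvg_harmonic|exact: cvg_cst].
rewrite mul0r expR0 mulr1 => /cvgr_to_ge; apply; near=> m.
by apply: h; rewrite /harmonic invr_gt0 ltr0n.
Unshelve. all: by end_near. Qed.

(** [M] stays fixed while the comparison polynomial has order [m + 1] tending to infinity; the tail
    subtracted on the left covers the gap between the two truncations. *)
Lemma Phi_sector_e (N : nat) (c e : R) (M : nat) (r u : R) : (1 < N)%N ->
  sin (pi / (N%:R + 1)) <= c * cos (pi / (N%:R + 1)) -> 0 < e ->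
  0 <= r -> 0 <= u <= sector_angle R N ->
  nrm (Phi d M).[(r%:C * cis u) ^+ N] - C * exp_tail M (r ^+ N) <=
  C * expR (- (r ^+ N * (cos (N%:R * u) - c * sin (N%:R * u)))) * expR (e * r ^+ N.+1).
Proof.
move=> N1 c_ge e0 r0 /[dup] u01 /andP[u0 ut].
set z := r%:C * cis u; set a := _ - C * _.
have C0 := C_ge0 d_le.
have [a0|a0] := leP a 0.
  by rewrite (le_trans a0)// !mulr_ge0 ?expR_ge0.
pose A : R[i] := 1 +i* c; pose k : R[i] := (- e)%:C * cis (- sector_half R N).
have /andP[h0 h1] := sector_half_lt R N1.
have s0 : 0 < cos (sector_half R N).
  by apply: cos_gt0_pihalf; rewrite h1 andbT (lt_trans _ h0)// oppr_lt0 (lt_trans h0).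
(* Large enough to contain the point and to meet the requirement on the arc, and independent of
   [m]. *)
pose X := Num.max r ((1 + nrm A) / (e * cos (sector_half R N))).
have XA : 1 + nrm A <= e * cos (sector_half R N) * X.
  by rewrite mulrC -ler_pdivrMr ?mulr_gt0// le_max lexx orbT.
have rX : r <= X by rewrite le_max lexx.
have /andP[t0 tpi] := sector_angle_gt0 R N1.
have Kz : cone (sector_angle R N) X (Re z, Im z).
  split => /=; rewrite !mul0r ?subr0 ?addr0.
  - by rewrite mulr_ge0// sin_ge0_pi// u0 (le_trans ut)// ltW.
  - rewrite (_ : _ - _ = r * sin (sector_angle R N - u)); last by rewrite sinB; ring.
    by rewrite mulr_ge0// sin_ge0_pi// subr_ge0 ut/=; lra.
  - by rewrite !exprMn -mulrDr cos2Dsin2 mulr1 lerXn2r ?nnegrE// (le_trans r0).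
have nw : nrm (z ^+ N) = r ^+ N by rewrite nrmX nrmM nrm_cis mulr1 nrm_real ger0_norm.
(* Lower bound for the modulus of the [(m + 1)]-st power at [v], with limit [exp (Re v)]; it lets
   the comparison factors be divided out. *)
pose L (v : R[i]) (m : nat) := (1 - nrm v ^+ 2 * harmonic m) *
  expR (Re v - nrm v ^+ 2 / 2 * harmonic m).
have cL v : (L v m @[m --> \oo] --> expR (Re v))%classic.
  have -> : expR (Re v) = (1 - nrm v ^+ 2 * 0) * expR (Re v - nrm v ^+ 2 / 2 * 0).
    by rewrite !mulr0 !subr0 mul1r.
  apply: cvgM.
    apply: cvgB; first exact: cvg_cst.
    by apply: cvgM; [exact: cvg_cst|exact: cvg_harmonic].
  apply: continuous_cvg; first exact: continuous_expR.
  apply: cvgB; first exact: cvg_cst.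
  by apply: cvgM; [exact: cvg_cst|exact: cvg_harmonic].
pose Bd (m : nat) := C * (1 + expR (X ^+ N) * exp_tail m.+1 (X ^+ N))
    * expR (((nrm A * X ^+ N) ^+ 2 + (e * X ^+ N.+1) ^+ 2) / 2 * harmonic m).
have cB : (Bd m @[m --> \oo] --> C)%classic.
  have -> : C = C * (1 + expR (X ^+ N) * 0) *
      expR (((nrm A * X ^+ N) ^+ 2 + (e * X ^+ N.+1) ^+ 2) / 2 * 0).
    by rewrite !mulr0 addr0 expR0 !mulr1.
  apply: cvgM.
    apply: cvgM; first exact: cvg_cst.
    apply: cvgD; first exact: cvg_cst.
    apply: cvgM; first exact: cvg_cst.
    by have := @cvg_exp_tail R (X ^+ N); rewrite -cvg_shiftS.
  apply: continuous_cvg; first exact: continuous_expR.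
  by apply: cvgM; [exact: cvg_cst|exact: cvg_harmonic].
have cLL : (a * (L (A * z ^+ N) m * L (k * z ^+ N.+1) m) @[m --> \oo] -->
    a * (expR (Re (A * z ^+ N)) * expR (Re (k * z ^+ N.+1))))%classic.
  by apply: cvgM; [exact: cvg_cst|apply: cvgM; exact: cL].
have : a * (expR (Re (A * z ^+ N)) * expR (Re (k * z ^+ N.+1))) <= C.
  apply: (ler_cvg_to cLL cB); near=> m.
  have mM : (M <= m.+1)%N by near: m; exists M => // i /= /leqW.
  have m1 : nrm (A * z ^+ N) ^+ 2 <= m.+1%:R.
    rewrite -natr1 (@le_trans _ _ m%:R)// ?lerDl//.
    by near: m; exact: nbhs_infty_ger.
  have m2 : nrm (k * z ^+ N.+1) ^+ 2 <= m.+1%:R.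
    rewrite -natr1 (@le_trans _ _ m%:R)// ?lerDl//.
    by near: m; exact: nbhs_infty_ger.
  have := PLpoly_le d_le phi_le N1 c_ge e0 (ltn0Sn m) XA Kz.
  rewrite toCK horner_PLpoly nrmM nrmM -[leLHS]mulrA.
  have LE v : nrm v ^+ 2 <= m.+1%:R -> 0 <= L v m <= nrm ((1 + v / m.+1%:R%:C) ^+ m.+1).
    move=> hv; have := nrm_1D_exp_ge (ltn0Sn m) hv.
    rewrite invfM mulrA /L => ->; rewrite andbT mulr_ge0 ?expR_ge0// subr_ge0.
    by rewrite ler_pdivrMr ?mul1r.
  have aP : a <= nrm (Phi d m.+1).[z ^+ N].
    have := Phi_diff_le d_le (z ^+ N) mM; rewrite nw => hd.
    have := nrmD ((Phi d M).[z ^+ N] - (Phi d m.+1).[z ^+ N]) (Phi d m.+1).[z ^+ N].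
    rewrite subrK -[nrm (_ - _)]nrmN opprB /a; lra.
  have /andP[l10 l1] := LE _ m1; have /andP[l20 l2] := LE _ m2.
  have -> : ((nrm A * X ^+ N) ^+ 2 + (e * X ^+ N.+1) ^+ 2) / (2 * m.+1%:R) =
    ((nrm A * X ^+ N) ^+ 2 + (e * X ^+ N.+1) ^+ 2) / 2 * harmonic m.
    by rewrite /harmonic/= invfM mulrA.
  apply: le_trans.
  by apply: ler_pM => //; [exact: ltW|exact: mulr_ge0|exact: ler_pM].
rewrite -expRD -ler_pdivlMr ?expR_gt0// -expRN opprD expRD mulrA => /le_trans; apply.
rewrite (Re_PL1 N c r u) ler_wpM2l ?mulr_ge0 ?expR_ge0// ler_expR (Re_PL2 N e r u) opprK.
rewrite -[leRHS]mulr1 ler_wpM2l ?cos_le1// mulr_ge0 ?exprn_ge0// ltW.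
Unshelve. all: by end_near. Qed.

Lemma Phi_sector (N : nat) (c : R) (M : nat) (r u : R) : (1 < N)%N ->
  sin (pi / (N%:R + 1)) <= c * cos (pi / (N%:R + 1)) ->
  0 <= r -> 0 <= u <= sector_angle R N ->
  nrm (Phi d M).[(r%:C * cis u) ^+ N] <= C * exp_tail M (r ^+ N) +
  C * expR (- (r ^+ N * (cos (N%:R * u) - c * sin (N%:R * u)))).
Proof.
move=> N1 cN r0 u0; rewrite -lerBlDl; apply: (@le_expR_lim _ _ (r ^+ N.+1)) => e e0.
exact: Phi_sector_e.
Qed.

(** For an argument [t < pi] and a tilt [c > 0], every large N gives a sector reaching [t] and
    satisfying the tilt condition; an N-th root of [w] is then inserted, and [c] tends to 0. On the
    negative axis [- Re w = |w|], so the plain type bound suffices. *)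
Lemma Phi_half_plane (M : nat) (w : R[i]) : 0 <= Im w ->
  nrm (Phi d M).[w] <= C * exp_tail M (nrm w) + C * expR (- Re w).
Proof.
move=> w0; have [t /andP[t0 tpi] wt] := polar w0; set r := nrm w in wt *.
have C0 := C_ge0 d_le; have r0 : 0 <= r := nrm_ge0 w.
have Rw : Re w = r * cos t by rewrite wt/= mul0r subr0.
have [tp|tp] := eqVneq t pi.
  rewrite (le_trans (Phi_le d_le _ _))// -/r Rw tp cospi mulrN1 opprK lerDr.
  by rewrite mulr_ge0// exp_tail_ge0.
have {tp}tpi : t < pi by rewrite lt_neqAle tp.
rewrite -lerBlDl; apply: (@le_expR_lim _ _ (r * sin t)) => c c0.
have cpi : (pi * harmonic m @[m --> \oo] --> (0 : R))%classic.
  have -> : (0 : R) = pi * 0 by rewrite mulr0.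
  by apply: cvgM; [exact: cvg_cst|exact: cvg_harmonic].
have cc : (c * cos (pi * harmonic m) - sin (pi * harmonic m) @[m --> \oo] --> c)%classic.
  have {2}-> : c = c * cos 0 - sin 0 by rewrite cos0 sin0 mulr1 subr0.
  apply: cvgB; first apply: cvgM; first exact: cvg_cst.
    by apply: continuous_cvg => //; exact: continuous_cos.
  by apply: continuous_cvg => //; exact: continuous_sin.
have ct : (pi - (pi * harmonic m) *+ 2 @[m --> \oo] --> (pi : R))%classic.
  have : (pi - (pi * harmonic m) *+ 2 @[m --> \oo] --> (pi - 0 *+ 2 : R))%classic.
    by apply: cvgB; [exact: cvg_cst|rewrite mulr2n; apply: cvgD].
  by rewrite mul0rn subr0.
have : (\forall m \near \oo, [/\ (1 < m)%N,
    sin (pi * harmonic m) <= c * cos (pi * harmonic m) &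
    t <= pi - (pi * harmonic m) *+ 2 :> R])%classic.
  near=> m; split.
  - by near: m; exact: nbhs_infty_gt.
  - rewrite -subr_ge0 ltW//; near: m; exact: (cvgr_gt _ cc).
  - rewrite ltW//; near: m; exact: (cvgr_gt _ ct).
move=> [N _ /(_ N (leqnn N)) /= [N1 cN tN]].
rewrite /harmonic/= -natr1 in cN tN.
have N0 : (N%:R : R) != 0 by rewrite pnatr_eq0 -lt0n ltnW.
pose s := r `^ (N%:R^-1); have sN : s ^+ N = r.
  by rewrite -powR_mulrn ?powR_ge0// -powRrM mulVf// powRr1.
have tu : 0 <= t / N%:R <= sector_angle R N.
  rewrite divr_ge0//= ler_pdivrMr ?ltr0n ?(ltnW N1)// mulrC sector_angleM//.
have wE : w = (s%:C * cis (t / N%:R)) ^+ N.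
  by rewrite exprMn cisX -rmorphXn/= sN [N%:R * _]mulrC divfK.
have := @Phi_sector N c M s (t / N%:R) N1 cN (powR_ge0 _ _) tu; rewrite -wE sN [N%:R * _]mulrC divfK// -lerBlDl.
move=> /le_trans; apply; rewrite -[leRHS]mulrA -expRD ler_wpM2l// ler_expR Rw; lra.
Unshelve. all: by end_near. Qed.

(** The coefficients are real, so conjugation carries the upper half-plane to the lower one. *)
Lemma Phi_plane (M : nat) (w : R[i]) :
  nrm (Phi d M).[w] <= C * exp_tail M (nrm w) + C * expR (- Re w).
Proof.
have [w0|w0] := leP 0 (Im w); first exact: Phi_half_plane.
have nJ (z : R[i]) : nrm z^* = nrm z by case: z => a b; rewrite /nrm/= sqrrN.
have := @Phi_half_plane M w^*; rewrite nJ (_ : Re w^* = Re w); last by case: (w).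
rewrite -(nJ (Phi d M).[w]) => h.
have -> : (Phi d M).[w]^* = (Phi d M).[w^*].
  rewrite !horner_Phi rmorph_sum/=; apply: eq_bigr => m _.
  by rewrite rmorphM rmorphXn; congr (_ * _); exact: conjc_real.
by apply: h; case: (w) w0 => a b /= /ltW; rewrite oppr_ge0.
Qed.

Lemma coef_1DaX (a : R[i]) M l : ((1 + a *: 'X) ^+ M)`_l = (a ^+ l) *+ 'C(M, l).
Proof.
rewrite exprDn coef_sum.
under eq_bigr => i _ do rewrite expr1n mul1r exprZn coefMn coefZ coefXn.
have [lM|lM] := ltnP l M.+1.
  rewrite (bigD1 (Ordinal lM))//= eqxx mulr1 big1 ?addr0// => i.
  by rewrite -val_eqE/= eq_sym => /negbTE ->; rewrite mulr0 mul0rn.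
rewrite bin_small// mulr0n big1// => i _.
by rewrite gtn_eqF ?mulr0 ?mul0rn// (leq_trans (ltn_ord i)).
Qed.

(** Coefficientwise convergence of [(1 + X / (m + 1)) ^ (m + 1)] to the exponential series, by the
    ratio of consecutive binomials. *)
Lemma cvg_bin_div (l : nat) :
  ('C(m.+1, l)%:R * harmonic m ^+ l @[m --> \oo] --> (l`!%:R^-1 : R))%classic.
Proof.
elim: l => [|l IH].
  rewrite fact0 invr1 (_ : (fun _ => _) = fun=> 1); first exact: cvg_cst.
  by apply/funext => m; rewrite bin0 expr0 mulr1.
rewrite (_ : (fun _ => _) = fun m => 'C(m.+1, l)%:R * harmonic m ^+ l *
    ((1 - l%:R * harmonic m) / l.+1%:R)); last first.
  apply/funext => m; have [lm|lm] := leqP l m.+1.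
    have h : (l.+1 * 'C(m.+1, l.+1) = (m.+1 - l) * 'C(m.+1, l))%N by rewrite mul_bin_left.
    have {h} := congr1 (fun n : nat => n%:R : R) h; rewrite /= !natrM natrB// => h.
    apply: (@mulfI _ (l.+1%:R)); first by rewrite pnatr_eq0.
    rewrite mulrA h exprS /harmonic/=; field.
    by rewrite !nat1r !pnatr_eq0.
  by rewrite !bin_small ?mul0r// ltnS ltnW.
have -> : (l.+1`!%:R^-1 : R) = l`!%:R^-1 * ((1 - l%:R * 0) / l.+1%:R).
  by rewrite mulr0 subr0 mul1r factS natrM invfM mulrC.
apply: cvgM => //; apply: cvgM; last exact: cvg_cst.
apply: cvgB; first exact: cvg_cst.
by apply: cvgM; [exact: cvg_cst|exact: cvg_harmonic].
Qed.

(* [Phi * exp] is bounded, so its positive Taylor coefficients vanish. *)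
Lemma binomial_sum_eq0 (j : nat) : (0 < j)%N ->
  \sum_(i < j.+1) d i / (i`!%:R * (j - i)`!%:R) = 0.
Proof.
move=> j0; set S := \sum_(i < _) _; have C0 := C_ge0 d_le.
have SB (r : R) : 0 < r -> `|S| * r ^+ j <= C.
  move=> r0; have r0' := ltW r0.
  pose q m := \sum_(i < j.+1) d i / i`!%:R * ('C(m.+1, j - i)%:R * harmonic m ^+ (j - i)).
  have cq : (q m @[m --> \oo] --> S)%classic.
    have -> : S = \sum_(i < j.+1) d i / i`!%:R * (j - i)`!%:R^-1.
      by apply: eq_bigr => i _; rewrite invfM mulrA.
    apply: cvg_big => [|i _]; first exact: add_continuous.
    by apply: cvgM; [exact: cvg_cst|exact: cvg_bin_div].
  have c1 : (`|q m| * r ^+ j @[m --> \oo] --> `|S| * r ^+ j)%classic.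
    by apply: cvgM; [exact: cvg_norm|exact: cvg_cst].
  have c2 : (C * (1 + exp_tail m.+1 r * expR r) * expR (r ^+ 2 / 2 * harmonic m)
      @[m --> \oo] --> C)%classic.
    have {2}-> : C = C * (1 + 0 * expR r) * expR (r ^+ 2 / 2 * 0).
      by rewrite mulr0 mul0r addr0 expR0 !mulr1.
    apply: cvgM.
      apply: cvgM; first exact: cvg_cst.
      apply: cvgD; first exact: cvg_cst.
      apply: cvgM; last exact: cvg_cst.
      by have := @cvg_exp_tail R r; rewrite -cvg_shiftS.
    apply: continuous_cvg; first exact: continuous_expR.
    by apply: cvgM; [exact: cvg_cst|exact: cvg_harmonic].
  apply: (ler_cvg_to c1 c2); near=> m.
  have jm : (j <= m)%N by near: m; exact: nbhs_infty_ge.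
  (* Polynomial version of [F * exp], whose [j]-th coefficient is [q m]. On the circle of radius [r]
     its bound tends to [C] whatever [r] is. *)
  pose Q := Phi d m.+1 * (1 + (m.+1%:R^-1)%:C *: 'X) ^+ m.+1.
  have -> : `|q m| = nrm Q`_j.
    rewrite -nrm_real; congr nrm; rewrite coefM rmorph_sum/=; apply: eq_bigr => i _.
    rewrite coef_1DaX coef_poly (leq_trans (ltn_ord i))// 1?ltnS//.
    rewrite -rmorphXn -rmorphMn -rmorphM; congr (_%:C); congr (_ * _).
    by rewrite mulr_natl.
  apply: poly_coef_bound => // z zr; rewrite hornerM horner_exp hornerD hornerC hornerZ hornerX.
  rewrite nrmM mulrC [X in nrm ((1 + X) ^+ _)]mulrC fmorphV.
  apply: (@le_trans _ _ (expR (Re z + nrm z ^+ 2 / (2 * m.+1%:R)) *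
     (C * exp_tail m.+1 (nrm z) + C * expR (- Re z)))).
    by apply: ler_pM; rewrite ?nrm_ge0 ?nrm_1D_exp_le ?Phi_plane.
  have -> : nrm z ^+ 2 / (2 * m.+1%:R) = r ^+ 2 / 2 * harmonic m.
    by rewrite zr invfM mulrA.
  rewrite expRD mulrAC ler_wpM2r ?expR_ge0// mulrDr [X in _ + X]mulrCA -expRD subrr expR0.
  rewrite mulr1 zr [leRHS]mulrDr mulr1 addrC lerD2l.
  rewrite mulrCA ler_wpM2l// mulrC ler_wpM2l ?exp_tail_ge0// ler_expR.
  by rewrite -zr (le_trans (ler_norm _))// normr_Re_le.
apply/eqP; rewrite -normr_eq0 eq_le normr_ge0 andbT leNgt; apply/negP => S0.
(* This radius is at least 1, so its [j]-th power is no smaller, while [|S|] times it already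
   exceeds [C]. *)
have r1 : 0 < C / `|S| + 1 by rewrite ltr_wpDl// divr_ge0.
have := SB _ r1; rewrite leNgt => /negP[].
have r2 : C / `|S| + 1 <= (C / `|S| + 1) ^+ j.
  by rewrite ler_eXnr// lerDr divr_ge0.
apply: (@lt_le_trans _ _ (`|S| * (C / `|S| + 1))); last by rewrite ler_pM2l.
by rewrite mulrDr mulr1 mulrCA divff ?gt_eqF// mulr1 ltrDl.
Unshelve. all: by end_near. Qed.

(** The vanishing coefficients say that the binomial transform of [d] is 0 at every positive index;
    comparison with the expansion of [(1 - 1) ^ (j + 1)] inverts it by strong induction. *)
Lemma entire_rigidity_norm1 m : d m = (-1) ^+ m * d 0.
Proof.
elim/ltn_ind: m => -[|j] IH; first by rewrite expr0 mul1r.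
have := @binomial_sum_eq0 j.+1 isT.
have fE (i : 'I_j.+2) : d i / (i`!%:R * (j.+1 - i)`!%:R) =
    (j.+1`!%:R)^-1 * ('C(j.+1, i)%:R * d i).
  have ij : (i <= j.+1)%N by rewrite -ltnS.
  rewrite -(bin_fact ij) !natrM; field.
  by rewrite !pnatr_eq0 -!lt0n !fact_gt0 bin_gt0 ij.
rewrite (eq_bigr _ (fun i _ => fE i)) -mulr_sumr => /eqP.
rewrite mulf_eq0 invr_eq0 pnatr_eq0 -[_ == _]negbK -lt0n fact_gt0/= => /eqP.
rewrite big_ord_recr/=.
rewrite (eq_bigr (fun i : 'I_j.+1 => 'C(j.+1, i)%:R * (-1) ^+ i * d 0)); last first.
  by move=> i _; rewrite IH// mulrA.
rewrite binn mul1r -mulr_suml.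
have := @exprDn R 1 (-1) j.+1.
rewrite subrr expr0n/= big_ord_recr/= binn expr1n mul1r mulr1n.
under eq_bigr => i _ do rewrite expr1n mul1r -mulr_natl.
move=> h h2; have -> : d j.+1 = - (\sum_(i < j.+1) 'C(j.+1, i)%:R * (-1) ^+ i * d 0).
  by rewrite -mulr_suml; lra.
rewrite -mulr_suml -mulNr; congr (_ * _); lra.
Qed.

End Liouville.

(** Rescaling to [d m / s ^ m] and [x / s] reduces to type 1. In terms of functions,
    [F x = F 0 * exp (- s x)]. *)
Lemma entire_rigidity (R : realType) (d : nat -> R) (C s : R) : 0 < s ->
  (forall m, `|d m| <= C * s ^+ m) ->
  (forall x, 0 <= x ->
    `|limn (series (fun m => d m * x ^+ m / m`!%:R))| <= C * expR (- (s * x))) ->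
  forall m, d m = (- s) ^+ m * d 0.
Proof.
move=> s0 dC phiC m; pose d' m := d m / s ^+ m.
have sn0 i : s ^+ i != 0 by rewrite expf_neq0// gt_eqF.
have d'_le i : `|d' i| <= C.
  by rewrite normrM normfV normrX (gtr0_norm s0) ler_pdivrMr ?exprn_gt0.
have := @entire_rigidity_norm1 R d' C d'_le _ m; rewrite /d' expr0 divr1 => h.
have {}h : d m / s ^+ m = (-1) ^+ m * d 0.
  apply: h => x x0; have xs : 0 <= x / s by rewrite divr_ge0// ltW.
  have := phiC _ xs; rewrite mulrCA divff ?gt_eqF// mulr1.
  congr (`|limn (series _)| <= _); apply/funext => i.
  by rewrite expr_div_n; ring.
by rewrite -[LHS](divfK (sn0 m)) h [(- s) ^+ m]exprNn; ring.
Qed.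

(** * Integrals of [x^s exp (- c x^q)] over the half-line *)

Section PowerExponentialMoments.
Variable R : realType.
Local Notation mu := (@lebesgue_measure R).
Implicit Types (f F : R -> R) (c q s p : R).
Local Open Scope classical_set_scope.

Lemma integrable_addR (D : set (measurableTypeR R)) f g : measurable D ->
  mu.-integrable D (EFin \o f) -> mu.-integrable D (EFin \o g) ->
  mu.-integrable D (EFin \o (fun x => f x + g x)).
Proof.
by move=> mD fi gi; rewrite (_ : _ \o _ = ((EFin \o f) \+ (EFin \o g))%E) ?integrableD.
Qed.

Lemma integrable_mulR (D : set (measurableTypeR R)) (a : R) f : measurable D ->
  mu.-integrable D (EFin \o f) -> mu.-integrable D (EFin \o (fun x => a * f x)).
Proof. by move=> mD fi; exact: (integrableZl mD a fi). Qed.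

Lemma integrable_subR (D : set (measurableTypeR R)) f g : measurable D ->
  mu.-integrable D (EFin \o f) -> mu.-integrable D (EFin \o g) ->
  mu.-integrable D (EFin \o (fun x => f x - g x)).
Proof.
move=> mD fi gi; apply: integrable_addR => //.
rewrite (_ : (fun x => - g x) = (fun x => -1 * g x)); first exact: integrable_mulR.
by apply/funext => x; rewrite mulN1r.
Qed.

Lemma bigcup_itv0y : \bigcup_i `[(harmonic i : R), +oo[ = `]0, +oo[.
Proof.
apply/seteqP; split => x /=.
  move=> [i _ /=]; rewrite !in_itv/= !andbT; apply: lt_le_trans.
  by rewrite invr_gt0 ltr0n.
rewrite in_itv/= andbT => x0; have /cvgrPdist_lt /(_ _ x0)[i _ /(_ i (leqnn i))] := @cvg_harmonic R.
rewrite sub0r normrN ger0_norm ?invr_ge0// => ix.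
by exists i => //=; rewrite in_itv/= andbT ltW.
Qed.

(** The integrand may be singular at 0, so the closed half-lines from [1 / (i + 1)] exhaust the open
    one; the sign condition serves monotone convergence. *)
Lemma FTC2_0y f F (l0 l : R) :
  (forall x : R, 0 < x -> 0 <= f x) -> (forall x : R, 0 < x -> {for x, continuous f}) ->
  (forall x : R, 0 < x -> is_derive x 1 F (f x)) ->
  F x @[x --> 0^'+] --> l0 -> F x @[x --> +oo] --> l ->
  (\int[mu]_(x in `]0%R, +oo[) (f x)%:E = (l - l0)%:E)%E.
Proof.
move=> f0 cf dF Fl0 Fl.
have h0 i : 0 < harmonic i :> R by rewrite invr_gt0 ltr0n.
have E i : (\int[mu]_(x in `[(harmonic i), +oo[) (f x)%:E = (l - F (harmonic i))%:E)%E.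
  apply: (@ge0_continuous_FTC2y _ f F (harmonic i) l).
  - by move=> x hx; apply: f0; exact: lt_le_trans hx.
  - apply/continuous_within_itvcyP; split.
      move=> x; rewrite in_itv/= andbT => hx; apply: cf.
      exact: lt_trans hx.
    by apply: cvg_at_right_filter; apply: cf.
  - exact: Fl.
  - by move=> x hx; have [] := dF x (lt_trans (h0 i) hx).
  - apply: cvg_at_right_filter.
    have [dr _] := dF _ (h0 i).
    exact/differentiable_continuous/derivable1_diffP.
  - move=> x; rewrite in_itv/= andbT => hx.
    by have [_ <-] := dF x (lt_trans (h0 i) hx); rewrite derive1E.
have mf : measurable_fun (`]0, +oo[ : set R) f.
  apply: open_continuous_measurable_fun; first exact: interval_open.
  by move=> x; rewrite inE/= in_itv/= andbT; exact: cf.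
have : (\int[mu]_(x in `[(harmonic i), +oo[) (f x)%:E @[i --> \oo] -->
    \int[mu]_(x in `]0%R, +oo[) (f x)%:E)%E.
  rewrite -bigcup_itv0y; apply: ge0_nondecreasing_set_cvg_integral => //.
  - apply/nondecreasing_seqP => i; rewrite subsetEset; apply: subset_itvr.
    by rewrite bnd_simp lef_pV2 ?posrE ?ltr0n// ler_nat.
  - move=> i; apply/measurable_EFinP; apply: measurable_funS mf => //.
    by apply: subset_itvr; rewrite bnd_simp.
  - move=> i x /=; rewrite in_itv/= andbT => hx; rewrite lee_fin f0//.
    exact: lt_le_trans hx.
under eq_fun do rewrite E.
move=> c1; have c2 : ((l - F (harmonic i))%:E @[i --> \oo] --> (l - l0)%:E)%E.
  apply: cvg_EFin; first exact: nearW.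
  apply: cvgB; first exact: cvg_cst.
  by move/cvg_at_rightP : Fl0; apply; split => //; exact: cvg_harmonic.
exact: (cvg_unique (@ereal_hausdorff R) c1 c2).
Qed.

Lemma cvg_powRy p : 0 < p -> x `^ p @[x --> +oo] --> +oo.
Proof.
move=> p0; apply/cvgryPgt => A; near=> x.
pose B := Num.max A 1; have B0 : 0 < B by rewrite lt_max ltr01 orbT.
apply: (@le_lt_trans _ _ B); first by rewrite le_max lexx.
have -> : B = (B `^ p^-1) `^ p by rewrite -powRrM mulVf ?gt_eqF// powRr1 ?ltW.
have xB : B `^ p^-1 < x by near: x; apply: nbhs_pinfty_gt; exact: num_real.
apply: gt0_ltr_powR => //; rewrite nnegrE ?powR_ge0//.
Unshelve. all: by end_near. Qed.

Lemma continuous_powR p (x : R) : 0 < x -> {for x, continuous (fun y : R => y `^ p)}.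
Proof.
move=> x0; have [dr _] := is_derive1_powR p x0.
exact/differentiable_continuous/derivable1_diffP.
Qed.

Definition pe c q s (x : R) : R := x `^ s * expR (- (c * x `^ q)).

Lemma pe_ge0 c q s x : 0 <= pe c q s x.
Proof. by rewrite mulr_ge0 ?powR_ge0 ?expR_ge0. Qed.

Lemma is_derive_pe c q s (x : R) : 0 < x ->
  is_derive x 1 (pe c q s) (s * pe c q (s - 1) x - c * q * pe c q (s + q - 1) x).
Proof.
move=> x0.
have d1 := is_derive1_powR s x0; have d2 := is_derive1_powR q x0.
have d3 : is_derive x 1 (fun y => - (c * y `^ q)) (- (c * (q * x `^ (q - 1)))).
  exact: is_deriveN.
have d4 := @is_derive1_comp R expR (fun y => - (c * y `^ q)) x _ _ (is_derive_expR _) d3.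
have d5 := is_deriveM d1 d4.
apply: is_derive_eq d5 _.
rewrite /pe/= ![_ *: _]mulrC.
have -> : s + q - 1 = s + (q - 1) by rewrite addrA.
rewrite (@powRD _ x s (q - 1)) ?(gt_eqF x0) ?implybT//; ring.
Qed.

Lemma continuous_pe c q s (x : R) : 0 < x -> {for x, continuous (pe c q s)}.
Proof.
move=> x0; have [dr _] := is_derive_pe c q s x0.
exact/differentiable_continuous/derivable1_diffP.
Qed.

(** Derivative of [- 1 / (1 + x^p)]: an explicit majorant of total mass 1, of order [x^(p-1)] at 0
    and [x^(-p-1)] at infinity. With [p = s + 1] it matches [x^s] near 0. *)
Definition dom p (x : R) : R := p * x `^ (p - 1) / (1 + x `^ p) ^+ 2.

Lemma is_derive_dom p (x : R) : 0 < x ->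
  is_derive x 1 (fun y => - (1 + y `^ p)^-1) (dom p x).
Proof.
move=> x0; have d1 := is_derive1_powR p x0.
have n0 : 1 + x `^ p != 0 by rewrite gt_eqF// ltr_wpDr// powR_ge0.
have d2 := is_deriveD (is_derive_cst (1 : R) x 1) d1.
have d3 := @is_deriveV R (fun y => 1 + y `^ p) x _ 1 n0 d2.
apply: is_derive_eq (is_deriveN d3) _.
by rewrite add0r scaleNr opprK /dom [LHS]mulrC.
Qed.

Lemma dom_ge0 p x : 0 <= p -> 0 <= dom p x.
Proof.
move=> p0; apply: divr_ge0; last exact: sqr_ge0.
by rewrite mulr_ge0 ?powR_ge0.
Qed.

Lemma cvg_dom0 p : 0 < p -> - (1 + x `^ p)^-1 @[x --> 0^'+] --> (-1 : R).
Proof.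
move=> p0; have -> : -1 = - (1 + 0)^-1 :> R by rewrite addr0 invr1.
apply: cvgN; apply: cvgV; first by rewrite addr0.
by apply: cvgD; [exact: cvg_cst|exact: powR_cvg0].
Qed.

Lemma cvg_domy p : 0 < p -> - (1 + x `^ p)^-1 @[x --> +oo] --> (0 : R).
Proof.
move=> p0; have -> : 0 = - 0 :> R by rewrite oppr0.
apply: cvgN.
apply/gtr0_cvgV0; first by apply: nearW => x; rewrite ltr_wpDr// powR_ge0.
exact: (cvg_comp _ _ (cvg_powRy p0) (cvg_addrl _)).
Qed.

Lemma continuous_dom p (x : R) : 0 < x -> {for x, continuous (dom p)}.
Proof.
move=> x0; apply: cvgM.
  by apply: cvgM; [exact: cvg_cst|exact: continuous_powR].
apply: cvgV; first by rewrite expf_neq0// gt_eqF// ltr_wpDr// powR_ge0.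
have cx : {for x, continuous (fun y => 1 + y `^ p)}.
  by apply: cvgD; [exact: cvg_cst|exact: continuous_powR].
exact: (cvgM cx cx).
Qed.

Lemma integral_dom p : 0 < p -> (\int[mu]_(x in `]0%R, +oo[) (dom p x)%:E = 1)%E.
Proof.
move=> p0; rewrite (FTC2_0y _ _ (is_derive_dom p) (cvg_dom0 p0) (cvg_domy p0)).
- by rewrite sub0r opprK.
- by move=> x _; rewrite dom_ge0// ltW.
- exact: continuous_dom.
Qed.

Lemma integrable_dom p : 0 < p -> mu.-integrable `]0, +oo[ (EFin \o dom p).
Proof.
move=> p0; apply/integrableP; split.
  apply/measurable_EFinP; apply: open_continuous_measurable_fun; first exact: interval_open.
  by move=> x; rewrite inE/= in_itv/= andbT; exact: continuous_dom.
under eq_integral do rewrite /= ger0_norm ?dom_ge0 ?(ltW p0)//.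
by rewrite integral_dom// ltry.
Qed.

Lemma measurable_pe c q s : measurable_fun setT (pe c q s).
Proof.
apply: measurable_funM; first exact: measurable_powR.
apply: measurableT_comp => //; apply: measurableT_comp => //.
by apply: measurable_funM => //; exact: measurable_powR.
Qed.

(** With [y = x^q] and an integer [n >= p / q], the left factor is at most [4 (1 + y)^(2n)], and a
    single term of the series of [exp (c (1 + y))] controls it; the shift by 1 costs the factor
    [exp c]. *)
Lemma powR_exp_bound c q p : 0 < c -> 0 < q -> 0 < p -> exists2 K, 0 < K &
  forall x : R, 0 < x -> (1 + x `^ p) ^+ 2 * expR (- (c * x `^ q)) <= K.
Proof.
move=> c0 q0 p0; pose n := Num.bound (p / q).
have pn : p / q <= n%:R by rewrite ltW// archi_boundP// divr_ge0 ?ltW.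
pose N := (n * 2)%N.
have N0 : (0 < N`!%:R :> R) by rewrite ltr0n fact_gt0.
exists (4 * (N`!%:R / c ^+ N * expR c)).
  by rewrite !mulr_gt0 ?expR_gt0 ?invr_gt0 ?exprn_gt0.
move=> x x0; set y := x `^ q; have y0 : 0 < y by rewrite powR_gt0.
have y1 : 1 <= 1 + y by rewrite lerDl ltW.
have y2 : 0 <= 1 + y := le_trans ler01 y1.
have xp : x `^ p <= (1 + y) ^+ n.
  rewrite -powR_mulrn; last exact: le_trans y1.
  rewrite (@le_trans _ _ (y `^ (p / q)))//.
    by rewrite /y -powRrM mulrCA divff ?mulr1// gt_eqF.
  apply: (@le_trans _ _ ((1 + y) `^ (p / q))); last exact: ler_powR.
  apply: ge0_ler_powR; rewrite ?nnegrE ?lerDr//; first by rewrite divr_ge0// ltW.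
  exact: ltW.
rewrite expRN ler_pdivrMr ?expR_gt0//.
apply: (@le_trans _ _ (4 * (1 + y) ^+ N)).
  have -> : 4 * (1 + y) ^+ N = (2 * (1 + y) ^+ n) ^+ 2 by rewrite exprMn /N exprM; ring.
  rewrite lerXn2r ?nnegrE ?addr_ge0 ?powR_ge0 ?mulr_ge0 ?exprn_ge0//.
  by rewrite mulr2n mulrDl !mul1r lerD// exprn_ege1.
rewrite -!mulrA ler_pM2l// -expRD.
have -> : c + c * y = c * (1 + y) by rewrite mulrDr mulr1.
have cy : 0 <= c * (1 + y) by apply: mulr_ge0 => //; exact: ltW.
rewrite mulrA mulrAC ler_pdivlMr ?exprn_gt0// -exprMn [(1 + y) * c]mulrC
  [leRHS]mulrC -ler_pdivrMr//.
case: N N0 => [|N] N0; first by rewrite expr0 fact0 divff// (le_trans _ (expR_ge1Dx _))// lerDl.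
by apply: le_trans (expR_ge1Dxn N cy); rewrite lerDr.
Qed.

Lemma pe_le_dom c q s : 0 < c -> 0 < q -> -1 < s -> exists2 K, 0 < K &
  forall x : R, 0 < x -> pe c q s x <= K * dom (s + 1) x.
Proof.
move=> c0 q0 s1; have p0 : 0 < s + 1 by rewrite -ltrBlDr sub0r.
have [K K0 hK] := powR_exp_bound c0 q0 p0.
exists (K / (s + 1)); first by rewrite divr_gt0.
move=> x x0; rewrite /dom addrK.
have d1 : 0 < 1 + x `^ (s + 1) by rewrite ltr_wpDr// powR_ge0.
have d0 : 0 < (1 + x `^ (s + 1)) ^+ 2 by rewrite exprn_gt0.
have -> : K / (s + 1) * ((s + 1) * x `^ s / (1 + x `^ (s + 1)) ^+ 2) =
    x `^ s * (K / (1 + x `^ (s + 1)) ^+ 2) by field; rewrite (gt_eqF d1) (gt_eqF p0).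
rewrite ler_wpM2l ?powR_ge0// ler_pdivlMr// mulrC.
exact: hK.
Qed.

Lemma integrable_pe c q s : 0 < c -> 0 < q -> -1 < s ->
  mu.-integrable `]0, +oo[ (EFin \o pe c q s).
Proof.
move=> c0 q0 s1; have [K K0 hK] := pe_le_dom c0 q0 s1.
have p0 : 0 < s + 1 by rewrite -ltrBlDr sub0r.
apply: le_integrable (integrableZl _ K (integrable_dom p0)) => //.
  by apply/measurable_EFinP; apply: measurable_funTS; exact: measurable_pe.
move=> x /=; rewrite in_itv/= andbT => x0; rewrite lee_fin !ger0_norm ?pe_ge0 ?hK//.
by rewrite mulr_ge0 ?dom_ge0// ltW.
Qed.

Lemma cvg_pe0 c q s : 0 < c -> 0 < s -> pe c q s x @[x --> 0^'+] --> (0 : R).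
Proof.
move=> c0 s0; apply: (@squeeze_cvgr _ _ _ _ (cst 0) (fun y => y `^ s)); last exact: powR_cvg0.
  apply: nearW => x; rewrite pe_ge0/= ler_piMr ?powR_ge0// -expR0 ler_expR oppr_le0.
  by rewrite mulr_ge0 ?powR_ge0 ?ltW.
exact: cvg_cst.
Qed.

Lemma cvg_pey c q s : 0 < c -> 0 < q -> 0 < s -> pe c q s x @[x --> +oo] --> (0 : R).
Proof.
move=> c0 q0 s0; have [K K0 hK] := powR_exp_bound c0 q0 s0.
apply: (@squeeze_cvgr _ _ _ _ (cst 0) (fun x => - K * - (1 + x `^ s)^-1)).
- near=> x; have x0 : 0 < x by near: x; apply: nbhs_pinfty_gt; exact: num_real.
  rewrite pe_ge0/= mulrNN.
  have d0 : 0 < 1 + x `^ s by rewrite ltr_wpDr// powR_ge0.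
  have := hK _ x0; rewrite mulrC -ler_pdivlMr ?exprn_gt0// => h.
  rewrite /pe mulrC (le_trans (ler_wpM2r (powR_ge0 _ _) h))//.
  rewrite -mulrA ler_pM2l// expr2 invfM -mulrA ler_piMr ?invr_ge0 ?(ltW d0)//.
  by rewrite mulrC ler_pdivrMr// mul1r lerDr.
- exact: cvg_cst.
- rewrite -[X in _ --> X](mulr0 (- K)); apply: cvgM; [exact: cvg_cst|exact: cvg_domy].
Unshelve. all: by end_near. Qed.

(** Integration by parts: the difference of the two integrands is the derivative of
    [x^(s+1) exp (- c x^q)], which vanishes at both ends. *)
Lemma pe_recursion c q s : 0 < c -> 0 < q -> -1 < s ->
  (s + 1) * Rintegral mu `]0, +oo[ (pe c q s) =
  c * q * Rintegral mu `]0, +oo[ (pe c q (s + q)).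
Proof.
move=> c0 q0 s1; have p0 : 0 < s + 1 by rewrite -ltrBlDr sub0r.
have sq1 : -1 < s + q by rewrite (lt_trans s1)// ltrDl.
have p1 : 0 < s + q + 1 by rewrite -ltrBlDr sub0r.
have [K K0 hK] := pe_le_dom c0 q0 sq1.
(* That derivative changes sign, whereas [FTC2_0y] wants a nonnegative integrand. Adding [L * dom]
   restores the sign, and its known integral [L] is removed at the end. *)
pose L := c * q * K; have L0 : 0 < L by rewrite !mulr_gt0.
pose g x := (s + 1) * pe c q s x - c * q * pe c q (s + q) x + L * dom (s + q + 1) x.
have cq0 : 0 < c * q by rewrite mulr_gt0.
pose G x := pe c q (s + 1) x + L * - (1 + x `^ (s + q + 1))^-1.
have E : (\int[mu]_(x in `]0%R, +oo[) (g x)%:E = L%:E)%E.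
  have h1 (x : R) : 0 < x -> 0 <= g x.
    move=> x0; rewrite /g -addrA; apply: addr_ge0.
      by rewrite mulr_ge0 ?pe_ge0// ltW.
    by rewrite addrC subr_ge0 /L -[leRHS]mulrA ler_pM2l// hK.
  have h2 (x : R) : 0 < x -> {for x, continuous g}.
    move=> x0; apply: cvgD; first apply: cvgB.
    + by apply: cvgM; [exact: cvg_cst|exact: continuous_pe].
    + by apply: cvgM; [exact: cvg_cst|exact: continuous_pe].
    + by apply: cvgM; [exact: cvg_cst|exact: continuous_dom].
  have h3 (x : R) : 0 < x -> is_derive x 1 G (g x).
    move=> x0; have d1 := is_derive_pe c q (s + 1) x0.
    have d2 := is_derive_dom (s + q + 1) x0.
    apply: is_derive_eq (is_deriveD d1 (is_deriveZ L d2)) _.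
    by rewrite /g addrK (_ : s + 1 + q - 1 = s + q)//; ring.
  have h4 : G x @[x --> 0^'+] --> 0 + L * -1.
    apply: cvgD; first exact: cvg_pe0.
    by apply: cvgM; [exact: cvg_cst|exact: cvg_dom0].
  have h5 : G x @[x --> +oo] --> 0 + L * 0.
    apply: cvgD; first exact: cvg_pey.
    by apply: cvgM; [exact: cvg_cst|exact: cvg_domy].
  by rewrite (FTC2_0y h1 h2 h3 h4 h5) mulr0 addr0 mulrN1 add0r sub0r opprK.
have m0y : measurable (`]0, +oo[ : set (measurableTypeR R)) by exact: measurable_itv.
have i1 := integrable_pe c0 q0 s1; have i2 := integrable_pe c0 q0 sq1.
have i3 := integrable_dom p1.
have i1' : mu.-integrable `]0, +oo[ (EFin \o (fun x => (s + 1) * pe c q s x)).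
  exact: integrable_mulR.
have i2' : mu.-integrable `]0, +oo[ (EFin \o (fun x => c * q * pe c q (s + q) x)).
  exact: integrable_mulR.
have i3' : mu.-integrable `]0, +oo[ (EFin \o (fun x => L * dom (s + q + 1) x)).
  exact: integrable_mulR.
have i4 : mu.-integrable `]0, +oo[
    (EFin \o (fun x => (s + 1) * pe c q s x - c * q * pe c q (s + q) x)).
  exact: integrable_subR.
have : Rintegral mu `]0, +oo[ g = L by rewrite /Rintegral E.
rewrite RintegralD// RintegralB// !RintegralZl//.
rewrite {3}/Rintegral integral_dom//= mulr1 => /(canRL (addrK _)).
by rewrite subrr => /eqP; rewrite subr_eq0 => /eqP.
Qed.

End PowerExponentialMoments.

(** * Gamma, moments on the whole line, integration of series *)

Section SymmetricMoments.
Variable R : realType.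
Local Notation mu := (@lebesgue_measure R).
Local Open Scope classical_set_scope.
Implicit Types (f g : R -> R) (c q s : R).

Lemma Rintegral_pe_gt0 c q s : 0 < c -> 0 < q -> -1 < s ->
  0 < Rintegral mu `]0, +oo[ (pe c q s).
Proof.
move=> c0 q0 s1; have ip := integrable_pe c0 q0 s1.
rewrite lt_neqAle Rintegral_ge0 ?andbT => [|x _]; last exact: pe_ge0.
apply/eqP => h.
have m0y : measurable (`]0, +oo[ : set (measurableTypeR R)) by exact: measurable_itv.
have mp : measurable_fun (`]0, +oo[ : set (measurableTypeR R)) (EFin \o pe c q s).
  by apply/measurable_EFinP; apply: measurable_funTS; exact: measurable_pe.
have /(ae_eq_integral_abs mu m0y mp)[N [mN N0 NS]] :
    (\int[mu]_(x in `]0%R, +oo[) `|(EFin \o pe c q s) x| = 0)%E.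
  under eq_integral do rewrite /= ger0_norm ?pe_ge0//.
  rewrite -[LHS]fineK; last exact: integrable_fin_num.
  by rewrite -/(Rintegral mu _ (pe c q s)) -h.
have : (mu `]0%R, +oo[ <= mu N)%E.
  apply: le_measure; rewrite ?inE//.
  move=> x x0; apply: NS => /= /(_ x0)/= /eqP; rewrite eqe.
  by move: x0 => /=; rewrite in_itv/= andbT => x0; rewrite gt_eqF// mulr_gt0 ?powR_gt0 ?expR_gt0.
by rewrite N0 lebesgue_measure_itv/= ltey/= leNgt ltey.
Qed.

Lemma Gamma_pe (x : R) : Gamma x = Rintegral mu `]0, +oo[ (pe 1 1 (x - 1)).
Proof.
apply: eq_Rintegral => t /set_mem/=; rewrite in_itv/= andbT => t0.
by rewrite /pe powRr1 ?mul1r// ltW.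
Qed.

Lemma Gamma_gt0 (x : R) : 0 < x -> 0 < Gamma x.
Proof. by move=> x0; rewrite Gamma_pe Rintegral_pe_gt0// ltrBrDr addNr. Qed.

Lemma Gamma_rec (x : R) : 0 < x -> Gamma (x + 1) = x * Gamma x.
Proof.
move=> x0; rewrite !Gamma_pe addrK.
have := @pe_recursion R 1 1 (x - 1) ltr01 ltr01; rewrite ltrBrDr addNr => /(_ x0).
by rewrite subrK !mul1r.
Qed.

(** Rising factorial, equal to [Gamma (x + m) / Gamma x] for [x > 0]; it frees all later series from
    Gamma. *)
Definition poch (x : R) (m : nat) : R := \prod_(i < m) (x + i%:R).

Lemma pochS x m : poch x m.+1 = poch x m * (x + m%:R).
Proof. by rewrite /poch big_ord_recr. Qed.

Lemma poch_gt0 x m : 0 < x -> 0 < poch x m.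
Proof. by move=> x0; apply: prodr_gt0 => i _; rewrite ltr_wpDr. Qed.

Lemma ler_poch x y m : 0 < x -> x <= y -> poch x m <= poch y m.
Proof.
move=> x0 xy; apply: ler_prod => i _.
by rewrite lerD2r xy addr_ge0// ltW.
Qed.

Lemma Gamma_poch (x : R) m : 0 < x -> Gamma (x + m%:R) = poch x m * Gamma x.
Proof.
move=> x0; elim: m => [|m IH]; first by rewrite addr0 /poch big_ord0 mul1r.
rewrite pochS -natr1 addrA Gamma_rec ?IH; last by rewrite ltr_wpDr.
by rewrite mulrA [poch x m * _]mulrC.
Qed.

Lemma integral_normr f : measurable_fun setT f -> (forall x, 0 <= f x) ->
  (\int[mu]_x (f `|x|)%:E = 2%:E * \int[mu]_(x in `]0%R, +oo[) (f x)%:E)%E.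
Proof.
move=> mf f0; pose h (x : R) : \bar R := (f `|x|)%:E.
have mh : measurable_fun setT h.
  by apply/measurable_EFinP; apply: measurableT_comp => //; exact: normr_measurable.
have h0 x : (0 <= h x)%E by rewrite lee_fin.
have e1 : (\int[mu]_(x in `]0%R, +oo[) h x = \int[mu]_(x in `]0%R, +oo[) (f x)%:E)%E.
  apply: eq_integral => x /set_mem/=; rewrite in_itv/= andbT => x0.
  by rewrite /h gtr0_norm.
have e2 : (\int[mu]_(x in `]-oo, 0%R]) h x = \int[mu]_(x in `]0%R, +oo[) h x)%E.
  rewrite integral_itv_obnd_cbnd; last exact: measurable_funTS.
  rewrite ge0_integration_by_substitution0//.
  by apply: eq_integral => x _; rewrite /h normrN.
rewrite -[LHS]/(\int[mu]_x h x)%E.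
have -> : [set: R] = `]-oo, 0%R] `|` `]0%R, +oo[.
  by rewrite -itv_bndbnd_setU ?bnd_simp// set_itvNyy.
rewrite ge0_integral_setU//=.
- by rewrite e2 e1 -mule2n -mule_natl.
- exact: measurable_funTS.
- apply/disj_setPS => x [/=]; rewrite !in_itv/= andbT => h1 h2.
  by have := le_lt_trans h1 h2; rewrite ltxx.
Qed.

Definition pa c q s (x : R) : R := pe c q s `|x|.

Lemma pa_ge0 c q s x : 0 <= pa c q s x.
Proof. exact: pe_ge0. Qed.

Lemma measurable_pa c q s : measurable_fun setT (pa c q s).
Proof. by apply: measurableT_comp; [exact: measurable_pe|exact: normr_measurable]. Qed.

Lemma integrable_pa c q s : 0 < c -> 0 < q -> -1 < s ->
  mu.-integrable setT (EFin \o pa c q s).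
Proof.
move=> c0 q0 s1; apply/integrableP; split.
  by apply/measurable_EFinP; exact: measurable_pa.
under eq_integral do rewrite /= ger0_norm ?pa_ge0//.
rewrite integral_normr; [|exact: measurable_pe|exact: pe_ge0].
have : (\int[mu]_(x in `]0%R, +oo[) (pe c q s x)%:E < +oo)%E.
  apply: integrable_lty; first exact: measurable_itv.
  exact: integrable_pe.
by apply: lte_mul_pinfty.
Qed.

Lemma Rintegral_pa c q s : 0 < c -> 0 < q -> -1 < s ->
  Rintegral mu setT (pa c q s) = 2 * Rintegral mu `]0, +oo[ (pe c q s).
Proof.
move=> c0 q0 s1.
rewrite /Rintegral integral_normr; [|exact: measurable_pe|exact: pe_ge0].
by rewrite fineM// integrable_fin_num//; exact: integrable_pe.
Qed.

Lemma Rintegral_pa_gt0 c q s : 0 < c -> 0 < q -> -1 < s ->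
  0 < Rintegral mu setT (pa c q s).
Proof. by move=> c0 q0 s1; rewrite Rintegral_pa// mulr_gt0// Rintegral_pe_gt0. Qed.

(** Each use of [pe_recursion] raises the exponent by [q] and contributes the factor
    [((s + 1) / q + m) / c]. *)
Lemma Rintegral_pa_poch c q s m : 0 < c -> 0 < q -> -1 < s ->
  Rintegral mu setT (pa c q (s + q * m%:R)) =
  poch ((s + 1) / q) m / c ^+ m * Rintegral mu setT (pa c q s).
Proof.
move=> c0 q0 s1; elim: m => [|m IH].
  by rewrite mulr0 addr0 /poch big_ord0 expr0 divr1 mul1r.
have sm : -1 < s + q * m%:R by rewrite (lt_le_trans s1)// lerDl mulr_ge0// ltW.
have h := pe_recursion c0 q0 sm.
rewrite -natr1 mulrDr mulr1 addrA.
have {}h : (s + q * m%:R + 1) * Rintegral mu setT (pa c q (s + q * m%:R)) =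
    c * q * Rintegral mu setT (pa c q (s + q * m%:R + q)).
  have sq : -1 < s + q * m%:R + q by rewrite (lt_trans sm)// ltrDl.
  by rewrite !Rintegral_pa// mulrCA h mulrCA.
have cq : c * q != 0 by rewrite mulf_neq0// gt_eqF.
apply: (mulfI cq); rewrite -h IH pochS exprS.
have cm : c ^+ m != 0 by rewrite expf_neq0// gt_eqF.
by field; rewrite cm !gt_eqF.
Qed.

Lemma ge0_integral_opp (h : R -> \bar R) : measurable_fun setT h ->
  (forall x, 0 <= h x)%E -> (\int[mu]_x h (- x)%R = \int[mu]_x h x)%E.
Proof.
move=> mh h0.
have := @ge0_integral_pushforward _ _ _ _ _ (-%R : measurableTypeR R -> measurableTypeR R)
  (@oppr_measurable R setT) mu setT h measurableT mh (fun x _ => h0 x).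
rewrite preimage_setT => <-.
by apply: eq_measure_integral => A mA _; exact: lebesgue_measureN.
Qed.

Lemma Rintegral_opp f : measurable_fun setT f ->
  Rintegral mu setT (fun x => f (- x)) = Rintegral mu setT f.
Proof.
move=> mf; congr fine; rewrite [LHS]integralE [RHS]integralE; congr (_ - _)%E.
  rewrite -[RHS]ge0_integral_opp//; last first.
    by apply: measurable_funepos; exact/measurable_EFinP.
  by apply: eq_integral => x _; rewrite !funeposE.
rewrite -[RHS]ge0_integral_opp//; last first.
  by apply: measurable_funeneg; exact/measurable_EFinP.
by apply: eq_integral => x _; rewrite !funenegE.
Qed.

Lemma Rintegral_series (u : nat -> R -> R) (U D : R -> R) :
  (forall m, measurable_fun setT (u m)) ->
  mu.-integrable setT (EFin \o D) ->
  (forall M x, \sum_(0 <= m < M) `|u m x| <= D x) ->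
  (forall x, series (u ^~ x) @ \oo --> U x) ->
  mu.-integrable setT (EFin \o U) /\
  series (fun m => Rintegral mu setT (u m)) @ \oo --> Rintegral mu setT U.
Proof.
move=> mu_ iD uD uU.
have mS M : measurable_fun setT (fun x => series (u ^~ x) M).
  by apply: measurable_sum => m; exact: mu_.
have mU : measurable_fun setT U by apply: (measurable_fun_cvg mS) => x _; exact: uU.
have uDm m x : `|u m x| <= D x.
  apply: le_trans (uD m.+1 x); rewrite big_nat_recr//= lerDr sumr_ge0//.
have iu m : mu.-integrable setT (EFin \o u m).
  apply: le_integrable iD => //; first by apply/measurable_EFinP; exact: mu_.
  by move=> x _ /=; rewrite lee_fin (le_trans (uDm m x))// ler_norm.
have mS' M : measurable_fun setT (fun x => (series (u ^~ x) M)%:E).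
  exact/measurable_EFinP.
have mU' : measurable_fun setT (EFin \o U) by exact/measurable_EFinP.
have cS : {ae mu, forall x, setT x -> (series (u ^~ x) M)%:E @[M --> \oo] --> (EFin \o U) x}.
  by apply: aeW => x _; apply: cvg_EFin; [exact: nearW|exact: uU].
have bS : {ae mu, forall x M, setT x -> (`|(series (u ^~ x) M)%:E| <= (EFin \o D) x)%E}.
  apply: aeW => x M _ /=; rewrite lee_fin (le_trans _ (uD M x))//.
  exact: ler_norm_sum.
have [iU _ cU] := @dominated_convergence _ _ _ mu setT measurableT
  (fun M x => (series (u ^~ x) M)%:E) (EFin \o U) (EFin \o D) mS' mU' cS iD bS.
split => //.
have E M : (\int[mu]_x (series (u ^~ x) M)%:E)%E = (series (fun m => Rintegral mu setT (u m)) M)%:E.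
  under eq_integral do rewrite /series/= -sumEFin.
  rewrite integral_sum// -sumEFin; apply: eq_bigr => m _.
  rewrite /Rintegral fineK//; apply: integrable_fin_num => //; exact: iu.
move: cU; under eq_fun do rewrite E.
have -> : (\int[mu]_x (EFin \o U) x)%E = (Rintegral mu setT U)%:E.
  by rewrite /Rintegral fineK//; exact: integrable_fin_num.
exact: fine_cvg.
Qed.

End SymmetricMoments.

(** * Determinacy of the moments in [|x|^q] *)

Section MomentDeterminacy.
Variable R : realType.
Local Notation mu := (@lebesgue_measure R).
Local Open Scope classical_set_scope.
Implicit Types (u f g : R -> R).

Lemma ae_impl (P Q : R -> Prop) : (forall x, P x -> Q x) ->
  {ae mu, forall x, P x} -> {ae mu, forall x, Q x}.
Proof.
move=> PQ [N [mN N0 NP]]; exists N; split => // x nQ; apply: NP => /= px.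
exact/nQ/PQ.
Qed.

Lemma ae_and (P Q : R -> Prop) : {ae mu, forall x, P x} -> {ae mu, forall x, Q x} ->
  {ae mu, forall x, P x /\ Q x}.
Proof.
move=> [N [mN N0 NP]] [M [mM M0 MQ]]; exists (N `|` M); split.
- exact: measurableU.
- by rewrite measureU0.
- move=> x /= /not_andP[nP|nQ]; [left; exact: NP|right; exact: MQ].
Qed.

Lemma Rintegral_dominated_cvg (F : nat -> R -> R) (f D : R -> R) :
  (forall m, measurable_fun setT (F m)) -> measurable_fun setT f ->
  mu.-integrable setT (EFin \o D) -> (forall m x, `|F m x| <= D x) ->
  {ae mu, forall x, F m x @[m --> \oo] --> f x} ->
  Rintegral mu setT (F m) @[m --> \oo] --> Rintegral mu setT f.
Proof.
move=> mF mf iD FD cF.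
have mF' m : measurable_fun setT (EFin \o F m) by apply/measurable_EFinP; exact: mF.
have mf' : measurable_fun setT (EFin \o f) by apply/measurable_EFinP.
have cF' : {ae mu, forall x, setT x -> (EFin \o F m) x @[m --> \oo] --> (EFin \o f) x}.
  by apply: ae_impl cF => x cx _; apply: cvg_EFin; [exact: nearW|exact: cx].
have bF : {ae mu, forall x m, setT x -> (`|(EFin \o F m) x| <= (EFin \o D) x)%E}.
  by apply: aeW => x m _ /=; rewrite lee_fin.
have [iF _ c] := @dominated_convergence _ _ _ mu setT measurableT
  (fun m => EFin \o F m) (EFin \o f) (EFin \o D) mF' mf' cF' iD bF.
have E m : (\int[mu]_x (EFin \o F m) x)%E = (Rintegral mu setT (F m))%:E.
  rewrite /Rintegral fineK//; apply: integrable_fin_num => //.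
  apply: le_integrable iD => //; first exact: mF'.
  by move=> x _ /=; rewrite lee_fin (le_trans (FD m x))// ler_norm.
have Ef : (\int[mu]_x (EFin \o f) x)%E = (Rintegral mu setT f)%:E.
  by rewrite /Rintegral fineK//; exact: integrable_fin_num.
move: c; under eq_fun do rewrite E; rewrite Ef; exact: fine_cvg.
Qed.

Lemma ae_opp (P : R -> Prop) : {ae mu, forall x, P x} -> {ae mu, forall x, P (- x)}.
Proof.
move=> [N [mN N0 NP]]; exists ((-%R : measurableTypeR R -> measurableTypeR R) @^-1` N).
have mN' : measurable ((-%R : measurableTypeR R -> measurableTypeR R) @^-1` N).
  rewrite -[X in measurable X]setTI.
  exact: (@oppr_measurable R setT measurableT N mN).
split => //; first by rewrite -[LHS]/(pushforward mu (-%R : measurableTypeR R -> measurableTypeR R) N)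
  lebesgue_measureN.
by move=> x /= nP; apply: NP.
Qed.

Variables (c q s K : R).
Hypotheses (c0 : 0 < c) (q0 : 0 < q) (s1 : -1 < s) (K0 : 0 <= K).

Definition pw (x : R) : R := `|x| `^ q.

Lemma pw_ge0 x : 0 <= pw x. Proof. exact: powR_ge0. Qed.

Lemma measurable_pw : measurable_fun setT pw.
Proof.
by apply: (measurableT_comp (measurable_powR q)); exact: normr_measurable.
Qed.

(** Equality holds off 0. At 0 the right side is 1 when [s + q m = 0], since [powR] with exponent 0
    is 1, so only the inequality is general. *)
Lemma pa_pw_le e m (x : R) :
  pw x ^+ m * pa e q s x <= pa e q (s + q * m%:R) x.
Proof.
have [->|x0] := eqVneq x 0.
  case: m => [|m]; first by rewrite expr0 mul1r mulr0 addr0.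
  by rewrite /pw normr0 powR0 ?gt_eqF// expr0n mul0r pa_ge0.
have ax : 0 < `|x| by rewrite normr_gt0.
rewrite /pa /pe powRD; last by rewrite (gt_eqF ax) implybT.
rewrite [`|x| `^ (q * _)]powRrM powR_mulrn ?powR_ge0// -/(pw x).
by rewrite mulrA [pw x ^+ m * _]mulrC.
Qed.

Definition pa_bounded u := measurable_fun setT u /\ forall x, `|u x| <= K * pa c q s x.

Lemma pa_bounded_mul u f : pa_bounded u -> measurable_fun setT f ->
  (forall x, `|f x| <= 1) -> pa_bounded (fun x => u x * f x).
Proof.
move=> [mu_ uK] mf f1; split; first exact: measurable_funM.
by move=> x; rewrite normrM (le_trans _ (uK x))// ler_piMr.
Qed.

Lemma pa_bounded_integrable u : pa_bounded u -> mu.-integrable setT (EFin \o u).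
Proof.
move=> [mu_ uK].
have iD : mu.-integrable setT (EFin \o (fun x => K * pa c q s x)).
  by apply: integrable_mulR => //; exact: integrable_pa.
apply: le_integrable iD => //; first exact/measurable_EFinP.
by move=> x _ /=; rewrite lee_fin (le_trans (uK x))// ler_norm.
Qed.

(** The rate [c / 2] is strictly below the decay rate of [u], so the absolute exponential series,
    which grows like [exp (c y / 2)], leaves an integrable majorant. *)
Let ex (x : R) : R := expR (- (c / 2 * pw x)).

Let ex01 x : 0 <= ex x <= 1.
Proof.
rewrite expR_ge0 -expR0 ler_expR oppr_le0 mulr_ge0 ?pw_ge0//.
by rewrite divr_ge0// ltW.
Qed.

Let mex : measurable_fun setT ex.
Proof.
apply: (measurableT_comp (@measurable_expR R)).
apply: (measurableT_comp (@oppr_measurable R setT)).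
by apply: measurable_funM => //; exact: measurable_pw.
Qed.

(* Multiplying by [exp (- c y / 2)] preserves the decay, so the exponential
   series may be integrated term by term again and again. *)
Lemma moments_mul_exp u : pa_bounded u ->
  (forall m, Rintegral mu setT (fun x => u x * pw x ^+ m) = 0) ->
  forall m, Rintegral mu setT (fun x => u x * ex x * pw x ^+ m) = 0.
Proof.
move=> [mu_ uK] u0 m; pose d := c / 2.
have d0 : 0 < d by rewrite divr_gt0.
pose t i x := u x * pw x ^+ m * ((- (d * pw x)) ^+ i / i`!%:R).
have mpX i : measurable_fun setT (fun x => pw x ^+ i).
  by elim: i => [//|i IH]; under eq_fun do rewrite exprS; apply: measurable_funM => //; exact: measurable_pw.
have tE i x : t i x = (- d) ^+ i / i`!%:R * (u x * pw x ^+ (m + i)).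
  by rewrite /t -mulNr exprMn exprD; ring.
have mt i : measurable_fun setT (t i).
  rewrite (_ : t i = fun x => (- d) ^+ i / i`!%:R * (u x * pw x ^+ (m + i))).
    by apply: measurable_funM => //; exact: measurable_funM.
  by apply/funext => x; exact: tE.
have sm : -1 < s + q * m%:R by rewrite (lt_le_trans s1)// lerDl mulr_ge0// ltW.
have iD : mu.-integrable setT (EFin \o (fun x => K * pa d q (s + q * m%:R) x)).
  by apply: integrable_mulR => //; exact: integrable_pa.
have tD M x : \sum_(0 <= i < M) `|t i x| <= K * pa d q (s + q * m%:R) x.
  have y0 : 0 <= d * pw x by rewrite mulr_ge0 ?pw_ge0// ltW.
  have -> : \sum_(0 <= i < M) `|t i x| =
      `|u x| * pw x ^+ m * series (exp_coeff (d * pw x)) M.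
    rewrite /series/= mulr_sumr; apply: eq_bigr => i _.
    rewrite /t [LHS]normrM [`|u x * _|]normrM; congr (_ * _ * _).
      by rewrite ger0_norm ?exprn_ge0 ?pw_ge0.
    by rewrite normrM normrX normrN (ger0_norm y0) ger0_norm ?invr_ge0.
  have := exp_tail_ge0 M y0; rewrite subr_ge0 => sE.
  apply: (@le_trans _ _ (K * pa c q s x * pw x ^+ m * expR (d * pw x))).
    apply: ler_pM => //; rewrite ?mulr_ge0 ?exprn_ge0 ?pw_ge0//.
      by apply: sumr_ge0 => i _; rewrite /exp_coeff/= mulr_ge0 ?invr_ge0 ?exprn_ge0.
    by rewrite ler_wpM2r ?exprn_ge0 ?pw_ge0.
  have -> : K * pa c q s x * pw x ^+ m * expR (d * pw x) = K * (pw x ^+ m * pa d q s x).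
    rewrite /pa /pe -/(pw x) (_ : - (c * pw x) = - (d * pw x) - d * pw x); last by rewrite /d; field.
    rewrite expRD; have : expR (- (d * pw x)) * expR (d * pw x) = 1 by rewrite -expRD addNr expR0.
    move: (expR _) (expR _) => a b ab.
    rewrite -[RHS]mulr1 -ab; ring.
  by rewrite ler_wpM2l// pa_pw_le.
have cU x : series (t ^~ x) @ \oo --> u x * ex x * pw x ^+ m.
  have -> : series (t ^~ x) = fun M => u x * pw x ^+ m * series (exp_coeff (- (d * pw x))) M.
    by apply/funext => M; rewrite /series/= mulr_sumr.
  rewrite [u x * ex x * _]mulrAC; apply: cvgM; first exact: cvg_cst.
  exact: is_cvg_series_exp_coeff.
have [_ cI] := Rintegral_series mt iD tD cU.
have z i : Rintegral mu setT (t i) = 0.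
  rewrite (_ : Rintegral mu setT (t i) = Rintegral mu setT
    (fun x => (- d) ^+ i / i`!%:R * (u x * pw x ^+ (m + i)))); last first.
    by apply: eq_Rintegral => x _; exact: tE.
  rewrite RintegralZl ?u0 ?mulr0//.
  have smi : -1 < s + q * (m + i)%:R by rewrite (lt_le_trans s1)// lerDl mulr_ge0// ltW.
  have iE : mu.-integrable setT (EFin \o (fun x => K * pa c q (s + q * (m + i)%:R) x)).
    by apply: integrable_mulR => //; exact: integrable_pa.
  apply: le_integrable iE => //.
    by apply/measurable_EFinP; apply: measurable_funM; [exact: mu_|exact: mpX].
  move=> x _ /=; rewrite lee_fin normrM [`|_ ^+ _|]ger0_norm ?exprn_ge0 ?pw_ge0//.
  rewrite [leRHS]ger0_norm ?mulr_ge0 ?pa_ge0//.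
  apply: le_trans (ler_wpM2l K0 (pa_pw_le c (m + i) x)).
  by rewrite [pw x ^+ _ * _]mulrC mulrA ler_wpM2r ?exprn_ge0 ?pw_ge0.
apply/esym; apply: (cvg_unique (@Rhausdorff R) _ cI).
rewrite (_ : series _ = fun=> 0); first exact: cvg_cst.
by apply/funext => M; rewrite /series/= big1// => i _; exact: z.
Qed.

(** Iteration reaches every rate [i c / 2], although for a rate of [c] or more the exponential
    series need not be dominated in one go. *)
Lemma moments_exp i u : pa_bounded u ->
  (forall m, Rintegral mu setT (fun x => u x * pw x ^+ m) = 0) ->
  Rintegral mu setT (fun x => u x * ex x ^+ i) = 0.
Proof.
elim: i u => [|i IH] u bu u0.
  by rewrite -[RHS](u0 0%N); apply: eq_Rintegral => x _; rewrite !expr0.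
rewrite -[RHS](IH (fun x => u x * ex x)).
- by apply: eq_Rintegral => x _; rewrite exprS mulrA.
- by apply: pa_bounded_mul => // x; have /andP[h0 h1] := ex01 x; rewrite ger0_norm.
- exact: moments_mul_exp.
Qed.

Let mexX i : measurable_fun setT (fun x => ex x ^+ i).
Proof.
by elim: i => [//|i IH]; under eq_fun do rewrite exprS; apply: measurable_funM.
Qed.

Let exX01 x i : 0 <= ex x ^+ i <= 1.
Proof.
by have /andP[h0 h1] := ex01 x; rewrite exprn_ge0//= exprn_ile1.
Qed.

Lemma exp_moments_pow u j M : pa_bounded u ->
  (forall i, Rintegral mu setT (fun x => u x * ex x ^+ i) = 0) ->
  Rintegral mu setT (fun x => u x * (1 - ex x ^+ j) ^+ M) = 0.
Proof.
elim: M u => [|M IH] u bu u0.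
  by rewrite -[RHS](u0 0%N); apply: eq_Rintegral => x _; rewrite !expr0.
have bu' : pa_bounded (fun x => u x * (1 - ex x ^+ j)).
  apply: pa_bounded_mul => //; first exact: measurable_funB.
  by move=> x; have /andP[h0 h1] := exX01 x j; rewrite ger0_norm ?subr_ge0// gerBl.
have bi i : mu.-integrable setT (EFin \o (fun x => u x * ex x ^+ i)).
  apply: pa_bounded_integrable; apply: pa_bounded_mul => // x.
  by have /andP[h0 h1] := exX01 x i; rewrite ger0_norm.
rewrite -[RHS](IH _ bu').
  by apply: eq_Rintegral => x _; rewrite exprS mulrA.
move=> i; rewrite -[RHS](subrr 0) -{1}(u0 i) -(u0 (j + i)%N) -RintegralB//.
by apply: eq_Rintegral => x _; rewrite exprD; ring.
Qed.

Definition trunc_exp (b : R) (j : nat) : nat := Num.truncn (expR (j%:R * b)).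

Lemma trunc_expP b j : (trunc_exp b j)%:R <= expR (j%:R * b) < (trunc_exp b j)%:R + 1.
Proof. by rewrite natr1 truncn_itv// expR_ge0. Qed.

(* [(1 - exp (- j a)) ^ exp (j b)] tends to the indicator of [b < a]. *)
Lemma cvg_gumbel (a b : R) : 0 <= a -> 0 < b -> a != b ->
  (1 - expR (- a) ^+ j) ^+ trunc_exp b j @[j --> \oo] --> ((b < a)%R%:R : R).
Proof.
move=> a0 b0 ab.
have ea j : expR (- a) ^+ j = expR (j%:R * - a) by rewrite expRM_natl.
have ea1 j : 0 <= expR (- a) ^+ j <= 1.
  by rewrite ea expR_ge0 -expR0 ler_expR mulrN oppr_le0 mulr_ge0.
have p01 j N : 0 <= (1 - expR (- a) ^+ j) ^+ N <= 1.
  have /andP[h0 h1] := ea1 j.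
  by rewrite exprn_ge0 ?subr_ge0//= exprn_ile1 ?subr_ge0// gerBl.
have geo (e : R) : 0 < e -> expR (- e) ^+ j @[j --> \oo] --> (0 : R).
  move=> e0; apply: cvg_expr; rewrite ger0_norm ?expR_ge0// -expR0 ltr_expR.
  by rewrite oppr_lt0.
have [ba|ab'] := ltP b a.
  (* Bernoulli bounds the power below by 1 minus [exp (j b) exp (- j a)]. *)
  apply: (@squeeze_cvgr _ _ _ _ (fun j => 1 - expR (- (a - b)) ^+ j) (cst 1)).
  - apply: nearW => j; have /andP[_ ->] := p01 j (trunc_exp b j); rewrite andbT.
    apply: le_trans (bernoulli_le _ (ea1 j)); rewrite lerD2l lerN2.
    have /andP[h _] := trunc_expP b j.
    have /andP[h0 _] := ea1 j.
    apply: (le_trans (ler_wpM2r h0 h)).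
    by rewrite ea -expRD -expRM_natl ler_expR; lra.
  - rewrite -[X in _ --> X](subr0 1); apply: cvgB; first exact: cvg_cst.
    by apply: geo; rewrite subr_gt0.
  - exact: cvg_cst.
have {ab ab'}ba : a < b by rewrite lt_neqAle ab ab'.
apply: (@squeeze_cvgr _ _ _ _ (cst 0) (fun j => expR (- (b - a)) ^+ j)).
- apply: nearW => j; have /andP[-> _] := p01 j (trunc_exp b j) => /=.
  have /andP[h0 h1] := ea1 j; have /andP[_ hb] := trunc_expP b j.
  (* Here [1 - x <= exp (- x)], and [trunc_exp b j] times [exp (- j a)] is at least
     [exp (j (b - a)) - 1 >= j (b - a)]. *)
  apply: (@le_trans _ _ (expR (- (expR (- a) ^+ j)) ^+ trunc_exp b j)).
    by rewrite lerXn2r ?nnegrE ?expR_ge0 ?subr_ge0//; exact: expR_ge1Dx.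
  rewrite -[leLHS]expRM_natl -[leRHS]expRM_natl ler_expR mulrN [leRHS]mulrN lerN2.
  apply: (@le_trans _ _ (expR (j%:R * (b - a)) - 1)).
    by have := expR_ge1Dx (j%:R * (b - a)); lra.
  have -> : expR (j%:R * (b - a)) = expR (j%:R * b) * expR (- a) ^+ j.
    by rewrite ea -expRD; congr expR; ring.
  have : (expR (j%:R * b) - 1) * expR (- a) ^+ j <= (trunc_exp b j)%:R * expR (- a) ^+ j.
    by rewrite ler_wpM2r// lerBlDr ltW.
  by rewrite mulrBl mul1r; lra.
- exact: cvg_cst.
- by apply: geo; rewrite subr_gt0.
Qed.

Lemma Rintegral_tail_eq0 u (B : R) : 0 < B -> pa_bounded u ->
  (forall m, Rintegral mu setT (fun x => u x * pw x ^+ m) = 0) ->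
  Rintegral mu setT (fun x => u x * (B < `|x|)%R%:R) = 0.
Proof.
move=> B0 bu u0; pose b := c / 2 * B `^ q.
have d0 : 0 < c / 2 by rewrite divr_gt0.
have b0 : 0 < b by rewrite mulr_gt0// powR_gt0.
have mI : measurable_fun setT (fun x : R => (B < `|x|)%R%:R : R).
  rewrite (_ : (fun _ => _) = \1_[set x : R | (B < `|x|)%R]).
    apply: measurable_indic.
    have := @normr_measurable R setT measurableT `]B, +oo[ (measurable_itv _).
    rewrite setTI; congr measurable; apply/seteqP; split => x /=; rewrite in_itv/= andbT//.
  by apply/funext => x; rewrite indicE mem_setE.
have F01 j x : 0 <= (1 - ex x ^+ j) ^+ trunc_exp b j <= 1.
  have /andP[h0 h1] := exX01 x j.
  by rewrite exprn_ge0 ?subr_ge0//= exprn_ile1 ?subr_ge0// gerBl.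
have cI : Rintegral mu setT (fun x => u x * (1 - ex x ^+ j) ^+ trunc_exp b j) @[j --> \oo] -->
    Rintegral mu setT (fun x => u x * (B < `|x|)%R%:R).
  apply: (@Rintegral_dominated_cvg _ _ (fun x => `|u x|)).
  - move=> j; apply: measurable_funM; first by case: bu.
    elim: (trunc_exp b j) => [//|N IH]; under eq_fun do rewrite exprS.
    by apply: measurable_funM => //; exact: measurable_funB.
  - by apply: measurable_funM => //; case: bu.
  - exact: (integrable_norm (pa_bounded_integrable bu)).
  - move=> j x; have /andP[h0 h1] := F01 j x.
    by rewrite normrM (ger0_norm h0) ler_piMr.
  (* The two points with [|x| = B] are discarded: there both rates coincide and the powers tend to
     [1 / e], not to the indicator. *)
  - have : {ae mu, forall x : R, `|x| != B}.
      exists ([set B] `|` [set - B]); split.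
      + by apply: measurableU; exact: measurable_set1.
      + by rewrite measureU0//; exact: lebesgue_measure_set1.
      + move=> x /= /negP; rewrite negbK => /eqP xB.
        have [x0|x0] := leP 0 x; [left|right]; rewrite -xB /=; first by rewrite ger0_norm.
        by rewrite ltr0_norm// opprK.
    apply: ae_impl => x xB; apply: cvgM; first exact: cvg_cst.
    have -> : (B < `|x|) = (b < c / 2 * pw x).
      rewrite /b ltr_pM2l// /pw; apply/idP/idP => h.
        by apply: gt0_ltr_powR => //; rewrite ?nnegrE// ltW.
      rewrite ltNge; apply/negP => h'; move: h; rewrite ltNge => /negP; apply.
      by apply: ge0_ler_powR; rewrite ?nnegrE ?(ltW q0) ?(ltW B0).
    apply: cvg_gumbel => //; first by rewrite mulr_ge0 ?pw_ge0// ltW.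
    apply: contra xB => /eqP/(mulfI (lt0r_neq0 d0)) => e.
    by apply/eqP; apply: (powR_injective q0); rewrite ?nnegrE// ltW.
apply: (cvg_unique (@Rhausdorff R) cI).
rewrite (_ : (fun _ => _) = fun=> 0); first exact: cvg_cst.
apply/funext => j; apply: exp_moments_pow => // i; exact: moments_exp.
Qed.

(** As [|x|^q] is even, only [u x + u (- x)] can be recovered. Its integrals over all []B, +oo[]
    with [B > 0] vanish, so its primitive is constant on the positive axis and its derivative is 0
    almost everywhere there. *)
Lemma moments_eq0 u : pa_bounded u ->
  (forall m, Rintegral mu setT (fun x => u x * pw x ^+ m) = 0) ->
  {ae mu, forall x : R, 0 < x -> u x + u (- x) = 0}.
Proof.
move=> bu u0; have iu := pa_bounded_integrable bu; case: (bu) => [mu_ uK].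
pose I (B x : R) : R := (B < x)%R%:R.
have mI B : measurable_fun setT (I B).
  rewrite (_ : I B = \1_`]B, +oo[); first exact: measurable_indic.
  by apply/funext => x; rewrite indicE mem_setE in_itv/= andbT.
have bI f B : pa_bounded f -> pa_bounded (fun x => f x * I B x).
  move=> bf; apply: pa_bounded_mul => // x.
  by rewrite /I; case: (B < x); rewrite ?normr0 ?normr1.
have bN : pa_bounded (fun x => u (- x)).
  split; first by apply: measurableT_comp => //; exact: oppr_measurable.
  by move=> x; rewrite (le_trans (uK _))// /pa normrN.
pose v x := u x * I 0 x + u (- x) * I 0 x.
have iv : mu.-integrable setT (EFin \o v).
  by apply: integrable_addR => //; apply: pa_bounded_integrable; exact: bI.
have vB (B : R) : 0 < B -> Rintegral mu `]B, +oo[ v = 0.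
  move=> B0; rewrite Rintegral_mkcond -[RHS](Rintegral_tail_eq0 B0 bu u0).
  transitivity (Rintegral mu setT (fun x => u x * I B x + u (- x) * I B x)).
    apply: eq_Rintegral => x _; rewrite patchE mem_setE in_itv/= andbT /v /I.
    by case: ifPn => [Bx|_]; [rewrite (lt_trans B0 Bx)|rewrite !mulr0 addr0].
  rewrite RintegralD//; last 2 first.
  - by apply: pa_bounded_integrable; exact: bI.
  - by apply: pa_bounded_integrable; exact: bI.
  have -> : Rintegral mu setT (fun x => u (- x) * I B x) =
      Rintegral mu setT (fun x => u x * I B (- x)).
    rewrite -[RHS]Rintegral_opp; last first.
      apply: measurable_funM => //; apply: measurableT_comp => //; exact: oppr_measurable.
    by apply: eq_Rintegral => x _; rewrite opprK.
  rewrite -RintegralD//.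
  - apply: eq_Rintegral => x _; rewrite /I -mulrDr; congr (_ * _).
    have [x0|x0] := leP 0 x.
      by rewrite (ger0_norm x0) [B < - x]lt_gtF ?addr0// (le_lt_trans _ B0)// oppr_le0.
    by rewrite (ltr0_norm x0) [B < x]lt_gtF ?add0r// (lt_trans x0).
  - by apply: pa_bounded_integrable; exact: bI.
  - apply: pa_bounded_integrable; apply: pa_bounded_mul => //.
      by apply: measurableT_comp => //; exact: oppr_measurable.
    by move=> x; rewrite /I; case: (B < - x); rewrite ?normr0 ?normr1.
pose T := Rintegral mu setT v.
have FT (x : R) : 0 < x -> Rintegral mu `]-oo, x] v = T.
  move=> x0; have := @Rintegral_setU _ _ _ mu (`]-oo, x] : set (measurableTypeR R)) `]x, +oo[ v.
  rewrite -itv_bndbnd_setU ?bnd_simp// set_itvNyy /T => ->//.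
  + by rewrite vB// addr0.
  + apply/disj_setPS => y [/=]; rewrite !in_itv/= andbT => h1 h2.
    by have := le_lt_trans h1 h2; rewrite ltxx.
have iy (y : R) : mu.-integrable `]-oo, y] (EFin \o v) by apply: integrableS iv.
have lv : locally_integrable setT v by exact: (open_integrable_locally openT).
have := FTC1Ny iy lv.
apply: ae_impl => x [_ dF] x0.
have : v x = 0.
  rewrite -dF derive1E (@near_eq_derive _ _ _ _ (cst T)); first by rewrite derive_cst.
  near=> y; apply: FT; near: y; exact: lt_nbhsr.
by rewrite /v /I x0 !mulr1.
Unshelve. all: by end_near. Qed.

End MomentDeterminacy.

(** * Bessel series and rigidity of Hankel-type transforms *)

Section BesselTransform.
Variable R : realType.
Local Notation mu := (@lebesgue_measure R).
Local Open Scope classical_set_scope.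
Implicit Types (u f g : R -> R).

(** Consecutive quotients [L^m / poch b m] have ratio [L / (b + m)], below 1 from [N > L] on; [D]
    sums the finitely many earlier ones instead of taking their maximum. *)
Lemma exprn_le_poch (b L : R) : 0 < b -> 0 < L ->
  exists2 D, 0 < D & forall m, L ^+ m <= D * poch b m.
Proof.
move=> b0 L0; pose r m := L ^+ m / poch b m.
have r0 m : 0 < r m by rewrite divr_gt0 ?exprn_gt0 ?poch_gt0.
pose N := Num.bound L; have LN : L < N%:R by rewrite archi_boundP// ltW.
pose D := \sum_(i < N.+1) r i.
have rD (i : 'I_N.+1) : r i <= D.
  by rewrite /D (bigD1 i)//= lerDl sumr_ge0// => j _; exact: ltW.
have rN m : r (N + m)%N <= r N.
  elim: m => [|m IH]; first by rewrite addn0.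
  apply: le_trans IH; rewrite addnS /r exprS pochS.
  have bm : 0 < b + (N + m)%:R by rewrite ltr_wpDr.
  have -> : L * L ^+ (N + m) / (poch b (N + m) * (b + (N + m)%:R)) =
      L ^+ (N + m) / poch b (N + m) * (L / (b + (N + m)%:R)).
    by rewrite invfM [L * _]mulrC mulrACA.
  rewrite ler_piMr ?(ltW (r0 _))// ler_pdivrMr// mul1r natrD.
  have : 0 <= m%:R :> R by []. lra.
have rall m : r m <= D.
  have [mN|Nm] := ltnP m N.+1; first exact: (rD (Ordinal mN)).
  by rewrite -(subnKC (ltnW Nm)) (le_trans (rN _))// (rD ord_max).
exists D; first exact: lt_le_trans (rall 0%N).
by move=> m; rewrite -ler_pdivrMr ?poch_gt0//; exact: rall.
Qed.

Definition jbs_term (b v : R) (m : nat) : R := (- v) ^+ m / (m`!%:R * poch b m).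

(** The hypergeometric function 0F1 with parameter [b] at [- v], that is the normalized Bessel
    function of index [b - 1] in the variable [v = (z / 2)^2]. *)
Definition jbs (b v : R) : R := limn (series (jbs_term b v)).

(** Growth is of order 1/2 in [y], so any exponential rate [e > 0] suffices: [poch b m] outgrows the
    powers of [(v + 1) / e]. The [+ 1] keeps that base positive when [v = 0]. *)
Lemma jbs_term_le (b e v : R) : 0 < b -> 0 < e -> 0 <= v ->
  exists2 D, 0 < D & forall (y : R) M, 0 <= y ->
    \sum_(0 <= m < M) `|jbs_term b (v * y) m| <= D * expR (e * y).
Proof.
move=> b0 e0 v0; have L0 : 0 < (v + 1) / e by rewrite divr_gt0// ltr_wpDl.
have [D D0 hD] := exprn_le_poch b0 L0; exists D => // y M y0.
have ey : 0 <= e * y by rewrite mulr_ge0// ltW.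
apply: (@le_trans _ _ (D * series (exp_coeff (e * y)) M)); last first.
  rewrite ler_wpM2l ?(ltW D0)//.
  by have := exp_tail_ge0 M ey; rewrite subr_ge0.
rewrite /series/= mulr_sumr; apply: ler_sum => m _.
have pm := poch_gt0 m b0; have fm : 0 < m`!%:R :> R by rewrite ltr0n fact_gt0.
rewrite /jbs_term normrM normrX normrN [`|v * y|]ger0_norm ?mulr_ge0//.
rewrite ger0_norm ?invr_ge0 ?mulr_ge0 ?(ltW pm)// invfM.
rewrite /exp_coeff/= mulrA [leRHS]mulrA mulrAC ler_wpM2r ?invr_ge0//.
rewrite ler_pdivrMr//.
apply: (@le_trans _ _ ((v + 1) ^+ m * y ^+ m)).
  by rewrite exprMn ler_wpM2r ?exprn_ge0// lerXn2r ?nnegrE ?addr_ge0// lerDl.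
have := hD m; rewrite expr_div_n ler_pdivrMr ?exprn_gt0// => h.
rewrite exprMn; apply: (le_trans (ler_wpM2r (exprn_ge0 m y0) h)).
by rewrite le_eqVlt; apply/orP; left; apply/eqP; ring.
Qed.

Lemma cvg_jbs (b v : R) : 0 < b -> 0 <= v ->
  series (jbs_term b v) @ \oo --> jbs b v.
Proof.
move=> b0 v0; apply: normed_cvg.
have [D D0 hD] := jbs_term_le b0 ltr01 v0.
apply: nondecreasing_is_cvgn.
  by apply/nondecreasing_seqP => m; rewrite -subr_ge0 seriesSB normr_ge0.
exists (D * expR (1 * 1)) => _ [M _ <-].
by have := hD 1 M ler01; rewrite mulr1.
Qed.

Lemma bessel_jE (be z : R) : 0 < be + 1 ->
  bessel_j be z = jbs (be + 1) ((z / 2) ^+ 2).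
Proof.
move=> b0; rewrite /bessel_j /jbs.
have G0 := Gamma_gt0 b0.
have E : series (jbs_term (be + 1) ((z / 2) ^+ 2)) =
    fun M => Gamma (be + 1) * series (bessel_term be z) M.
  apply/funext => M; rewrite /series/= mulr_sumr; apply: eq_bigr => m _.
  rewrite /jbs_term /bessel_term addrAC Gamma_poch// [(- _ ^+ 2) ^+ m]exprNn -exprM.
  have pm := poch_gt0 m b0.
  by field; rewrite (gt_eqF pm) (gt_eqF G0) pnatr_eq0 -lt0n fact_gt0.
have c1 := cvg_jbs b0 (sqr_ge0 (z / 2)).
have c2 : series (bessel_term be z) @ \oo --> (Gamma (be + 1))^-1 * jbs (be + 1) ((z / 2) ^+ 2).
  rewrite (_ : series _ = fun M => (Gamma (be + 1))^-1 * series (jbs_term (be + 1) ((z / 2) ^+ 2)) M).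
    by apply: cvgM => //; exact: cvg_cst.
  by apply/funext => M; rewrite E mulKf// gt_eqF.
by rewrite (cvg_lim (@Rhausdorff R) c2) mulVKf ?gt_eqF.
Qed.

Variables (c q s K b L : R).
Hypotheses (c0 : 0 < c) (q0 : 0 < q) (s1 : -1 < s) (K0 : 0 <= K) (b0 : 0 < b) (L0 : 0 < L).
Local Notation bounded := (pa_bounded c q s K).

(** [m!] times the [m]-th Taylor coefficient in [t] of the integral of [u x * jbs b (L t |x|^q)]. *)
Definition hcoef u (m : nat) : R :=
  (- L) ^+ m / poch b m * Rintegral mu setT (fun x => u x * pw q x ^+ m).

Lemma measurable_pwX m : measurable_fun setT (fun x : R => pw q x ^+ m).
Proof.
elim: m => [//|m IH]; under eq_fun do rewrite exprS.
by apply: measurable_funM => //; exact: measurable_pw.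
Qed.

Lemma integrable_pwX u m : bounded u ->
  mu.-integrable setT (EFin \o (fun x => u x * pw q x ^+ m)).
Proof.
move=> [mu_ uK].
have sm : -1 < s + q * m%:R by rewrite (lt_le_trans s1)// lerDl mulr_ge0// ltW.
have iE : mu.-integrable setT (EFin \o (fun x => K * pa c q (s + q * m%:R) x)).
  by apply: integrable_mulR => //; exact: integrable_pa.
apply: le_integrable iE => //.
  by apply/measurable_EFinP; apply: measurable_funM => //; exact: measurable_pwX.
move=> x _ /=; rewrite lee_fin normrM [`|_ ^+ _|]ger0_norm ?exprn_ge0 ?pw_ge0//.
rewrite [leRHS]ger0_norm ?mulr_ge0 ?pa_ge0//.
apply: le_trans (ler_wpM2l K0 (pa_pw_le s q0 c m x)).
by rewrite [pw q x ^+ _ * _]mulrC mulrA ler_wpM2r ?exprn_ge0 ?pw_ge0.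
Qed.

Lemma hankel_series u (t : R) : 0 <= t -> bounded u ->
  mu.-integrable setT (EFin \o (fun x => u x * jbs b (L * t * pw q x))) /\
  series (fun m => hcoef u m * t ^+ m / m`!%:R) @ \oo -->
    Rintegral mu setT (fun x => u x * jbs b (L * t * pw q x)).
Proof.
move=> t0 bu; case: (bu) => mu_ uK.
have c2 : 0 < c / 2 by rewrite divr_gt0.
have v0 : 0 <= L * t by rewrite mulr_ge0// ltW.
(* Half of the Gaussian rate pays for the Bessel sums; the other half stays integrable. *)
have [D D0 hD] := jbs_term_le b0 c2 v0.
pose T m x := u x * jbs_term b (L * t * pw q x) m.
have TE m x : T m x = (- L) ^+ m * t ^+ m / (m`!%:R * poch b m) * (u x * pw q x ^+ m).
  by rewrite /T /jbs_term -!mulNr !exprMn; ring.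
have mT m : measurable_fun setT (T m).
  rewrite (_ : T m = fun x => (- L) ^+ m * t ^+ m / (m`!%:R * poch b m) * (u x * pw q x ^+ m)).
    by apply: measurable_funM => //; apply: measurable_funM => //; exact: measurable_pwX.
  by apply/funext => x; exact: TE.
have iD : mu.-integrable setT (EFin \o (fun x => K * D * pa (c / 2) q s x)).
  by apply: integrable_mulR => //; exact: integrable_pa.
have TD M x : \sum_(0 <= m < M) `|T m x| <= K * D * pa (c / 2) q s x.
  under eq_bigr do rewrite normrM; rewrite -mulr_sumr.
  apply: (@le_trans _ _ (K * pa c q s x * (D * expR (c / 2 * pw q x)))).
    by apply: ler_pM => //; [exact: sumr_ge0|exact/hD/pw_ge0].
  rewrite /pa /pe -/(pw q x) (_ : - (c * pw q x) = - (c / 2 * pw q x) - c / 2 * pw q x);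
    last by field.
  rewrite expRD; have : expR (- (c / 2 * pw q x)) * expR (c / 2 * pw q x) = 1.
    by rewrite -expRD addNr expR0.
  move: (expR _) (expR _) => a a' aa.
  rewrite le_eqVlt; apply/orP; left; apply/eqP.
  by rewrite -[RHS]mulr1 -aa; ring.
have cT x : series (T ^~ x) @ \oo --> u x * jbs b (L * t * pw q x).
  rewrite (_ : series _ = fun M => u x * series (jbs_term b (L * t * pw q x)) M).
    by apply: cvgM; [exact: cvg_cst|apply: cvg_jbs => //; rewrite mulr_ge0 ?pw_ge0].
  by apply/funext => M; rewrite /series/= mulr_sumr.
have [iT cI] := Rintegral_series mT iD TD cT.
split=> //; rewrite (_ : (fun m => _) = fun m => Rintegral mu setT (T m))//.
apply/funext => m.
rewrite (_ : Rintegral mu setT (T m) = Rintegral mu setT (fun x =>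
  (- L) ^+ m * t ^+ m / (m`!%:R * poch b m) * (u x * pw q x ^+ m))); last first.
  by apply: eq_Rintegral => x _; exact: TE.
rewrite RintegralZl//; last exact: integrable_pwX.
rewrite /hcoef invfM; ring.
Qed.

Lemma Rintegral_pa_pw m : Rintegral mu setT (fun x => pa c q s x * pw q x ^+ m) =
  poch ((s + 1) / q) m / c ^+ m * Rintegral mu setT (pa c q s).
Proof.
rewrite -Rintegral_pa_poch//; congr fine.
rewrite [RHS]integral_normr; [|exact: measurable_pe|exact: pe_ge0].
rewrite (@integral_normr R (fun x => pe c q s x * (x `^ q) ^+ m)).
- congr (_ * _)%E; apply: eq_integral => x /set_mem/=; rewrite in_itv/= andbT => x0.
  rewrite /pe powRD; last by rewrite (gt_eqF x0) implybT.
  by rewrite [x `^ (q * _)]powRrM powR_mulrn ?powR_ge0// mulrAC.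
- apply: measurable_funM; first exact: measurable_pe.
  elim: m => [//|m IH]; under eq_fun do rewrite exprS.
  by apply: measurable_funM => //; exact: measurable_powR.
- by move=> x; rewrite mulr_ge0 ?pe_ge0// exprn_ge0// powR_ge0.
Qed.

(** The moments of the majorant carry [poch ((s + 1) / q) m], which is at most the denominator
    [poch b m]; what remains is geometric with ratio [L / c], the exponential type. *)
Lemma hcoef_le u m : bounded u -> (s + 1) / q <= b ->
  `|hcoef u m| <= K * Rintegral mu setT (pa c q s) * (L / c) ^+ m.
Proof.
move=> bu sb; have [mu_ uK] := bu.
have sq0 : 0 < (s + 1) / q by rewrite divr_gt0// -ltrBlDr sub0r.
have pb := poch_gt0 m b0; have ps := poch_gt0 m sq0.
have I0 := Rintegral_pa_gt0 c0 q0 s1.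
rewrite /hcoef normrM.
have -> : `|(- L) ^+ m / poch b m| = L ^+ m / poch b m.
  by rewrite normrM normrX normrN (gtr0_norm L0) gtr0_norm ?invr_gt0.
have iu := integrable_pwX m bu.
have bpa : pa_bounded c q s 1 (pa c q s).
  by split; [exact: measurable_pa|move=> x; rewrite mul1r ger0_norm ?pa_ge0].
have ip : mu.-integrable setT (EFin \o (fun x => pa c q s x * pw q x ^+ m)).
  have sm : -1 < s + q * m%:R by rewrite (lt_le_trans s1)// lerDl mulr_ge0// ltW.
  apply: le_integrable (integrable_pa c0 q0 sm) => //.
    by apply/measurable_EFinP; apply: measurable_funM; [exact: measurable_pa|exact: measurable_pwX].
  move=> x _ /=; rewrite lee_fin !ger0_norm ?mulr_ge0 ?pa_ge0 ?exprn_ge0 ?pw_ge0//.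
  by rewrite mulrC pa_pw_le.
have : `|Rintegral mu setT (fun x => u x * pw q x ^+ m)| <=
    K * (poch ((s + 1) / q) m / c ^+ m * Rintegral mu setT (pa c q s)).
  rewrite -Rintegral_pa_pw -RintegralZl//.
  apply: (le_trans (le_normr_Rintegral _ iu)) => //.
  apply: le_Rintegral => //; first exact: integrable_norm.
    exact: integrable_mulR.
  move=> x _ /=; rewrite normrM [`|_ ^+ _|]ger0_norm ?exprn_ge0 ?pw_ge0//.
  by rewrite mulrA ler_wpM2r ?exprn_ge0 ?pw_ge0.
have Lp : 0 <= L ^+ m / poch b m by rewrite divr_ge0 ?exprn_ge0// ltW.
move=> /(ler_wpM2l Lp)/le_trans; apply.
have -> : L ^+ m / poch b m * (K * (poch ((s + 1) / q) m / c ^+ m * Rintegral mu setT (pa c q s))) =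
    K * Rintegral mu setT (pa c q s) * (L / c) ^+ m * (poch ((s + 1) / q) m / poch b m).
  by rewrite expr_div_n; field; rewrite (gt_eqF pb) expf_neq0// gt_eqF.
rewrite ler_piMr ?mulr_ge0 ?(ltW I0) ?exprn_ge0 ?divr_ge0 ?(ltW L0) ?(ltW c0)//.
by rewrite ler_pdivrMr// mul1r ler_poch.
Qed.

Lemma hankel_rigidity u (C : R) : bounded u -> (s + 1) / q <= b ->
  (forall t, 0 <= t ->
    `|Rintegral mu setT (fun x => u x * jbs b (L * t * pw q x))| <= C * expR (- (L / c * t))) ->
  forall m, Rintegral mu setT (fun x => u x * pw q x ^+ m) =
    poch b m / c ^+ m * Rintegral mu setT u.
Proof.
move=> bu sb uC m; have Lc : 0 < L / c by rewrite divr_gt0.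
pose C' := Num.max C (K * Rintegral mu setT (pa c q s)).
have dC i : `|hcoef u i| <= C' * (L / c) ^+ i.
  rewrite (le_trans (hcoef_le i bu sb))// ler_wpM2r ?exprn_ge0 ?(ltW Lc)//.
  by rewrite le_max lexx orbT.
have phiC x : 0 <= x -> `|limn (series (fun i => hcoef u i * x ^+ i / i`!%:R))| <=
    C' * expR (- (L / c * x)).
  move=> x0; have [_ cI] := hankel_series x0 bu.
  rewrite (cvg_lim (@Rhausdorff R) cI) (le_trans (uC x x0))// ler_wpM2r ?expR_ge0//.
  by rewrite le_max lexx.
have := entire_rigidity Lc dC phiC m.
have u0 : Rintegral mu setT (fun x => u x * pw q x ^+ 0) = Rintegral mu setT u.
  by apply: eq_Rintegral => x _; rewrite expr0 mulr1.
rewrite /hcoef u0 expr0 {2}/poch big_ord0 divr1 mul1r => h.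
have pb := poch_gt0 m b0.
have Lm : (- L) ^+ m != 0 by rewrite expf_neq0// oppr_eq0 gt_eqF.
have Lpb : (- L) ^+ m / poch b m != 0 by rewrite mulf_neq0// invr_eq0 gt_eqF.
apply: (mulfI Lpb); rewrite h -mulNr expr_div_n; field.
by rewrite (gt_eqF pb) expf_neq0// gt_eqF.
Qed.

Lemma hankel_rigidity_eq0 u (C d : R) : bounded u -> (s + 1) / q <= b -> 0 < d ->
  (forall t, 0 <= t ->
    t `^ d * `|Rintegral mu setT (fun x => u x * jbs b (L * t * pw q x))|
      <= C * expR (- (L / c * t))) ->
  forall m, Rintegral mu setT (fun x => u x * pw q x ^+ m) = 0.
Proof.
move=> bu sb d0 uC; have Lc : 0 < L / c by rewrite divr_gt0.
pose C1 := K * Rintegral mu setT (pa c q s).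
have C10 : 0 <= C1 by rewrite mulr_ge0// ltW// Rintegral_pa_gt0.
have C0 : 0 <= C.
  have := uC 0 (lexx _); rewrite powR0 ?gt_eqF// mul0r mulr0 oppr0 expR0 mulr1; exact.
pose J t := Rintegral mu setT (fun x => u x * jbs b (L * t * pw q x)).
have JE t : 0 <= t -> `|J t| <= C1 * expR (L / c * t).
  move=> t0; have [_ cI] := hankel_series t0 bu.
  have : `|series (fun m => hcoef u m * t ^+ m / m`!%:R) M| @[M --> \oo] --> `|J t|.
    exact: cvg_norm.
  move/cvgr_to_le; apply; apply: nearW => M.
  have Lt : 0 <= L / c * t by rewrite mulr_ge0// ltW.
  apply: (@le_trans _ _ (C1 * series (exp_coeff (L / c * t)) M)); last first.
    by rewrite ler_wpM2l//; have := exp_tail_ge0 M Lt; rewrite subr_ge0.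
  rewrite /series/= (le_trans (ler_norm_sum _ _ _))// mulr_sumr; apply: ler_sum => m _.
  have tm : 0 <= t ^+ m / m`!%:R by rewrite divr_ge0 ?exprn_ge0.
  rewrite -mulrA normrM (ger0_norm tm) /exp_coeff/= exprMn -[_ * t ^+ m / _]mulrA [leRHS]mulrA.
  by rewrite ler_wpM2r// hcoef_le.
pose C2 := Num.max C (C1 * expR (L / c * 2)).
have mom := @hankel_rigidity u C2 bu sb.
have {}mom m : Rintegral mu setT (fun x => u x * pw q x ^+ m) =
    poch b m / c ^+ m * Rintegral mu setT u.
  apply: mom => t t0; have [t1|t1] := leP t 1.
    apply: (le_trans (JE t t0)).
    (* For [t <= 1] the growing exponential is at most [exp (2 L / c)] times the decaying one. *)
    apply: (@le_trans _ _ (C1 * expR (L / c * 2) * expR (- (L / c * t)))).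
      rewrite -[leRHS]mulrA -expRD ler_wpM2l// ler_expR -mulrBr ler_pM2l//; lra.
    by rewrite ler_wpM2r ?expR_ge0// le_max lexx orbT.
  apply: (@le_trans _ _ (t `^ d * `|J t|)).
    rewrite ler_peMl//; have := ler_powR (ltW t1) (ltW d0); rewrite powRr0; exact.
  rewrite (le_trans (uC t t0))// ler_wpM2r ?expR_ge0// le_max lexx//.
have u0 : Rintegral mu setT u = 0.
  have JT t : 0 <= t -> J t = Rintegral mu setT u * expR (- (L / c * t)).
    move=> t0; have [_ cI] := hankel_series t0 bu.
    apply: (cvg_unique (@Rhausdorff R) cI).
    rewrite (_ : series _ = fun M => Rintegral mu setT u * series (exp_coeff (- (L / c * t))) M).
      by apply: cvgM; [exact: cvg_cst|exact: is_cvg_series_exp_coeff].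
    apply/funext => M; rewrite /series/= mulr_sumr; apply: eq_bigr => m _.
    have pb := poch_gt0 m b0.
    rewrite /hcoef mom /exp_coeff/= -mulNr -mulNr !exprMn exprVn; field.
    by rewrite pnatr_eq0 -lt0n fact_gt0 (gt_eqF pb) gt_eqF// exprn_gt0.
  apply/eqP; rewrite -normr_eq0 eq_le normr_ge0 andbT leNgt; apply/negP => U0.
  (* At this [t], [t^d] times the modulus of the integral equals [C + 1]. *)
  pose t := ((C + 1) / `|Rintegral mu setT u|) `^ d^-1.
  have := uC t (powR_ge0 _ _); rewrite -/(J t) JT ?powR_ge0// normrM.
  rewrite [`|expR _|]ger0_norm ?expR_ge0// mulrA ler_pM2r ?expR_gt0//.
  rewrite /t -powRrM mulVf ?gt_eqF// powRr1 ?divr_ge0 ?addr_ge0//.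
  rewrite divfK ?gt_eqF//; lra.
by move=> m; rewrite mom u0 mulr0.
Qed.

End BesselTransform.

(** * The transform [F_kn] and its parity parts *)

Section HardyKernel.
Variables (R : realType) (n : nat) (k a : R).
Local Notation mu := (@lebesgue_measure R).
Local Notation Re := complex.Re.
Local Notation Im := complex.Im.
Local Open Scope classical_set_scope.
Hypothesis n_gt0 : (1 <= n)%N.
Hypothesis k_ge : (n%:R - 1) / (2 * n%:R) <= k.
Hypothesis a_gt0 : 0 < a.

Local Notation q := (2 / n%:R : R).
Local Notation s0 := (2 * k + 2 / n%:R - 2 : R).
Local Notation al := (alpha_kn k n).
Local Notation c := (n%:R * a).
Local Notation L := ((n%:R / 2 : R) ^+ 2).

Let n0 : (0 : R) < n%:R. Proof. by rewrite ltr0n. Qed.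
Let q0 : 0 < q. Proof. by rewrite divr_gt0. Qed.
Let c0 : 0 < c. Proof. by rewrite mulr_gt0. Qed.
Let L0 : 0 < L. Proof. by rewrite exprn_gt0// divr_gt0. Qed.

Let kn_ge : (n%:R - 1) / 2 <= k * n%:R.
Proof.
move: k_ge; rewrite ler_pdivrMr ?mulr_gt0//; lra.
Qed.

(** The lower bound on [k] amounts to [alpha >= - 1/2]. *)
Lemma alpha_gt : 0 < al + 1.
Proof. by rewrite /alpha_kn; move: kn_ge; lra. Qed.

Lemma weight_exponentE : (s0 + 1) / q = al + 1.
Proof. by rewrite /alpha_kn; field; rewrite gt_eqF. Qed.

Lemma weight_exponent_gt : -1 < s0.
Proof.
have : 0 < (s0 + 1) / q by rewrite weight_exponentE alpha_gt.
by rewrite pmulr_lgt0 ?invr_gt0// -ltrBlDr sub0r.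
Qed.

Definition w_cst : R := (2 * Gamma (al + 1))^-1 * (n%:R / 2) `^ al.

Lemma w_cst_gt0 : 0 < w_cst.
Proof.
by rewrite mulr_gt0 ?invr_gt0 ?mulr_gt0 ?Gamma_gt0 ?alpha_gt// powR_gt0// divr_gt0.
Qed.

Lemma gauss_pw e (x : R) : gauss_n n e x = expR (- (n%:R * e * pw q x)).
Proof. by []. Qed.

Lemma gaussN e (x : R) : gauss_n n e (- x) = gauss_n n e x.
Proof. by rewrite /gauss_n normrN. Qed.

Lemma pw_opp (x : R) : pw q (- x) = pw q x.
Proof. by rewrite /pw normrN. Qed.

Lemma w_opp (x : R) : w_kn k n (- x) = w_kn k n x.
Proof. by rewrite /w_kn normrN. Qed.

Lemma w_ge0 (x : R) : 0 <= w_kn k n x.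
Proof. by rewrite mulr_ge0 ?powR_ge0// ltW// w_cst_gt0. Qed.

Lemma w_gt0 (x : R) : x != 0 -> 0 < w_kn k n x.
Proof. by move=> x0; rewrite mulr_gt0 ?w_cst_gt0// powR_gt0// normr_gt0. Qed.

Lemma gauss_w (x : R) : gauss_n n a x * w_kn k n x = w_cst * pa c q s0 x.
Proof. by rewrite /w_kn -/w_cst gauss_pw /pa /pe -/(pw q x); ring. Qed.

Lemma measurable_w : measurable_fun setT (w_kn k n).
Proof.
apply: measurable_funM => //.
by apply: (measurableT_comp (measurable_powR s0)); exact: normr_measurable.
Qed.

(** Squaring separates the variables: apart from the factor [l] of the odd part, the kernel sees [l]
    only through [t = |l|^(2/n)]. *)
Lemma bessel_arg (x l : R) :
  (n%:R * `|l * x| `^ (n%:R^-1) / 2) ^+ 2 = L * pw q l * pw q x.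
Proof.
have -> : n%:R * `|l * x| `^ (n%:R^-1) / 2 = n%:R / 2 * `|l * x| `^ (n%:R^-1) by ring.
rewrite exprMn -mulrA; congr (_ * _).
by rewrite -powR_mulrn ?powR_ge0// -powRrM [_^-1 * _]mulrC normrM powRM.
Qed.

Definition odd_cst : R := (n%:R / 2) ^+ n * (Gamma (al + 1) / Gamma (al + n%:R + 1)).

Let aln : 0 < al + n%:R + 1.
Proof. by rewrite addrAC ltr_wpDr// alpha_gt. Qed.

Lemma odd_cst_gt0 : 0 < odd_cst.
Proof.
by rewrite mulr_gt0 ?exprn_gt0 ?divr_gt0// Gamma_gt0// alpha_gt.
Qed.

Lemma B_knE (x l : R) : B_kn k n x l =
  (jbs (al + 1) (L * pw q l * pw q x))%:C + (- 'i) ^+ n *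
  (odd_cst * l * x * jbs (al + n%:R + 1) (L * pw q l * pw q x))%:C.
Proof. by rewrite /B_kn !bessel_jE ?alpha_gt// bessel_arg. Qed.

Definition even_part (g : R -> R) (l : R) : R :=
  Rintegral mu setT (fun x => g x * w_kn k n x * jbs (al + 1) (L * pw q l * pw q x)).

Definition odd_part (g : R -> R) (l : R) : R :=
  odd_cst * l * Rintegral mu setT
    (fun x => g x * x * w_kn k n x * jbs (al + n%:R + 1) (L * pw q l * pw q x)).

Section GaussBounded.
Variables (g : R -> R) (C : R).
Hypotheses (mg : measurable_fun setT g) (C0 : 0 <= C).
Hypothesis gC : forall x, `|g x| <= C * gauss_n n a x.

Lemma even_bounded : pa_bounded c q s0 (C * w_cst) (fun x => g x * w_kn k n x).
Proof.
split; first by apply: measurable_funM => //; exact: measurable_w.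
move=> x; rewrite normrM (ger0_norm (w_ge0 x)) -mulrA -gauss_w mulrA.
by rewrite ler_wpM2r// w_ge0.
Qed.

Lemma odd_bounded : pa_bounded c q (s0 + 1) (C * w_cst) (fun x => g x * x * w_kn k n x).
Proof.
split.
  by apply: measurable_funM; [exact: measurable_funM|exact: measurable_w].
move=> x; have [->|x0] := eqVneq x 0.
  by rewrite mulr0 mul0r normr0 mulr_ge0 ?pa_ge0// mulr_ge0// ltW// w_cst_gt0.
rewrite mulrAC normrM.
have -> : pa c q (s0 + 1) x = pa c q s0 x * `|x|.
  by rewrite /pa /pe powRD ?normr_eq0 ?x0 ?implybT// powRr1// mulrAC.
rewrite mulrA ler_wpM2r//; have [_] := even_bounded; exact.
Qed.

Lemma integrable_even l : mu.-integrable setT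
  (EFin \o (fun x => g x * w_kn k n x * jbs (al + 1) (L * pw q l * pw q x))).
Proof.
have Cw : 0 <= C * w_cst by rewrite mulr_ge0// ltW// w_cst_gt0.
by have [] := hankel_series c0 q0 weight_exponent_gt Cw alpha_gt L0 (pw_ge0 q l) even_bounded.
Qed.

Let s01 : -1 < s0 + 1.
Proof. by rewrite (lt_trans weight_exponent_gt)// ltrDl. Qed.

Lemma integrable_odd l : mu.-integrable setT
  (EFin \o (fun x => g x * x * w_kn k n x * jbs (al + n%:R + 1) (L * pw q l * pw q x))).
Proof.
have Cw : 0 <= C * w_cst by rewrite mulr_ge0// ltW// w_cst_gt0.
by have [] := hankel_series c0 q0 s01 Cw aln L0 (pw_ge0 q l) odd_bounded.
Qed.

(** The even part gives [g w] the moments of a multiple of the weighted Gaussian, which determines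
    [g x + g (- x)]; the vanishing moments of [g x * x * w] give [g x = g (- x)]. *)
Lemma gauss_bounded_rigidity (b D : R) : a * b = 1 / 4 ->
  (forall l, `|even_part g l| <= D * gauss_n n b l) ->
  (forall l, `|odd_part g l| <= D * gauss_n n b l) ->
  exists l, {ae mu, forall x, g x = l * gauss_n n a x}.
Proof.
move=> ab eD oD.
have Cw : 0 <= C * w_cst by rewrite mulr_ge0// ltW// w_cst_gt0.
(* Criticality enters here: the prescribed rate [n b] is the exponential type [L / c]. *)
have Lc t : n%:R * b * t = L / c * t.
  congr (_ * _); have -> : b = 1 / 4 / a by rewrite -ab mulrC mulKf// gt_eqF.
  by field; rewrite !gt_eqF.
pose root (t : R) := t `^ q^-1.
have rootE t : 0 <= t -> pw q (root t) = t.
  by move=> t0; rewrite /pw ger0_norm ?powR_ge0// -powRrM mulVf ?gt_eqF// powRr1.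
pose ue x := g x * w_kn k n x; pose uo x := g x * x * w_kn k n x.
have be := even_bounded; have bo := odd_bounded.
have I0 := Rintegral_pa_gt0 c0 q0 weight_exponent_gt.
have me := @hankel_rigidity R c q s0 _ (al + 1) L c0 q0 weight_exponent_gt Cw alpha_gt L0 ue D be.
rewrite weight_exponentE in me.
have {}me m : Rintegral mu setT (fun x => ue x * pw q x ^+ m) =
    poch (al + 1) m / c ^+ m * Rintegral mu setT ue.
  apply: me => // t t0; have := eD (root t).
  by rewrite /even_part rootE// gauss_pw rootE// Lc.
have mo : forall m, Rintegral mu setT (fun x => uo x * pw q x ^+ m) = 0.
  apply: (@hankel_rigidity_eq0 R c q (s0 + 1) _ (al + n%:R + 1) L c0 q0 s01 Cw aln L0 uo
    (D / odd_cst) q^-1 bo).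
  (* The extra factor [x] raises [(s + 1) / q] to [alpha + 1 + n / 2], still at most the odd Bessel
     parameter [alpha + n + 1]. *)
  - rewrite mulrDl weight_exponentE invf_div mul1r addrAC lerD2r lerD2l.
    by rewrite ler_pdivrMr// ler_peMr// ?ler1n// ltW.
  - by rewrite invr_gt0.
  - move=> t t0; have := oD (root t); rewrite /odd_part rootE// gauss_pw rootE// Lc.
    rewrite [`|odd_cst * _ * _|]normrM [`|odd_cst * _|]normrM (gtr0_norm odd_cst_gt0).
    rewrite [`|root t|]ger0_norm ?powR_ge0// => h.
    rewrite [leRHS]mulrAC ler_pdivlMr ?odd_cst_gt0//.
    by rewrite mulrC mulrA.
(* Matches the zeroth moments of [ue] and [l' * pa]; by [me] all the others then agree. *)
pose l' := Rintegral mu setT ue / Rintegral mu setT (pa c q s0).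
have bpa : pa_bounded c q s0 `|l'| (fun x => l' * pa c q s0 x).
  split; first by apply: measurable_funM => //; exact: measurable_pa.
  by move=> x; rewrite normrM (ger0_norm (pa_ge0 _ _ _ _)).
pose v x := ue x - l' * pa c q s0 x.
have bv : pa_bounded c q s0 (C * w_cst + `|l'|) v.
  split; first by apply: measurable_funB; [case: be|case: bpa].
  move=> x; apply: (le_trans (ler_normB _ _)); rewrite [leRHS]mulrDl; apply: lerD.
    by case: be => _; exact.
  by case: bpa => _; exact.
have K0 : 0 <= C * w_cst + `|l'| by rewrite addr_ge0.
have mv m : Rintegral mu setT (fun x => v x * pw q x ^+ m) = 0.
  have i1 := integrable_pwX c0 q0 weight_exponent_gt Cw m be.
  have i2 := integrable_pwX c0 q0 weight_exponent_gt (normr_ge0 l') m bpa.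
  transitivity (Rintegral mu setT (fun x => ue x * pw q x ^+ m -
      l' * pa c q s0 x * pw q x ^+ m)).
    by apply: eq_Rintegral => x _; rewrite /v mulrBl.
  rewrite RintegralB// me.
  have -> : Rintegral mu setT (fun x => l' * pa c q s0 x * pw q x ^+ m) =
      l' * Rintegral mu setT (fun x => pa c q s0 x * pw q x ^+ m).
    rewrite -RintegralZl//; first by apply: eq_Rintegral => x _; rewrite mulrA.
    have bp1 : pa_bounded c q s0 1 (pa c q s0).
      by split; [exact: measurable_pa|move=> x; rewrite mul1r ger0_norm ?pa_ge0].
    exact: (integrable_pwX c0 q0 weight_exponent_gt ler01 m bp1).
  rewrite Rintegral_pa_pw// ?weight_exponent_gt// weight_exponentE /l'.
  by rewrite mulrCA divfK ?subrr// gt_eqF.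
have ae_e := moments_eq0 c0 q0 weight_exponent_gt K0 bv mv.
have ae_o := moments_eq0 c0 q0 s01 Cw bo mo.
exists (l' / w_cst).
have key : {ae mu, forall x : R, 0 < x -> g x = l' / w_cst * gauss_n n a x /\
    g (- x) = l' / w_cst * gauss_n n a x}.
  apply: ae_impl (ae_and ae_e ae_o) => x [he ho] x0.
  have wx : 0 < w_kn k n x by rewrite w_gt0// gt_eqF.
  have {}ho : g x = g (- x).
    have := ho x0; rewrite /uo w_opp mulrN mulNr => /eqP; rewrite subr_eq0 => /eqP.
    move/(mulIf (lt0r_neq0 wx)) => /(mulIf (lt0r_neq0 x0)); exact.
  have he' := he x0; rewrite /v /ue w_opp -ho /pa normrN -/(pa c q s0 x) in he'.
  have gw := gauss_w x; have wc := w_cst_gt0.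
  have E : g x * w_kn k n x = l' / w_cst * gauss_n n a x * w_kn k n x.
    rewrite -[RHS]mulrA gw [RHS]mulrA divfK ?gt_eqF//; lra.
  by rewrite -ho; split; exact: (mulIf (lt0r_neq0 wx) E).
have z0 : {ae mu, forall x : R, x != 0}.
  exists [set 0]; split; [exact: measurable_set1|exact: lebesgue_measure_set1|].
  by move=> x /= /negP; rewrite negbK => /eqP.
apply: ae_impl (ae_and z0 (ae_and key (ae_opp key))) => x [x0 [h1 h2]].
have [xp|xn] := ltP 0 x; first by have [] := h1 xp.
have Nx : 0 < - x by rewrite oppr_gt0 lt_neqAle x0 xn.
by have [_] := h2 Nx; rewrite opprK gaussN.
Qed.

End GaussBounded.

Lemma F_knE (f : R -> R[i]) (C l : R) : cmeasurable f -> 0 <= C ->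
  (forall x, nrm (f x) <= C * gauss_n n a x) ->
  F_kn k n f l =
    (even_part (fun x => Re (f x)) l +i* even_part (fun x => Im (f x)) l) +
    (- 'i) ^+ n * (odd_part (fun x => Re (f x)) l +i* odd_part (fun x => Im (f x)) l).
Proof.
move=> [mRe mIm] C0 fC.
have gR x : `|Re (f x)| <= C * gauss_n n a x by rewrite (le_trans (normr_Re_le _)).
have gI x : `|Im (f x)| <= C * gauss_n n a x by rewrite (le_trans (normr_Im_le _)).
have eR := integrable_even mRe C0 gR l; have eI := integrable_even mIm C0 gI l.
have oR := integrable_odd mRe C0 gR l; have oI := integrable_odd mIm C0 gI l.
case E : ((- 'i) ^+ n) => [zr zi].
pose j1 x := jbs (al + 1) (L * pw q l * pw q x).
pose j2 x := jbs (al + n%:R + 1) (L * pw q l * pw q x).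
have BE x : f x * B_kn k n x l * (w_kn k n x)%:C =
   (Re (f x) * w_kn k n x * j1 x + (zr * odd_cst * l * (Re (f x) * x * w_kn k n x * j2 x)
      + - zi * odd_cst * l * (Im (f x) * x * w_kn k n x * j2 x))) +i*
   (Im (f x) * w_kn k n x * j1 x + (zi * odd_cst * l * (Re (f x) * x * w_kn k n x * j2 x)
      + zr * odd_cst * l * (Im (f x) * x * w_kn k n x * j2 x))).
  rewrite B_knE E -/(j1 x) -/(j2 x); case: (f x) => u v; simpc.
  by congr (_ +i* _) => /=; ring.
rewrite /F_kn /cintegral.
have ->: Rintegral mu setT (fun x => Re (f x * B_kn k n x l * (w_kn k n x)%:C)) =
    even_part (fun x => Re (f x)) l + (zr * odd_part (fun x => Re (f x)) l
      + - zi * odd_part (fun x => Im (f x)) l).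
  under eq_Rintegral do rewrite BE/=.
  rewrite RintegralD//; last by apply: integrable_addR => //; exact: integrable_mulR.
  rewrite RintegralD//; try exact: integrable_mulR.
  by rewrite !RintegralZl// /odd_part !mulrA.
have ->: Rintegral mu setT (fun x => Im (f x * B_kn k n x l * (w_kn k n x)%:C)) =
    even_part (fun x => Im (f x)) l + (zi * odd_part (fun x => Re (f x)) l
      + zr * odd_part (fun x => Im (f x)) l).
  under eq_Rintegral do rewrite BE/=.
  rewrite RintegralD//; last by apply: integrable_addR => //; exact: integrable_mulR.
  rewrite RintegralD//; try exact: integrable_mulR.
  by rewrite !RintegralZl// /odd_part !mulrA.
by simpc; congr (_ +i* _); ring.
Qed.

Lemma even_part_opp g l : even_part g (- l) = even_part g l.
Proof. by rewrite /even_part pw_opp. Qed.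

Lemma odd_part_opp g l : odd_part g (- l) = - odd_part g l.
Proof. by rewrite /odd_part pw_opp mulrN mulNr. Qed.

Lemma nrm_NiX : nrm ((- 'i : R[i]) ^+ n) = 1.
Proof. by rewrite nrmX nrmN /nrm/= expr0n add0r expr1n sqrtr1 expr1n. Qed.

(** Sum and difference of the values at [l] and [- l] isolate the two parities, and [(- i)^n] has
    modulus 1. *)
Lemma hardy_parts (f : R -> R[i]) (b C : R) : cmeasurable f -> 0 <= C ->
  (forall x, nrm (f x) <= C * gauss_n n a x) ->
  (forall l, nrm (F_kn k n f l) <= C * gauss_n n b l) ->
  forall l, [/\ `|even_part (fun x => Re (f x)) l| <= C * gauss_n n b l,
    `|even_part (fun x => Im (f x)) l| <= C * gauss_n n b l,
    `|odd_part (fun x => Re (f x)) l| <= C * gauss_n n b l &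
    `|odd_part (fun x => Im (f x)) l| <= C * gauss_n n b l].
Proof.
move=> mf C0 fC FC l; have h1 := FC l; have h2 := FC (- l); rewrite gaussN in h2.
rewrite (F_knE _ mf C0 fC) in h1; rewrite (F_knE _ mf C0 fC) !even_part_opp !odd_part_opp in h2.
set e1 := even_part _ _ in h1 h2 *; set e2 := even_part _ _ in h1 h2 *.
set o1 := odd_part _ _ in h1 h2 *; set o2 := odd_part _ _ in h1 h2 *.
set z := (- 'i) ^+ n in h1 h2.
have oN : (- o1) +i* (- o2) = - (o1 +i* o2) :> R[i] by [].
rewrite oN mulrN in h2.
have n2 (u : R[i]) : nrm (u + u) = 2 * nrm u.
  have -> : u + u = (2 : R)%:C * u by case: u => x y; simpc; congr (_ +i* _); ring.
  by rewrite nrmM nrm_real ger0_norm.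
have hE : nrm (e1 +i* e2) <= C * gauss_n n b l.
  have := nrmD (e1 +i* e2 + z * (o1 +i* o2)) (e1 +i* e2 - z * (o1 +i* o2)).
  rewrite addrACA subrr addr0 n2; lra.
have hO : nrm (o1 +i* o2) <= C * gauss_n n b l.
  have := nrmD (e1 +i* e2 + z * (o1 +i* o2)) (- (e1 +i* e2 - z * (o1 +i* o2))).
  have -> : e1 +i* e2 + z * (o1 +i* o2) - (e1 +i* e2 - z * (o1 +i* o2)) =
    z * (o1 +i* o2) + z * (o1 +i* o2) by ring.
  rewrite nrmN n2 nrmM /z nrm_NiX mul1r; lra.
by split; [apply: le_trans (normr_Re_le (e1 +i* e2)) hE|apply: le_trans (normr_Im_le (e1 +i* e2)) hE
  |apply: le_trans (normr_Re_le (o1 +i* o2)) hO|apply: le_trans (normr_Im_le (o1 +i* o2)) hO].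
Qed.

Lemma hardy_decayP (b : R) f : hardy_decay n k a b f -> cmeasurable f /\ exists2 C, 0 < C &
  (forall x, nrm (f x) <= C * gauss_n n a x) /\ (forall l, nrm (F_kn k n f l) <= C * gauss_n n b l).
Proof.
move=> [mf [C [C0 [h1 h2]]]]; split=> //; exists C => //.
by split => x; rewrite -lecR -nrmE.
Qed.

Lemma hardy_critical (b : R) f : a * b = 1 / 4 -> hardy_decay n k a b f ->
  exists lam : R[i], {ae mu, forall x, f x = lam * (gauss_n n a x)%:C}.
Proof.
move=> ab /hardy_decayP[mf [C C0 [fC FC]]]; have C0' := ltW C0.
have hp := hardy_parts mf C0' fC FC; case: (mf) => mR mI.
have gR x : `|Re (f x)| <= C * gauss_n n a x by rewrite (le_trans (normr_Re_le _)).
have gI x : `|Im (f x)| <= C * gauss_n n a x by rewrite (le_trans (normr_Im_le _)).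
have [l1 h1] : exists l, {ae mu, forall x, Re (f x) = l * gauss_n n a x}.
  by apply: (gauss_bounded_rigidity (D := C) mR C0' gR ab) => l; have [] := hp l.
have [l2 h2] : exists l, {ae mu, forall x, Im (f x) = l * gauss_n n a x}.
  by apply: (gauss_bounded_rigidity (D := C) mI C0' gI ab) => l; have [] := hp l.
exists (l1 +i* l2); apply: ae_impl (ae_and h1 h2) => x.
by case: (f x) => u v /= [-> ->]; simpc.
Qed.

(** The rising factorial in the Gaussian moments cancels the one in the Bessel series, leaving an
    exponential series. *)
Lemma even_part_gauss (l : R) : even_part (gauss_n n a) l =
  w_cst * Rintegral mu setT (pa c q s0) * expR (- (L / c * pw q l)).
Proof.
have g1 x : `|gauss_n n a x| <= 1 * gauss_n n a x by rewrite mul1r ger0_norm// expR_ge0.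
have mG : measurable_fun setT (gauss_n n a).
  apply: (measurableT_comp (@measurable_expR R)); apply: (measurableT_comp (@oppr_measurable R setT)).
  by apply: measurable_funM => //; exact: measurable_pw.
have bu := even_bounded mG g1.
have K0 : 0 <= 1 * w_cst by rewrite mul1r ltW// w_cst_gt0.
have [_ cI] := hankel_series c0 q0 weight_exponent_gt K0 alpha_gt L0 (pw_ge0 q l) bu.
apply: (cvg_unique (@Rhausdorff R) cI).
set I := Rintegral mu setT (pa c q s0).
rewrite (_ : series _ = fun M => w_cst * I * series (exp_coeff (- (L / c * pw q l))) M).
  by apply: cvgM; [exact: cvg_cst|exact: is_cvg_series_exp_coeff].
apply/funext => M; rewrite /series/= mulr_sumr; apply: eq_bigr => m _.
have pb := poch_gt0 m alpha_gt.
have bp1 : pa_bounded c q s0 1 (pa c q s0).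
  by split; [exact: measurable_pa|move=> x; rewrite mul1r ger0_norm ?pa_ge0].
have ip := integrable_pwX c0 q0 weight_exponent_gt ler01 m bp1.
have -> : hcoef q (al + 1) L (fun x => gauss_n n a x * w_kn k n x) m =
    w_cst * I * (- (L / c)) ^+ m.
  rewrite /hcoef (_ : Rintegral mu setT _ =
    w_cst * Rintegral mu setT (fun x => pa c q s0 x * pw q x ^+ m)); last first.
    rewrite -RintegralZl//; apply: eq_Rintegral => x _.
    by rewrite gauss_w mulrA.
  rewrite Rintegral_pa_pw// ?weight_exponent_gt// weight_exponentE -/I.
  have -> : (- (L / c)) ^+ m = (- L) ^+ m / c ^+ m.
    by rewrite -(mulNr L c^-1) [LHS]expr_div_n.
  have cm : c ^+ m != 0 by rewrite expf_neq0// gt_eqF.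
  have pm := lt0r_neq0 pb.
  move: ((- L) ^+ m) (c ^+ m) (poch _ m) cm pm I => u v p v0 p0 I'.
  by field; apply/andP.
have -> : exp_coeff (- (L / c * pw q l)) m = (- (L / c)) ^+ m * pw q l ^+ m / m`!%:R.
  by rewrite /exp_coeff/= -exprMn (mulNr (L / c)).
by rewrite [RHS]mulrA [X in _ = X / _]mulrA.
Qed.

Lemma odd_part_gauss (l : R) : odd_part (gauss_n n a) l = 0.
Proof.
have g1 x : `|gauss_n n a x| <= 1 * gauss_n n a x by rewrite mul1r ger0_norm// expR_ge0.
have mG : measurable_fun setT (gauss_n n a).
  apply: (measurableT_comp (@measurable_expR R)); apply: (measurableT_comp (@oppr_measurable R setT)).
  by apply: measurable_funM => //; exact: measurable_pw.
have io := integrable_odd mG ler01 g1 l.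
have mo := measurable_int mu io.
rewrite /odd_part; set h := fun x => _ in io mo *.
have hN : Rintegral mu setT h = - Rintegral mu setT h.
  rewrite -{1}Rintegral_opp; last by apply/measurable_EFinP.
  rewrite -mulN1r -RintegralZl//; apply: eq_Rintegral => x _.
  by rewrite /h gaussN w_opp pw_opp; ring.
suff -> : Rintegral mu setT h = 0 by rewrite mulr0.
lra.
Qed.

Lemma hardy_gauss (b r : R) : 0 < r -> a * b < 1 / 4 ->
  hardy_decay n k a b (fun x => (r * gauss_n n a x)%:C).
Proof.
move=> r0 ab.
have mG : measurable_fun setT (gauss_n n a).
  apply: (measurableT_comp (@measurable_expR R)); apply: (measurableT_comp (@oppr_measurable R setT)).
  by apply: measurable_funM => //; exact: measurable_pw.
have mf : cmeasurable (fun x => (r * gauss_n n a x)%:C).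
  by split => /=; [exact: measurable_funM|exact: measurable_cst].
have nf x : nrm (r * gauss_n n a x)%:C = r * gauss_n n a x.
  by rewrite nrm_real ger0_norm// mulr_ge0 ?expR_ge0// ltW.
have I0 := Rintegral_pa_gt0 c0 q0 weight_exponent_gt.
pose D := w_cst * Rintegral mu setT (pa c q s0).
have D0 : 0 < D by rewrite mulr_gt0// w_cst_gt0.
(* [r] serves for the function and [r * D] for its transform; the sum covers both. *)
split=> //; exists (r * (1 + D)); split; first by rewrite mulr_gt0// addr_gt0.
split=> x; rewrite nrmE lecR.
  by rewrite nf ler_wpM2r ?expR_ge0// ler_peMr ?(ltW r0)// lerDl ltW.
have fC y : nrm (r * gauss_n n a y)%:C <= r * gauss_n n a y by rewrite nf.
rewrite (F_knE _ mf (ltW r0) fC).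
have g1 y : `|gauss_n n a y| <= 1 * gauss_n n a y by rewrite mul1r ger0_norm// expR_ge0.
have -> : even_part (fun y => Re (r * gauss_n n a y)%:C) x = r * even_part (gauss_n n a) x.
  rewrite /even_part -RintegralZl//; last exact: (integrable_even mG ler01 g1).
  by apply: eq_Rintegral => y _ /=; rewrite !mulrA.
have -> : odd_part (fun y => Re (r * gauss_n n a y)%:C) x = r * odd_part (gauss_n n a) x.
  rewrite /odd_part [RHS]mulrCA -[r * _]RintegralZl//; last exact: (integrable_odd mG ler01 g1).
  by congr (_ * _); apply: eq_Rintegral => y _ /=; rewrite !mulrA.
have -> : even_part (fun y => Im (r * gauss_n n a y)%:C) x = 0.
  rewrite /even_part (_ : (fun _ => _) = cst 0) ?Rintegral_cst ?mul0r//.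
  by apply/funext => y; rewrite /= !mul0r.
have -> : odd_part (fun y => Im (r * gauss_n n a y)%:C) x = 0.
  rewrite /odd_part (_ : (fun _ => _) = cst 0) ?Rintegral_cst ?mul0r ?mulr0//.
  by apply/funext => y; rewrite /= !mul0r.
rewrite odd_part_gauss mulr0 -[0 +i* 0]/(0 : R[i]) mulr0 addr0 even_part_gauss -/D.
rewrite -[_ +i* 0]/(_%:C) nrm_real ger0_norm; last first.
  by rewrite (mulr_ge0 (ltW r0))// (mulr_ge0 (ltW D0))// expR_ge0.
rewrite -[r * (1 + D) * _]mulrA ler_wpM2l ?(ltW r0)//.
apply: ler_pM; rewrite ?expR_ge0 ?(ltW D0) ?lerDr//.
rewrite gauss_pw ler_expR lerN2 ler_wpM2r ?pw_ge0//.
have -> : L / c = n%:R / (4 * a) by field; rewrite !gt_eqF.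
rewrite ler_wpM2l ?(ltW n0)// -[X in b <= X]mul1r ler_pdivlMr ?mulr_gt0//; lra.
Qed.

End HardyKernel.

(** A null set cannot contain a half-line. This extracts from an almost everywhere identity a point
    as far out as needed. *)
Lemma ae_exists_gt (R : realType) (P : R -> Prop) (M : R) :
  {ae (@lebesgue_measure R), forall x, P x} -> exists2 x, M < x & P x.
Proof.
move=> [N [mN N0 NP]]; apply: contrapT => nP.
have : (lebesgue_measure (`]M, +oo[%classic : set R) <= lebesgue_measure N)%E.
  apply: le_measure; rewrite ?inE//.
  move=> x /=; rewrite in_itv/= andbT => Mx; apply: NP => /= Px.
  by apply: nP; exists x.
by rewrite N0 lebesgue_measure_itv/= ltey/= leNgt ltey.
Qed.

(** * The three regimes of [ab] *)

Unset Implicit Arguments.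

Theorem theorem1p1 (R : realType) (n : nat) (k a b : R) :
  (1 <= n)%N ->
  (n%:R - 1) / (2 * n%:R) <= k ->
  0 < a -> 0 < b ->
  (1 / 4 < a * b ->
     forall f : R -> R[i], hardy_decay n k a b f ->
       {ae (@lebesgue_measure R), forall x, f x = 0}) /\
  (a * b = 1 / 4 ->
     forall f : R -> R[i], hardy_decay n k a b f ->
       exists lam : R[i],
         {ae (@lebesgue_measure R), forall x, f x = lam * (gauss_n n a x)%:C}) /\
  (a * b < 1 / 4 ->
     exists g : nat -> R -> R[i],
       (forall i, hardy_decay n k a b (g i)) /\
       (forall i j, i <> j ->
          ~ {ae (@lebesgue_measure R), forall x, g i x = g j x})).
Proof.
move=> n1 kn a0 b0; have n0 : (0 : R) < n%:R by rewrite ltr0n.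
split; [|split].
(* The pair [(a', b)] is critical, and [a' < a] weakens the decay asked of [f]. *)
- move=> ab f hf; pose a' := 1 / (4 * b).
  have a'0 : 0 < a' by rewrite divr_gt0// mulr_gt0.
  have a'b : a' * b = 1 / 4 by rewrite /a'; field; rewrite gt_eqF.
  have a'a : a' < a by rewrite ltr_pdivrMr ?mulr_gt0//; lra.
  have [mf [C C0 [fC FC]]] := hardy_decayP hf.
  have hf' : hardy_decay n k a' b f.
    split => //; exists C; split => //; split => x; rewrite nrmE lecR//.
    apply: (le_trans (fC x)); rewrite ler_wpM2l ?(ltW C0)// ler_expR lerN2.
    by rewrite ler_wpM2r ?powR_ge0// ler_wpM2l ?(ltW n0)// ltW.
  have [lam fl] := hardy_critical n1 kn a'0 a'b hf'.
  suff l0 : lam = 0 by apply: ae_impl fl => x ->; rewrite l0 mul0r.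
  apply/eqP; rewrite -normr_eq0 nrmE -[0]/(0%:C); apply/eqP; congr (_%:C).
  apply/eqP; rewrite eq_le nrm_ge0 andbT leNgt; apply/negP => l0.
  pose e := n%:R * (a - a'); have e0 : 0 < e by rewrite mulr_gt0// subr_gt0.
  (* Beyond [M] the ratio of the two Gaussians, [exp (e |x|^q)] with [q = 2/n], exceeds [C / |lam|],
     which contradicts the original decay of [f]. *)
  pose M := (C / nrm lam / e) `^ (2 / n%:R)^-1.
  have [x Mx fx] := ae_exists_gt M fl.
  have M0 : 0 <= C / nrm lam / e by rewrite !divr_ge0// ltW.
  have x0 : 0 < x by rewrite (le_lt_trans _ Mx)// powR_ge0.
  have y1 : C / nrm lam / e < pw (2 / n%:R) x.
    have q0 : 0 < 2 / n%:R :> R by rewrite divr_gt0.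
    have -> : C / nrm lam / e = M `^ (2 / n%:R).
      by rewrite /M -powRrM mulVf ?gt_eqF// powRr1.
    rewrite /pw (gtr0_norm x0).
    by apply: gt0_ltr_powR; rewrite ?nnegrE ?powR_ge0 ?(ltW x0).
  have := fC x; rewrite fx nrmM nrm_real ger0_norm ?expR_ge0// !gauss_pw.
  have -> : - (n%:R * a * pw (2 / n%:R) x) =
    - (e * pw (2 / n%:R) x) - n%:R * a' * pw (2 / n%:R) x by rewrite /e; ring.
  rewrite expRD [C * _]mulrA ler_pM2r ?expR_gt0// expRN ler_pdivlMr ?expR_gt0//.
  rewrite leNgt => /negP; apply.
  have : C / nrm lam < expR (e * pw (2 / n%:R) x).
    apply: (lt_le_trans _ (expR_ge1Dx _)).
    by move: y1; rewrite ltr_pdivrMr// mulrC; lra.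
  by rewrite ltr_pdivrMr// mulrC.
- by move=> ab f hf; exact: (hardy_critical n1 kn a0 ab hf).
- move=> ab; exists (fun i x => (i.+1%:R * gauss_n n a x)%:C); split.
    by move=> i; apply: hardy_gauss => //; rewrite ltr0n.
  (* Distinct multiples of a positive function differ everywhere, so a single point of agreement is
     enough. *)
  move=> i j ij h; have [x _ /complexI e] := ae_exists_gt 0 h.
  apply: ij; have g0 : gauss_n n a x != 0 by rewrite gt_eqF// expR_gt0.
  by move/(mulIf g0): e => /eqP; rewrite eqr_nat eqSS => /eqP.
Qed.
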